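(* Let $T$ be Chacon's automorphism and $(h_n)_{n\ge0}$ the heights of its towers ($h_0=1$, $h_{n+1}=3h_n+1$). Let $(k_j)$ be a sequence of positive integers with $k_j\to+\infty$ such that $\hat T^{-k_j}$ converges weakly to an operator $L$. For each $j$ let $$k_j=\alpha_0^jh_{n_j}+\alpha_1^jh_{n_j-1}+\cdots+\alpha_{n_j}^jh_0$$ be the greedy expansion of $k_j$ along the integers $(h_n)$, and assume that for every $\ell\ge0$ the sequence $(\alpha_\ell^j)_j$ converges (i.e. is eventually constant) to some $\alpha_\ell$ as $j\to\infty$. 1. If there exists $r$ such that $\alpha_\ell=2$ for all $\ell>r$, or $\alpha_\ell=0$ for all $\ell>r$, then there exist an integer $m\ge1$ and a sequence of integers $(k_j')$ such that $\hat T^{-k_j'}$ converges weakly to an operator $L'$ and $$\lim_{j\to\infty}\hat T^{-k_j}=P_m(\hat T)\,L'.$$ 2. If there exist infinitely many $\ell$ such that $\alpha_\ell\ne2$ and infinitely many $\ell$ such that $\alpha_\ell\neq0$, then $L=\Theta$.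
   Context: Chacon's (classical) automorphism $T$ of a probability space $(X,\mathscr A,\mu)$ is the rank-one transformation built by cutting and stacking. Tower $0$ is a single interval (height $h_0=1$) of measure $2/3$. For $n\ge1$, Tower $n-1$ (of height $h_{n-1}$) is cut into 3 sub-columns of equal width, one spacer (a new interval of the same width) is inserted above the middle sub-column, and the three parts are stacked from left to right to give Tower $n$, of height $h_n=3h_{n-1}+1$. $X$ is the union of all the towers (total measure $1$), and $T$ maps each level of each tower, other than its top level, by translation onto the level above it. $T$ is an invertible measure-preserving transformation (defined a.e.). Koopman operator: $\hat T f=f\circ T$ on $L^2(X,\mu)$. $\Theta f=\int f\,d\mu$ is the orthogonal projection onto constants. Weak convergence is convergence in the weak operator topology on $L^2(X,\mu)$. Greedy expansion of a positive integer $k$: $n$ is the largest index with $h_n\le k$; $\alpha_0=\lfloor k/h_n\rfloor\neq0$, and then the remainder is divided successively by $h_{n-1},\dots,h_0$ with quotients $\alpha_1,\dots,\alpha_n$. One has $0\le\alpha_\ell\le3$, and if $\alpha_\ell=3$ then $\alpha_s=0$ for all $s>\ell$. (For fixed $\ell$, $\alpha^j_\ell$ is defined for all large $j$ since $n_j\to\infty$.) Polynomials $P_m$: let $\Gamma=\mathbb Z_3=\{x=(x_0,x_1,\dots):x_k\in\{0,1,2\}\}$ be the compact group of 3-adic integers, $\lambda$ its Haar probability measure, and $Sx=x+1$. Let $\phi(x)\in\{0,1\}$ be the first coordinate of $x$ different from $2$ (defined for $x\neq(2,2,\dots)$). Set $\phi^{(0)}=0$ and $\phi^{(m)}(x)=\phi(x)+\phi(Sx)+\cdots+\phi(S^{m-1}x)$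 for $m\ge1$ (defined $\lambda$-a.e.). Let $\pi_m(j)=\lambda(\phi^{(m)}=j)$ and $P_m(X)=\sum_{j=0}^m\pi_m(j)X^j$. *)

(* Defs.v *)
From HB Require Import structures.
From mathcomp Require Import all_boot all_order all_algebra.
From mathcomp Require Import all_classical all_reals all_analysis.
Set Implicit Arguments.
Unset Strict Implicit.
Unset Printing Implicit Defensive.
Import Order.TTheory GRing.Theory Num.Theory.
Import numFieldNormedType.Exports.
Local Open Scope classical_set_scope.
Local Open Scope ring_scope.

(** * Cutting and stacking

    The intervals are realised inside [0, 1[: Tower 0 is [0, 2/3[, and the
    spacers are laid side by side to the right of it.  The spacer added when
    Tower n.+1 is built has the width 2/3 * 3^-(n.+1) of a level of that tower,
    so that it starts at 2/3 + \sum_(1 <= i <= n) 2/3 * 3^-i = 1 - 3^-(n.+1). *)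

Fixpoint height (n : nat) : nat :=
  if n is n'.+1 then (3 * height n' + 1)%N else 1%N.

Section Towers.
Variable R : realType.

Definition width (n : nat) : R := 2 / 3 / 3 ^+ n.

Definition spacer (n : nat) : R := 1 - (3 ^+ n)^-1.

(* The left endpoints of the levels of Tower n, from bottom to top. *)
Fixpoint bases (n : nat) : seq R :=
  if n is n'.+1 then
    bases n' ++ [seq b + width n | b <- bases n'] ++ [:: spacer n] ++
    [seq b + 2 * width n | b <- bases n']
  else [:: 0].

Definition base (n i : nat) : R := nth 0 (bases n) i.

Definition level (n i : nat) : set R :=
  [set` `[base n i, base n i + width n[].

Lemma size_bases n : size (bases n) = height n.
Proof.
elim: n => //= n IH; rewrite !size_cat /= !size_map IH.
by rewrite addnS addn1 !mulSn mul0n addn0 !addnS.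
Qed.

(* The towers are compatible: the value below does not depend on the choice of
   n and i.  No point of [0, 1[ is on the top level of every tower, so that the
   fallback value x is only used outside of [0, 1[. *)
Definition chacon (x : R) : R :=
  xget x [set y | exists n i, [/\ (i.+1 < height n)%N, level n i x
                                & y = x - base n i + base n i.+1]].

(* Here the fallback value is used outside of [0, 1[ and at 0, which is the
   only point lying on the bottom level of every tower. *)
Definition chacon_inv (x : R) : R :=
  xget x [set y | exists n i, [/\ (i.+1 < height n)%N, level n i.+1 x
                                & y = x - base n i.+1 + base n i]].

(** * The probability space *)

Definition chacon_prob : set (measurableTypeR R) -> \bar R :=
  mrestr lebesgue_measure (measurable_itv `[0 : R, 1[).

HB.instance Definition _ := Measure.on chacon_prob.

Lemma chacon_prob_setT : chacon_prob [set: _] = 1%E.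
Proof.
by rewrite /chacon_prob /mrestr setTI lebesgue_measure_itv /= lte01 sube0.
Qed.

HB.instance Definition _ := Measure_isProbability.Build _ _ R chacon_prob chacon_prob_setT.

(** * Operators on L^2

    Elements of L^2 are represented by functions in [Lfun chacon_prob 2%:E] and
    equality in L^2 is equality almost everywhere. *)

Definition L2 : {pred (R -> R)} := Lfun chacon_prob 2%:E.

Definition L2_eq (f g : R -> R) : Prop := f = g %[ae chacon_prob].

(* Linearity and boundedness make L compatible with [L2_eq]. *)
Record L2_operator (L : (R -> R) -> (R -> R)) : Prop := {
  L2_operator_stable : forall f, f \in L2 -> L f \in L2;
  L2_operator_linear : forall (a : R) f g, f \in L2 -> g \in L2 ->
    L2_eq (L (fun x => a * f x + g x)) (fun x => a * L f x + L g x);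
  L2_operator_bounded : exists c : R, forall f, f \in L2 ->
    ('N[chacon_prob]_2%:E[EFin \o L f] <= c%:E * 'N[chacon_prob]_2%:E[EFin \o f])%E
}.

Definition L2_operator_eq (L M : (R -> R) -> (R -> R)) : Prop :=
  forall f, f \in L2 -> L2_eq (L f) (M f).

Definition weak_cvg (A : nat -> (R -> R) -> (R -> R))
    (L : (R -> R) -> (R -> R)) : Prop :=
  forall f g, f \in L2 -> g \in L2 ->
    (\int[chacon_prob]_x (A j f x * g x)) @[j --> \oo] -->
    \int[chacon_prob]_x (L f x * g x).

Definition koopman (f : R -> R) : R -> R := f \o chacon.

Definition koopman_pow (k : int) (f : R -> R) : R -> R :=
  match k with
  | Posz n => f \o iter n chacon
  | Negz n => f \o iter n.+1 chacon_inv
  end.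

Definition Theta (f : R -> R) : R -> R := cst (\int[chacon_prob]_x f x).

Definition poly_op (p : {poly R}) (A : (R -> R) -> (R -> R)) (f : R -> R) :
    R -> R :=
  fun x => \sum_(i < size p) p`_i * iter i A f x.

End Towers.

(** * Greedy expansion along the heights *)

(* For k > 0, the largest n with height n <= k; such an n is less than k. *)
Definition greedy_index (k : nat) : nat :=
  \max_(n < k | (height n <= k)%N) n.

Fixpoint greedy_rem (k l : nat) : nat :=
  if l is l'.+1 then (greedy_rem k l' %% height (greedy_index k - l'))%N else k.

(* Meaningful for l <= greedy_index k; equal to 0 for larger l. *)
Definition greedy_digit (k l : nat) : nat :=
  (greedy_rem k l %/ height (greedy_index k - l))%N.

(** * The 3-adic integers and the polynomials P_m *)

Definition z3 : Type := nat -> 'I_3.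
HB.instance Definition _ := Choice.copy z3 (nat -> 'I_3).
HB.instance Definition _ := isPointed.Build z3 (fun=> ord0).

(* The sigma-algebra generated by the coordinates, that is, the Borel
   sigma-algebra of the product topology. *)
Definition z3_cylinders : set (set z3) :=
  [set A | exists n (a : 'I_3), A = [set x | x n = a]].

HB.instance Definition _ := @isMeasurable.Build (sigma_display z3_cylinders)
  z3 <<s z3_cylinders >> (@sigma_algebra0 _ setT z3_cylinders)
  (@sigma_algebraC _ z3_cylinders) (@sigma_algebra_bigcup _ setT z3_cylinders).

Fixpoint z3_carry (x y : z3) (n : nat) : bool :=
  if n is n'.+1 then (2 < x n' + y n' + z3_carry x y n')%N else false.

Definition z3_add (x y : z3) : z3 :=
  fun n => inZp (x n + y n + z3_carry x y n).

Definition z3_one : z3 := fun n => inZp (n == 0%N).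

Definition z3_succ (x : z3) : z3 := z3_add x z3_one.

Definition z3_haar (R : realType) (lam : probability z3 R) : Prop :=
  forall (y : z3) (A : set z3), measurable A ->
    lam (z3_add y @^-1` A) = lam A.

(* The first coordinate different from 2, with value 0 at (2, 2, ...). *)
Definition phi (x : z3) : nat :=
  if pselect (exists n, (x n : nat) != 2%N) is left e
  then x (ex_minn e) else 0%N.

Definition phi_sum (m : nat) (x : z3) : nat :=
  (\sum_(i < m) phi (iter i z3_succ x))%N.

Definition chacon_poly (R : realType) (lam : probability z3 R) (m : nat) :
    {poly R} :=
  \poly_(j < m.+1) fine (lam [set x | phi_sum m x = j]).

(* Main.v *)
Require Import Defs.
From HB Require Import structures.
From mathcomp Require Import all_boot all_order all_algebra.
From mathcomp Require Import all_classical all_reals all_analysis.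
From mathcomp Require Import measurable_realfun lebesgue_integral_differentiation.
From mathcomp Require Import ring lra zify.
Set Implicit Arguments.
Unset Strict Implicit.
Unset Printing Implicit Defensive.
Import Order.TTheory GRing.Theory Num.Theory.
Import numFieldNormedType.Exports.
Local Open Scope classical_set_scope.
Local Open Scope ring_scope.

(** Why the theorem holds.

    Tower n + s consists of 3^s copies of Tower n, separated by at most one
    spacer: between the copies of ranks t and t + 1 there are [gap t] spacers,
    where [gap t] is the first ternary digit of t different from 2, that is, the
    function phi of the 3-adic odometer read on integers.  Hence a point of
    level i of Tower n that goes back through q copies of Tower n also crosses
    [gap_sum b q] spacers, where b is the rank of the copy in which it arrives.
    When s grows, b is uniform on an interval of length 3^s and [gap_sum b q]
    tends in law to the distribution with generating polynomial P_q
    ([chacon_poly_gap]).  For step functions f and g of a lower tower this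
    expresses the correlation of f o T^-k and g, up to a small error, through
    the polynomials P_q, where q depends on the level ([corr_bound]).

    Part 1.  If the digits of k_j are eventually all 0 or all 2, then
    k_j = m h_n + k'_j with |k'_j| small with respect to h_n
    ([small_remainder]): for zeros m is the ternary number formed by the first
    digits, and for twos it is that number plus 1, because
    2 h_(n-1) + ... + 2 h_(n-s) differs from h_n by h_(n-s) + s only.  For most
    levels the number of copies crossed is then exactly m, and T^-k_j is weakly
    close to P_m(T) T^-k'_j ([corr_factor_cvg]).  A weak limit L' of T^-k'_j
    along a subsequence ([koopman_weak_compact]) satisfies L = P_m(T) L'.

    Part 2.  In general nearly every level crosses q = m or q = m + 1 copies, where m
    is the ternary number formed by the first digits.  Replacing k by k + 1
    shifts P_q by one degree, so it changes the correlations by at most the sum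
    of the norms of (1 - X) P_m and (1 - X) P_(m+1), up to a small error, the
    norm being the sum of the absolute values of the coefficients
    ([corr_shift_bound]).  The substitution structure of [gap] gives
    P_(3m) = X^m P_m, 3 P_(3m+1) = X^m ((1 + X) P_m + P_(m+1)) and
    3 P_(3m+2) = X^m (X P_m + (1 + X) P_(m+1)): reading one or two more digits
    convolves a part of the laws with a fair coin, and this happens infinitely
    often for both m and m + 1 unless the digits end with zeros or with twos.  Many fair
    coins make a law almost invariant under the shift ([coin_decay]), so the two
    norms tend to 0 ([shift_defect_decay]).  Therefore L f is invariant under T,
    hence constant by ergodicity ([invariant_cst]), and L is the projection onto
    the constants.

    All these limits are computed on indicators of levels and extended to L^2
    by density of the step functions ([step_dense], [L2_bilinear_dense]).  Weak
    compactness rests on the representation of bounded functionals of L^2,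
    obtained from the Radon-Nikodym theorem ([riesz]). *)

(** * Spacers between the copies of a tower *)

(** Last nonzero ternary digit of t + 1, minus 1; equivalently, the first
    ternary digit of t different from 2.  In Tower n + s, seen as 3^s copies of
    Tower n, it is the number of spacers between the copies of ranks t and
    t + 1. *)
Definition gap (t : nat) : nat := ((t.+1 %/ 3 ^ logn 3 t.+1) %% 3).-1.

Lemma gap3 b : gap (3 * b) = 0%N.
Proof.
rewrite /gap lognE /=.
have -> : (3 %| (3 * b).+1)%N = false by apply/negP; lia.
by rewrite ?andbF expn0 divn1 -addn1 mulnC modnMDl.
Qed.

Lemma gap31 b : gap (3 * b + 1) = 1%N.
Proof.
rewrite /gap lognE /=.
have -> : (3 %| (3 * b + 1).+1)%N = false by apply/negP; lia.
by rewrite ?andbF expn0 divn1 -addnS mulnC modnMDl.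
Qed.

Lemma gap32 b : gap (3 * b + 2) = gap b.
Proof.
rewrite /gap (_ : (3 * b + 2).+1 = 3 * b.+1)%N; last by lia.
by rewrite lognM // logn_prime //= add1n expnS divnMl.
Qed.

Lemma gap_le1 t : (gap t <= 1)%N.
Proof. by rewrite /gap; have := ltn_pmod (t.+1 %/ 3 ^ logn 3 t.+1) (isT : 0 < 3)%N; lia. Qed.

Definition gap_sum (a q : nat) : nat := (\sum_(i < q) gap (a + i))%N.

Lemma gap_sum0 a : gap_sum a 0 = 0%N.
Proof. by rewrite /gap_sum big_ord0. Qed.

Lemma gap_sumS a q : gap_sum a q.+1 = (gap_sum a q + gap (a + q))%N.
Proof. by rewrite /gap_sum big_ord_recr. Qed.

Lemma gap_sumD a p q : gap_sum a (p + q) = (gap_sum a p + gap_sum (a + p) q)%N.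
Proof.
elim: q => [|q IH]; first by rewrite addn0 gap_sum0 addn0.
by rewrite addnS !gap_sumS IH !addnA.
Qed.

Lemma gap_sum_le a q : (gap_sum a q <= q)%N.
Proof.
elim: q => [|q IH]; first by rewrite gap_sum0.
by rewrite gap_sumS -addn1 leq_add // gap_le1.
Qed.

(** Three consecutive gaps contain the gaps 0, 1 and one gap of the coarser
    tower, wherever the block starts. *)
Lemma gap_sum3 a c m : (c < 3)%N -> gap_sum (3 * a + c) (3 * m) = (m + gap_sum a m)%N.
Proof.
move=> c3; elim: m => [|m IH]; first by rewrite muln0 !gap_sum0.
rewrite mulnS (addnC 3) gap_sumD IH (gap_sumS a).
rewrite (_ : gap_sum _ 3 = (gap (a + m)).+1); first by lia.
rewrite !gap_sumS gap_sum0 add0n addn0.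
case: c c3 {IH} => [|[|[|//]]] _.
- rewrite addn0 -mulnDr gap3 gap31 gap32; lia.
- rewrite (_ : (3 * a + 1 + 3 * m = 3 * (a + m) + 1)%N); last by lia.
  rewrite gap31 (_ : (3 * (a + m) + 1 + 1 = 3 * (a + m) + 2)%N); last by lia.
  rewrite gap32 (_ : (3 * (a + m) + 1 + 2 = 3 * (a + m).+1)%N); last by lia.
  by rewrite gap3; lia.
- rewrite (_ : (3 * a + 2 + 3 * m = 3 * (a + m) + 2)%N); last by lia.
  rewrite gap32 (_ : (3 * (a + m) + 2 + 1 = 3 * (a + m).+1)%N); last by lia.
  rewrite gap3 (_ : (3 * (a + m) + 2 + 2 = 3 * (a + m).+1 + 1)%N); last by lia.
  by rewrite gap31; lia.
Qed.

(** Here and below, the three residues of the starting point modulo 3 give the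
    three terms of the recursion of the laws. *)
Lemma gap_sum31 a m :
  [/\ gap_sum (3 * a) (3 * m + 1) = (m + gap_sum a m)%N,
      gap_sum (3 * a + 1) (3 * m + 1) = (m + (gap_sum a m).+1)%N &
      gap_sum (3 * a + 2) (3 * m + 1) = (m + gap_sum a m.+1)%N].
Proof.
have := @gap_sum3 a 0 m isT; rewrite addn0 => e0.
rewrite addn1 !gap_sumS e0 !gap_sum3 // -mulnDr gap3.
rewrite (_ : (3 * a + 1 + 3 * m = 3 * (a + m) + 1)%N); last by lia.
rewrite (_ : (3 * a + 2 + 3 * m = 3 * (a + m) + 2)%N); last by lia.
by rewrite gap31 gap32; split; lia.
Qed.

Lemma gap_sum32 a m :
  [/\ gap_sum (3 * a) (3 * m + 2) = (m + (gap_sum a m).+1)%N,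
      gap_sum (3 * a + 1) (3 * m + 2) = (m + (gap_sum a m.+1).+1)%N &
      gap_sum (3 * a + 2) (3 * m + 2) = (m + gap_sum a m.+1)%N].
Proof.
rewrite (_ : 3 * m + 2 = (3 * m + 1).+1)%N; last by lia.
rewrite !(gap_sumS _ (3 * m + 1)).
have [-> -> ->] := gap_sum31 a m.
rewrite (_ : (3 * a + (3 * m + 1) = 3 * (a + m) + 1)%N); last by lia.
rewrite (_ : (3 * a + 1 + (3 * m + 1) = 3 * (a + m) + 2)%N); last by lia.
rewrite (_ : (3 * a + 2 + (3 * m + 1) = 3 * (a + m).+1)%N); last by lia.
by rewrite gap31 gap32 gap3 gap_sumS; split; lia.
Qed.

Section GapPoly.
Variable R : realType.

(** Generating polynomial of the law of [gap_sum a q] for a uniform below 3^s. *)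
Definition gap_poly (s q : nat) : {poly R} :=
  (3 ^+ s)^-1 *: \sum_(a < 3 ^ s) 'X^(gap_sum a q).

Lemma sum_mul3 (V : nmodType) (F : nat -> V) N :
  \sum_(a < 3 * N) F a =
  \sum_(a < N) (F (3 * a)%N + F (3 * a + 1)%N + F (3 * a + 2)%N).
Proof.
elim: N => [|N IH]; first by rewrite muln0 !big_ord0.
rewrite mulnS (addnC 3) addn3 !big_ord_recr /= IH.
rewrite (_ : (3 * N).+1 = 3 * N + 1)%N; last by lia.
by rewrite (_ : (3 * N + 1).+1 = 3 * N + 2)%N ?addrA; last by lia.
Qed.

Lemma gap_polyS s q : gap_poly s.+1 q =
  3^-1 *: ((3 ^+ s)^-1 *: \sum_(a < 3 ^ s) ('X^(gap_sum (3 * a) q) +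
   'X^(gap_sum (3 * a + 1) q) + 'X^(gap_sum (3 * a + 2) q))).
Proof.
rewrite /gap_poly scalerA exprS invfM expnS; congr (_ *: _).
by rewrite -[in RHS](sum_mul3 (fun a => 'X^(gap_sum a q) : {poly R})).
Qed.

Lemma gap_poly3 s m : gap_poly s.+1 (3 * m) = 'X^m * gap_poly s m.
Proof.
rewrite gap_polyS /gap_poly scalerA mulrC -scalerA -scalerAr.
congr (_ *: _); rewrite mulr_sumr scaler_sumr; apply: eq_bigr => a _.
have := @gap_sum3 a 0 m isT; rewrite addn0 => ->; rewrite !gap_sum3 // !exprD.
set x := _ * _; have -> : x + x + x = 3 *: x by rewrite scaler_nat !mulrS; ring.
by rewrite scalerA mulVf ?scale1r // pnatr_eq0.
Qed.

Lemma gap_poly31 s m : gap_poly s.+1 (3 * m + 1) =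
  3^-1 *: ('X^m * ((1 + 'X) * gap_poly s m + gap_poly s m.+1)).
Proof.
rewrite gap_polyS /gap_poly; congr (_ *: _).
rewrite -!scalerAr -scalerDr -scalerAr; congr (_ *: _).
rewrite !mulr_sumr -big_split mulr_sumr; apply: eq_bigr => a _ /=.
by have [-> -> ->] := gap_sum31 a m; rewrite !exprD exprS; ring.
Qed.

Lemma gap_poly32 s m : gap_poly s.+1 (3 * m + 2) =
  3^-1 *: ('X^m * ('X * gap_poly s m + (1 + 'X) * gap_poly s m.+1)).
Proof.
rewrite gap_polyS /gap_poly; congr (_ *: _).
rewrite -!scalerAr -scalerDr -scalerAr; congr (_ *: _).
rewrite !mulr_sumr -big_split mulr_sumr; apply: eq_bigr => a _ /=.
by have [-> -> ->] := gap_sum32 a m; rewrite !exprD !exprS; ring.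
Qed.

End GapPoly.

(** * Averaging with a fair coin *)

Section L1Norm.
Variable R : realType.
Implicit Types (p q : {poly R}).

Definition l1norm p : R := \sum_(i < size p) `|p`_i|.

Lemma l1normE n p : (size p <= n)%N -> l1norm p = \sum_(i < n) `|p`_i|.
Proof.
move=> pn; rewrite /l1norm -(subnKC pn) big_split_ord /= [X in _ = _ + X]big1 ?addr0 //.
by move=> i _; rewrite nth_default ?normr0 // leq_addr.
Qed.

Lemma l1norm_ge0 p : 0 <= l1norm p.
Proof. exact: sumr_ge0. Qed.

Lemma l1normD p q : l1norm (p + q) <= l1norm p + l1norm q.
Proof.
set n := maxn (size p) (size q).
rewrite (@l1normE n (p + q)) ?size_polyD // (@l1normE n p) ?leq_maxl //.
rewrite (@l1normE n q) ?leq_maxr // -big_split ler_sum // => i _.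
by rewrite coefD ler_normD.
Qed.

Lemma l1normZ c p : l1norm (c *: p) = `|c| * l1norm p.
Proof.
rewrite (@l1normE (size p)) ?size_scale_leq // mulr_sumr; apply: eq_bigr => i _.
by rewrite coefZ normrM.
Qed.

Lemma l1normXnM n p : l1norm ('X^n * p) = l1norm p.
Proof.
rewrite (@l1normE (n + size p)); last first.
  by apply: leq_trans (size_polyMleq _ _) _; rewrite size_polyXn.
rewrite big_split_ord /= big1 ?add0r => [|i _]; last by rewrite coefXnM ltn_ord normr0.
by apply: eq_bigr => i _; rewrite coefXnM ltnNge leq_addr /= addKn.
Qed.

Lemma l1normM p q : l1norm (p * q) <= l1norm p * l1norm q.
Proof.
rewrite -{1}(coefK p) poly_def mulr_suml.
have H n (F : 'I_n -> {poly R}) : l1norm (\sum_(i < n) F i) <= \sum_(i < n) l1norm (F i).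
  elim: n F => [|n IH] F; first by rewrite !big_ord0 /l1norm size_poly0 big_ord0.
  by rewrite !big_ord_recr /=; apply: le_trans (l1normD _ _) _; rewrite lerD2r.
apply: le_trans (H _ _) _; rewrite [X in _ <= X * _]/l1norm mulr_suml ler_sum // => i _.
by rewrite -scalerAl l1normZ l1normXnM.
Qed.

Lemma l1norm1 : l1norm 1 = 1.
Proof. by rewrite /l1norm size_poly1 big_ord1 coef1 normr1. Qed.

(** Law of a fair coin; multiplication of generating polynomials is convolution. *)
Definition coin : {poly R} := 2^-1 *: (1 + 'X).

Lemma l1norm_coin_le : l1norm coin <= 1.
Proof.
rewrite /coin l1normZ ger0_norm ?invr_ge0 //.
have X1 : l1norm 'X = 1 by rewrite -['X]mulr1 -['X]expr1 l1normXnM l1norm1.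
by have := l1normD 1 'X; rewrite l1norm1 X1 ler_pdivrMl // mulr1.
Qed.

(** Differences of consecutive binomial coefficients, in a form in which the
    deviation from the mean appears. *)
Lemma coef_binom_diff i j :
  ((1 - 'X) * (1 + 'X) ^+ i : {poly R})`_j =
  'C(i.+1, j)%:R * (i.+1%:R - 2 * j%:R) / i.+1%:R.
Proof.
have cE n k : ((1 + 'X) ^+ n : {poly R})`_k = 'C(n, k)%:R.
  rewrite exprDn coef_sum.
  under eq_bigr do rewrite expr1n mul1r coefMn coefXn.
  case: (ltnP k n.+1) => kn; last first.
    rewrite bin_small // big1 // => l _; case: eqP => [e|_]; last by rewrite mul0rn.
    by have := ltn_ord l; rewrite -e ltnNge kn.
  rewrite (bigD1 (Ordinal kn)) //= eqxx big1 ?addr0 // => l lk.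
  by case: eqP => [e|_]; [move: lk; rewrite -val_eqE /= e eqxx | rewrite mul0rn].
have i0 : (i.+1%:R : R) != 0 by rewrite pnatr_eq0.
apply: (mulIf i0); rewrite mulfVK // mulrBl mul1r coefB coefXM !cE.
case: j => [|j] /=; first by rewrite subr0 mulr0 subr0 !bin0.
have h1 := mul_bin_diag i j; have h2 := binS i j.
have h3 : (j.+1 * 'C(i, j.+1) + j * 'C(i, j) = i * 'C(i, j))%N.
  case: (leqP j i) => ji; last by rewrite (bin_small ji) bin_small ?muln0 // ltnS ltnW.
  by rewrite mul_bin_left -mulnDl; congr (_ * _)%N; lia.
have h4 : (j.+1%:R * 'C(i, j.+1)%:R + j%:R * 'C(i, j)%:R = i%:R * 'C(i, j)%:R :> R).
  by rewrite -!natrM -natrD h3.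
rewrite h2 natrD -!(natr1 i) -!(natr1 j) in h4 *; nra.
Qed.

Lemma sum_binom n : \sum_(j < n.+1) 'C(n, j)%:R = 2 ^+ n :> R.
Proof.
rewrite -natr_sum -natrX; congr (_%:R).
rewrite -[2%N]/(1 + 1)%N Pascal; apply: eq_bigr => j _.
by rewrite !exp1n !muln1.
Qed.

(** Variance of the binomial law, up to normalization. *)
Lemma sum_binom_sq n :
  \sum_(j < n.+1) 'C(n, j)%:R * (n%:R - 2 * j%:R) ^+ 2 = n%:R * 2 ^+ n :> R.
Proof.
elim: n => [|n IH]; first by rewrite big_ord1 /= mulr0 subr0 expr0n mulr0 mul0r.
rewrite big_ord_recl /= bin0.
under eq_bigr => j _ do rewrite /bump /= add1n binS natrD mulrDl.
rewrite big_split /= big_ord_recr /= (bin_small (leqnn n.+1)) mul0r addr0.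
have -> : \sum_(i < n.+1) 'C(n, i)%:R * (n.+1%:R - 2 * i.+1%:R) ^+ 2 =
   \sum_(i < n.+1) ('C(n, i)%:R * (n%:R - 2 * i%:R) ^+ 2 - 2 * ('C(n, i)%:R * (n%:R - 2 * i%:R)) + 'C(n, i)%:R) :> R.
  by apply: eq_bigr => i _; rewrite -(natr1 n) -(natr1 i); ring.
have e2 : 1 * (n.+1%:R - 2 * 0) ^+ 2 + \sum_(i < n) 'C(n, i.+1)%:R * (n.+1%:R - 2 * i.+1%:R) ^+ 2 =
   \sum_(i < n.+1) ('C(n, i)%:R * (n%:R - 2 * i%:R) ^+ 2 + 2 * ('C(n, i)%:R * (n%:R - 2 * i%:R)) + 'C(n, i)%:R) :> R.
  rewrite [RHS]big_ord_recl /= bin0; congr (_ + _); first by rewrite -(natr1 n); ring.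
  by apply: eq_bigr => i _; rewrite /bump /= add1n -(natr1 n) -(natr1 i); ring.
rewrite addrA e2 -big_split /=.
rewrite (eq_bigr (fun i : 'I_n.+1 => 2 * ('C(n, i)%:R * (n%:R - 2 * i%:R) ^+ 2) +
  2 * 'C(n, i)%:R)) => [|i _]; last by ring.
by rewrite big_split /= -!mulr_sumr IH sum_binom -(natr1 n) exprS; ring.
Qed.

(** The differences of the binomial law with n - 1 coins are, up to a factor 2,
    the deviations n - 2 j weighted by the law with n coins and divided by n;
    the mean of |n - 2 j| is at most the square root of n. *)
Lemma coin_decay (e : R) : 0 < e -> exists i, l1norm ((1 - 'X) * coin ^+ i) < e.
Proof.
move=> e0; pose M := (Num.bound (2 / e)).+1.
have M0 : (0 : R) < M%:R by rewrite ltr0n.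
have Me : 2 / M%:R < e.
  have := archi_boundP (_ : 0 <= 2 / e); rewrite divr_ge0 ?ltW // => /(_ isT) h.
  rewrite ltr_pdivrMr // mulrC -ltr_pdivrMr //; apply: lt_trans h _.
  by rewrite ltr_nat.
(* With M^2 - 1 coins, [coef_binom_diff] involves the law with M^2 coins, and the
   square root M of their number is an integer. *)
exists (M ^ 2).-1; set i := (M ^ 2).-1.
have iM : i.+1 = (M ^ 2)%N by rewrite /i prednK // expn_gt0.
apply: le_lt_trans Me.
rewrite /coin exprZn -scalerAr l1normZ ger0_norm ?exprn_ge0 ?invr_ge0 //.
rewrite (@l1normE i.+2); last first.
  apply: leq_trans (size_polyMleq _ _) _.
  have s1 : (size (1 - 'X : {poly R})%R <= 2)%N.
    by rewrite -size_polyN opprB size_XsubC.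
  have s2 : (size ((1 + 'X : {poly R})%R ^+ i)%R <= i.+1)%N.
    apply: leq_trans (size_poly_exp_leq _ _) _.
    by rewrite addrC -(opprK 1) -polyCN size_XsubC /= mul1n.
  by rewrite -subn1 leq_subLR; apply: leq_trans (leq_add s1 s2) _; rewrite add2n add1n.
under eq_bigr do rewrite coef_binom_diff normrM normfV (ger0_norm (ler0n _ _)) normrM (ger0_norm (ler0n _ _)).
rewrite -mulr_suml iM.
have -> : (2^-1 : R) ^+ i = 2 / 2 ^+ (M ^ 2).
  by rewrite -iM exprS exprVn invfM mulrA mulfV ?mul1r.
have bnd : \sum_(j < (M ^ 2).+1) ('C(M ^ 2, j)%:R * `|(M ^ 2)%:R - 2 * j%:R|) <= M%:R * 2 ^+ (M ^ 2) :> R.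
  (* The mean deviation is bounded by the variance through
     z <= z^2 / (2 M) + M / 2. *)
  apply: (@le_trans _ _ (\sum_(j < (M ^ 2).+1) ((2 * M%:R)^-1 * ('C(M ^ 2, j)%:R * ((M ^ 2)%:R - 2 * j%:R) ^+ 2) + (M%:R / 2) * 'C(M ^ 2, j)%:R))).
    apply: ler_sum => j _; set y := _ - _; rewrite -[y ^+ 2]real_normK ?num_real //.
    set z := `|y|; set c := 'C(_, _)%:R.
    have -> : (2 * M%:R)^-1 * (c * z ^+ 2) + M%:R / 2 * c = c * ((2 * M%:R)^-1 * z ^+ 2 + M%:R / 2) by ring.
    rewrite ler_wpM2l ?ler0n // -subr_ge0.
    have -> : (2 * M%:R)^-1 * z ^+ 2 + M%:R / 2 - z = (2 * M%:R)^-1 * (z - M%:R) ^+ 2.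
      by field; rewrite gt_eqF.
    by rewrite mulr_ge0 ?sqr_ge0 // invr_ge0 mulr_ge0 // ltW.
  rewrite big_split /= -!mulr_sumr sum_binom_sq sum_binom natrX le_eqVlt; apply/orP; left; apply/eqP.
  by field; rewrite gt_eqF.
apply: (@le_trans _ _ (2 / 2 ^+ (M ^ 2) * ((M%:R * 2 ^+ (M ^ 2)) / (M ^ 2)%:R))).
  rewrite ler_wpM2l ?divr_ge0 ?exprn_ge0 // ler_wpM2r // invr_ge0 ler0n //.
rewrite natrX le_eqVlt; apply/orP; left; apply/eqP; field.
by rewrite expf_neq0 //= gt_eqF.
Qed.

End L1Norm.

(** * Limit laws of the spacer counts *)

Lemma cvg_sumr (R : realType) (I : Type) (r : seq I) (p : pred I)
    (f : I -> nat -> R) (l : I -> R) :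
  (forall i, p i -> f i n @[n --> \oo] --> l i) ->
  \sum_(i <- r | p i) f i n @[n --> \oo] --> \sum_(i <- r | p i) l i.
Proof.
move=> fl; elim: r => [|i r IH].
  by rewrite big_nil; under eq_fun do rewrite big_nil; exact: cvg_cst.
rewrite big_cons; under eq_fun do rewrite big_cons.
by case: ifP => // pi; apply: cvgD IH; exact: fl.
Qed.

Lemma inv_pow3_cvg (R : realType) (c : R) : c / 3 ^+ s @[s --> \oo] --> (0 : R).
Proof.
under eq_fun do rewrite -exprVn.
have : c * 3^-1 ^+ s @[s --> \oo] --> (c * 0 : R).
  by apply: cvgMl_tmp; apply: cvg_expr; rewrite ger0_norm // invf_lt1 // ltr1n.
by rewrite mulr0.
Qed.

Section GapLaw.
Variable R : realType.

Definition coef_cvg (u : nat -> {poly R}) (p : {poly R}) : Prop :=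
  forall j, (u s)`_j @[s --> \oo] --> p`_j.

Lemma coef_cvg_unique u p q : coef_cvg u p -> coef_cvg u q -> p = q.
Proof. by move=> up uq; apply/polyP => j; apply: cvg_unique (up j) (uq j); exact: Rhausdorff. Qed.

Lemma coef_cvgD u v p q : coef_cvg u p -> coef_cvg v q ->
  coef_cvg (fun s => u s + v s) (p + q).
Proof.
move=> up vq j; rewrite coefD; under eq_fun do rewrite coefD.
exact: cvgD (up j) (vq j).
Qed.

Lemma coef_cvgZ c u p : coef_cvg u p -> coef_cvg (fun s => c *: u s) (c *: p).
Proof.
move=> up j; rewrite coefZ; under eq_fun do rewrite coefZ.
exact: cvgMl_tmp (up j).
Qed.

Lemma coef_cvgXnM n u p : coef_cvg u p -> coef_cvg (fun s => 'X^n * u s) ('X^n * p).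
Proof.
move=> up j; rewrite coefXnM; under eq_fun do rewrite coefXnM.
by case: ifP => _; [exact: cvg_cst | exact: up].
Qed.

Lemma coef_cvg_1XM u p : coef_cvg u p -> coef_cvg (fun s => (1 + 'X) * u s) ((1 + 'X) * p).
Proof.
move=> up; rewrite mulrDl mul1r.
under eq_fun do rewrite mulrDl mul1r.
by apply: coef_cvgD => //; rewrite -['X]expr1; exact: coef_cvgXnM.
Qed.

Lemma coef_cvgS u p : coef_cvg u p -> coef_cvg (fun s => u s.+1) p.
Proof. by move=> up j; move: (up j); rewrite -(cvg_shiftS (fun s => (u s)`_j)). Qed.

Lemma size_gap_poly s q : (size (gap_poly R s q) <= q.+1)%N.
Proof.
apply: leq_trans (size_scale_leq _ _) _.
apply: leq_trans (size_sum _ _ _) _; apply/bigmax_leqP => a _.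
by rewrite size_polyXn ltnS gap_sum_le.
Qed.

Lemma coef_gap_poly s q j :
  (gap_poly R s q)`_j = (\sum_(a < 3 ^ s) (gap_sum a q == j))%:R / 3 ^+ s.
Proof.
rewrite coefZ coef_sum mulrC natr_sum; congr (_ / _); apply: eq_bigr => a _.
by rewrite coefXn eq_sym.
Qed.

Lemma coef_gap_poly_ge0 s q j : 0 <= (gap_poly R s q)`_j.
Proof. by rewrite coef_gap_poly divr_ge0 ?ler0n // exprn_ge0. Qed.

Lemma sum_gap_poly (F : nat -> R) s q :
  \sum_(j < q.+1) (gap_poly R s q)`_j * F j = (3 ^+ s)^-1 * \sum_(a < 3 ^ s) F (gap_sum a q).
Proof.
under eq_bigr do rewrite coefZ coef_sum -mulrA.
rewrite -mulr_sumr; congr (_ * _).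
under eq_bigr do rewrite mulr_suml.
rewrite exchange_big; apply: eq_bigr => a _ /=.
have h : (gap_sum a q < q.+1)%N by rewrite ltnS gap_sum_le.
rewrite (bigD1 (Ordinal h)) //= coefXn eqxx mul1r big1 ?addr0 // => j jh.
rewrite coefXn; case: eqP => [e|]; last by rewrite mul0r.
by move: jh; rewrite -val_eqE /= e eqxx.
Qed.

Lemma l1norm_gap_poly s q : l1norm (gap_poly R s q) = 1.
Proof.
rewrite (l1normE (size_gap_poly s q)).
have := sum_gap_poly (fun=> 1) s q; rewrite sumr_const card_ord.
under eq_bigr do rewrite mulr1.
under [in X in _ -> X]eq_bigr do rewrite ger0_norm ?coef_gap_poly_ge0 //.
move=> ->; rewrite natrX mulVf // expf_neq0 //.
Qed.

Variable P : nat -> {poly R}.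
Hypothesis P_lim : forall q, coef_cvg (gap_poly R ^~ q) (P q).

Lemma size_gap_law q : (size (P q) <= q.+1)%N.
Proof.
apply/leq_sizeP => j qj; apply: cvg_unique (@P_lim q j) _ => //.
rewrite (_ : (fun s => _) = cst 0); first exact: cvg_cst.
by apply/funext => s; rewrite nth_default // (leq_trans (size_gap_poly _ _)).
Qed.

Lemma l1norm_gap_law q : l1norm (P q) <= 1.
Proof.
rewrite (l1normE (size_gap_law q)).
have h : \sum_(i < q.+1) `|(gap_poly R s q)`_i| @[s --> \oo] --> \sum_(i < q.+1) `|(P q)`_i|.
  apply: (@cvg_sumr _ _ _ _ (fun (i : 'I_q.+1) s => `|(gap_poly R s q)`_i|)) => i _.
  exact: cvg_norm (@P_lim q i).
rewrite -(cvg_lim _ h) //; apply: limr_le; first exact: cvgP h.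
by apply: nearW => s; rewrite -(l1normE (size_gap_poly s q)) l1norm_gap_poly.
Qed.

Lemma gap_law3 m : P (3 * m) = 'X^m * P m.
Proof.
apply: coef_cvg_unique (coef_cvgS (@P_lim _)) _.
under eq_fun do rewrite gap_poly3.
exact: coef_cvgXnM.
Qed.

Lemma gap_law31 m : P (3 * m + 1) =
  3^-1 *: ('X^m * ((1 + 'X) * P m + P m.+1)).
Proof.
apply: coef_cvg_unique (coef_cvgS (@P_lim _)) _.
under eq_fun do rewrite gap_poly31.
by apply: coef_cvgZ; apply: coef_cvgXnM; apply: coef_cvgD => //; exact: coef_cvg_1XM.
Qed.

Lemma gap_law32 m : P (3 * m + 2) =
  3^-1 *: ('X^m * ('X * P m + (1 + 'X) * P m.+1)).
Proof.
apply: coef_cvg_unique (coef_cvgS (@P_lim _)) _.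
under eq_fun do rewrite gap_poly32.
apply: coef_cvgZ; apply: coef_cvgXnM; apply: coef_cvgD; last exact: coef_cvg_1XM.
by rewrite -['X]expr1; exact: coef_cvgXnM.
Qed.

(** Twice the total variation distance between the law with generating
    polynomial coin^i P_q and its shift by one. The parameter i keeps track of
    the coins already collected in the recursion. *)
Definition shift_defect (i q : nat) : R := l1norm ((1 - 'X) * coin R ^+ i * P q).

Lemma shift_defectS i q : shift_defect i.+1 q <= shift_defect i q.
Proof.
rewrite /shift_defect exprS (_ : _ * _ * _ = coin R * ((1 - 'X) * coin R ^+ i * P q)); last by ring.
apply: le_trans (l1normM _ _) _.
by rewrite -[leRHS]mul1r ler_wpM2r ?l1norm_ge0 // l1norm_coin_le.
Qed.

Lemma shift_defect_le i q : shift_defect i q <= l1norm ((1 - 'X) * coin R ^+ i).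
Proof.
apply: le_trans (l1normM _ _) _.
by rewrite -[leRHS]mulr1 ler_wpM2l ?l1norm_ge0 // l1norm_gap_law.
Qed.

Lemma shift_defect3 i m : shift_defect i (3 * m) = shift_defect i m.
Proof.
by rewrite /shift_defect gap_law3 mulrCA l1normXnM.
Qed.

(** The factor 1 + X of the recursion is twice a fair coin, so that two thirds of
    the defect is evaluated with one more coin. *)
Lemma shift_defect31 i m : shift_defect i (3 * m + 1) <=
  2 / 3 * shift_defect i.+1 m + 3^-1 * shift_defect i m.+1.
Proof.
rewrite /shift_defect gap_law31 exprS.
rewrite (_ : (1 - 'X) * coin R ^+ i * (3^-1 *: ('X^m * ((1 + 'X) * P m + P m.+1))) =
  'X^m * ((2 / 3) *: ((1 - 'X) * (coin R * coin R ^+ i) * P m) +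
  3^-1 *: ((1 - 'X) * coin R ^+ i * P m.+1))); last first.
  rewrite [in X in _ = _ * (_ *: X + _)](_ : _ * _ * _ = 2^-1 *: ((1 + 'X) * (1 - 'X) * coin R ^+ i * P m)); last first.
    by rewrite [X in _ * (X * _) * _]/coin -!scalerAl -scalerAr -scalerAl; congr (_ *: _); ring.
  rewrite scalerA (_ : 2 / 3 / 2 = 3^-1 :> R); last by field.
  by rewrite -scalerDr -!scalerAr; congr (_ *: _); ring.
rewrite l1normXnM; apply: le_trans (l1normD _ _) _.
by rewrite !l1normZ !ger0_norm // ?divr_ge0 ?invr_ge0.
Qed.

Lemma shift_defect32 i m : shift_defect i (3 * m + 2) <=
  3^-1 * shift_defect i m + 2 / 3 * shift_defect i.+1 m.+1.
Proof.
rewrite /shift_defect gap_law32 exprS.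
rewrite (_ : (1 - 'X) * coin R ^+ i * (3^-1 *: ('X^m * ('X * P m + (1 + 'X) * P m.+1))) =
  'X^m * (3^-1 *: ('X^1 * ((1 - 'X) * coin R ^+ i * P m)) +
  (2 / 3) *: ((1 - 'X) * (coin R * coin R ^+ i) * P m.+1))); last first.
  rewrite [in X in _ = _ * (_ + _ *: X)](_ : _ * _ * _ = 2^-1 *: ((1 + 'X) * (1 - 'X) * coin R ^+ i * P m.+1)); last first.
    by rewrite [X in _ * (X * _) * _]/coin -!scalerAl -scalerAr -scalerAl; congr (_ *: _); ring.
  rewrite expr1 scalerA (_ : 2 / 3 / 2 = 3^-1 :> R); last by field.
  by rewrite -scalerDr -!scalerAr; congr (_ *: _); ring.
rewrite l1normXnM; apply: le_trans (l1normD _ _) _.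
by rewrite !l1normZ !ger0_norm // ?l1normXnM // ?divr_ge0 ?invr_ge0.
Qed.

Variable alpha : nat -> nat.
Hypothesis alpha_le2 : forall l, (alpha l <= 2)%N.
Hypothesis alpha_n0 : infinite_set [set l | alpha l <> 0%N].
Hypothesis alpha_n2 : infinite_set [set l | alpha l <> 2%N].

(** The digits are read from the most significant one. *)
Fixpoint ternary_value (a : nat -> nat) (r : nat) : nat :=
  if r is r'.+1 then (3 * ternary_value a r' + a r)%N else a 0%N.

(* The pair m, m + 1 is stable when a ternary digit is appended: the recursion
   expresses P at 3 m + a and at 3 m + a + 1 through P_m and P_(m+1). *)
Let E i r := Num.max (shift_defect i (ternary_value alpha r)) (shift_defect i (ternary_value alpha r).+1).

Let E_ge0 i r : 0 <= E i r.
Proof. by rewrite /E le_max !l1norm_ge0. Qed.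

Let E_S i r : E i.+1 r <= E i r.
Proof. by rewrite /E ge_max !le_max !shift_defectS orbT. Qed.

Let E_conv i r x y : x <= E i.+1 r -> y <= E i r -> 2 / 3 * x + 3^-1 * y <= E i r.
Proof. by move=> x1 y1; have := E_S i r; lra. Qed.

Let E_noninc i r : E i r.+1 <= E i r.
Proof.
rewrite {1}/E [ternary_value _ _.+1]/= ge_max; set m := ternary_value alpha r.
have h1 k : shift_defect k m <= E k r by rewrite /E le_max lexx.
have h2 k : shift_defect k m.+1 <= E k r by rewrite /E le_max lexx orbT.
case: (alpha r.+1) (alpha_le2 r.+1) => [|[|[|//]]] _.
- rewrite addn0 -[(3 * m).+1]addn1 shift_defect3 h1 /=; apply: le_trans (shift_defect31 _ _) _.
  exact: E_conv.
- rewrite (_ : (3 * m + 1).+1 = 3 * m + 2)%N; last by lia.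
    apply/andP; split.
    by apply: le_trans (shift_defect31 _ _) _; exact: E_conv.
  by apply: le_trans (shift_defect32 _ _) _; rewrite addrC; exact: E_conv.
- rewrite (_ : (3 * m + 2).+1 = 3 * m.+1)%N; last by lia.
  rewrite shift_defect3 h2 andbT.
  by apply: le_trans (shift_defect32 _ _) _; rewrite addrC; exact: E_conv.
Qed.

(* A digit 1, or a digit 0 followed by a digit 2, puts a coin in front of two
   thirds of both laws of the pair. *)
Let E_gain i r : (alpha r.+1 = 1%N \/ alpha r.+1 = 0%N /\ alpha r.+2 = 2%N) ->
  E i r.+2 <= 2 / 3 * E i.+1 r + 3^-1 * E i r.
Proof.
set m := ternary_value alpha r.
have h1 k : shift_defect k m <= E k r by rewrite /E le_max lexx.
have h2 k : shift_defect k m.+1 <= E k r by rewrite /E le_max lexx orbT.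
have c x y : x <= E i.+1 r -> y <= E i r ->
    2 / 3 * x + 3^-1 * y <= 2 / 3 * E i.+1 r + 3^-1 * E i r by lra.
case=> [a1|[a0 a2]].
  apply: le_trans (E_noninc _ _) _; rewrite {1}/E [ternary_value _ _.+1]/= a1 -/m ge_max.
  rewrite (_ : (3 * m + 1).+1 = 3 * m + 2)%N; last by lia.
    apply/andP; split.
    by apply: le_trans (shift_defect31 _ _) _; exact: c.
  by apply: le_trans (shift_defect32 _ _) _; rewrite addrC; exact: c.
have d1 k : shift_defect k (ternary_value alpha r.+1) <= E k r by rewrite /= a0 addn0 shift_defect3.
have d2 k : shift_defect k (ternary_value alpha r.+1).+1 <= 2 / 3 * E k.+1 r + 3^-1 * E k r.
  rewrite /= a0 addn0 -/m -[(3 * m).+1]addn1; apply: le_trans (shift_defect31 _ _) _.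
  by have := h1 k.+1; have := h2 k; rewrite -/m; lra.
have d3 := le_trans (d2 i.+1) (E_conv (lexx (E i.+2 r)) (lexx _)).
rewrite {1}/E [ternary_value _ r.+2]/= -/(ternary_value alpha r.+1) a2 ge_max.
set m' := ternary_value alpha r.+1 in d1 d2 d3 *.
rewrite (_ : (3 * _ + 2).+1 = 3 * m'.+1)%N; last by rewrite /m' /=; lia.
rewrite shift_defect3 d2 andbT.
by apply: le_trans (shift_defect32 _ _) _; rewrite addrC; exact: c.
Qed.

(* Otherwise all the digits from some rank on would be 0, or all would be 2. *)
Let gain_inf N : exists2 r, (N <= r)%N & alpha r.+1 = 1%N \/ alpha r.+1 = 0%N /\ alpha r.+2 = 2%N.
Proof.
apply: contrapT => /forall2NP H.
have {}H r : (N <= r)%N -> alpha r.+1 <> 1%N /\ ~ (alpha r.+1 = 0%N /\ alpha r.+2 = 2%N).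
  by move=> Nr; case: (H r) => [//|/not_orP].
have big (A : set nat) M : infinite_set A -> exists2 l, (M <= l)%N & A l.
  move=> iA; apply: contrapT => /forall2NP h; apply: iA.
  apply: (@sub_finite_set _ _ `I_M) (finite_II M) => l Al /=.
  by rewrite ltnNge; apply/negP => Ml; case: (h l).
have [l Nl al2] := big _ N.+1 alpha_n2.
have al0 : alpha l = 0%N.
  case: l Nl al2 => // l Nl al2; have [] := H l Nl; have := alpha_le2 l.+1.
  by move: al2 => /=; case: (alpha l.+1) => [|[|[|]]].
have z d : alpha (l + d) = 0%N.
  elim: d => [|d IH]; first by rewrite addn0.
  case: l Nl al2 al0 IH => // l Nl _ _ IH.
  have [_ h1] := H (l + d)%N (leq_trans Nl (leq_addr _ _)).
  have [h2 _] := H (l + d).+1 (leq_trans Nl (leqW (leq_addr _ _))).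
  rewrite addnS; move: h1 h2; rewrite -!addSn IH => h1 h2; have := alpha_le2 (l.+1 + d).+1.
  by move: h1 h2; case: (alpha _.+1) => [|[|[|]]] // h1; case: h1.
have [l' ll' /=] := big _ l alpha_n0.
by apply; rewrite -(subnKC ll') z.
Qed.

(** For fixed i the larger defect of the pair decreases with r to a limit l_i. The infinitely many
    gains give l_i <= 2/3 l_(i+1) + 1/3 l_i, hence l_0 <= l_i for all i, and l_i
    is small for large i because of the i coins. *)
Lemma shift_defect_decay (e : R) : 0 < e ->
  exists r, shift_defect 0 (ternary_value alpha r) < e /\ shift_defect 0 (ternary_value alpha r).+1 < e.
Proof.
move=> e0.
have ni i : nonincreasing_seq (E i) by apply/nonincreasing_seqP => r; exact: E_noninc.
have lb i : has_lbound (range (E i)) by exists 0 => _ [r _ <-]; exact: E_ge0.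
have cv i := nonincreasing_is_cvgn (ni i) (lb i).
pose l i := limn (E i).
have lE i r : l i <= E i r by exact: nonincreasing_cvgn_ge.
have lS i : l i <= l i.+1.
  apply/ler_addgt0Pr => d d0.
  have c1 : \forall r \near \oo, E i r < l i + d / 2.
    by apply: (cvgr_lt (l i)) => //; rewrite ltrDl divr_gt0.
  have c2 : \forall r \near \oo, E i.+1 r < l i.+1 + d / 2.
    by apply: (cvgr_lt (l i.+1)) => //; rewrite ltrDl divr_gt0.
  have [N _ HN] := filterI c1 c2.
  have [r Nr gr] := gain_inf N; have [h1 h2] := HN r Nr.
  have := E_gain i gr; have := lE i r.+2.
  by move: h1 h2 => /=; lra.
have l0 i : l 0%N <= l i by elim: i => // i IH; apply: le_trans IH (lS i).
have [i hi] := coin_decay e0.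
have le0 : l 0%N < e.
  apply: le_lt_trans (l0 i) _; apply: le_lt_trans (lE i 0%N) _.
  by rewrite /E gt_max !(le_lt_trans (shift_defect_le _ _) hi).
have [r _ /(_ r (leqnn _)) /=] : \forall r \near \oo, E 0%N r < e by apply: (cvgr_lt (l 0%N)).
by rewrite /E gt_max => /andP[h1 h2]; exists r.
Qed.

End GapLaw.

(** * The polynomials P_m as limit laws of the spacer counts *)

Section ThreeAdic.
Implicit Types (x y : z3) (n : nat).

(** Residue of x modulo 3^n. *)
Definition z3_val n x : nat := (\sum_(i < n) x i * 3 ^ i)%N.

Lemma z3_valS n x : z3_val n.+1 x = (z3_val n x + x n * 3 ^ n)%N.
Proof. by rewrite /z3_val big_ord_recr. Qed.

Lemma z3_val_lt n x : (z3_val n x < 3 ^ n)%N.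
Proof.
elim: n => [|n IH]; first by rewrite /z3_val big_ord0.
have := ltn_ord (x n); rewrite z3_valS expnS; nia.
Qed.

Lemma z3_valD n x y :
  (z3_val n (z3_add x y) + z3_carry x y n * 3 ^ n = z3_val n x + z3_val n y)%N.
Proof.
elim: n => [|n IH]; first by rewrite /z3_val !big_ord0.
have c3 : ((x n + y n + z3_carry x y n) %% 3 + (2 < x n + y n + z3_carry x y n) * 3 =
    x n + y n + z3_carry x y n)%N.
  by have := ltn_ord (x n); have := ltn_ord (y n); case: (z3_carry x y n) => /=; lia.
rewrite !z3_valS /= expnS; set P := (3 ^ n)%N in IH *.
have := congr1 (muln ^~ P) c3; rewrite /= !mulnDl -mulnA => cP.
by move: IH cP; lia.
Qed.

Definition z3_shift x : z3 := fun n => x n.+1.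

Lemma z3_val_shift n x : z3_val n.+1 x = (3 * z3_val n (z3_shift x) + x 0%N)%N.
Proof.
rewrite /z3_val big_ord_recl /= muln1 addnC big_distrr /=; congr (_ + _)%N.
by apply: eq_bigr => i _; rewrite /bump /= add1n expnS mulnCA.
Qed.

Lemma phi_shift x : phi x = if (x 0%N : nat) == 2%N then phi (z3_shift x) else x 0%N.
Proof.
rewrite /phi; case: pselect => [e|ne].
  case: ex_minnP => n xn minn; case: eqVneq => x0; last first.
    by have := minn _ x0; rewrite leqn0 => /eqP ->.
  case: n xn minn => [|n] xn minn; first by rewrite x0 in xn.
  case: pselect => [e'|[]]; last by exists n.
  case: ex_minnP => k xk mink; congr (nat_of_ord (x _)).
  by apply/eqP; rewrite eqn_leq (minn k.+1 xk) ltnS mink.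
case: eqVneq => x0; last by case: ne; exists 0%N.
by case: pselect => // -[n xn]; case: ne; exists n.+1.
Qed.

Lemma phi_le1 x : (phi x <= 1)%N.
Proof.
rewrite /phi; case: pselect => // e; case: ex_minnP => n xn _.
by case: (x n) xn => [[|[|[]]]].
Qed.

(** Unless the n first digits are all 2, the first digit different from 2 is
    found among them. *)
Lemma phi_gap n x : (z3_val n x).+1 != (3 ^ n)%N -> phi x = gap (z3_val n x).
Proof.
elim: n x => [|n IH] x; first by rewrite /z3_val big_ord0.
rewrite phi_shift z3_val_shift => h.
case: (x 0%N) h => [[|[|[|//]]] /= _ h].
- by rewrite addn0 gap3.
- by rewrite gap31.
- by rewrite gap32 IH //; apply: contraNneq h; rewrite expnS => <-; apply/eqP; lia.
Qed.

Lemma z3_val_one n : (0 < n)%N -> z3_val n z3_one = 1%N.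
Proof.
by case: n => // n _; rewrite /z3_val big_ord_recl /= big1.
Qed.

Lemma z3_val_succ n x : ((z3_val n x).+1 < 3 ^ n)%N -> z3_val n (z3_succ x) = (z3_val n x).+1.
Proof.
case: n => [|n] h; first by rewrite expn0 in h.
have := z3_valD n.+1 x z3_one; rewrite z3_val_one // -/(z3_succ x).
by case: z3_carry => /=; have := z3_val_lt n.+1 (z3_succ x); lia.
Qed.

Lemma z3_val_iter n i x : (z3_val n x + i < 3 ^ n)%N ->
  z3_val n (iter i z3_succ x) = (z3_val n x + i)%N.
Proof.
elim: i => [|i IH] h; first by rewrite addn0.
rewrite iterS z3_val_succ IH; lia.
Qed.

(** As long as adding m produces no carry beyond the n first digits, the odometer
    acts on x modulo 3^n as addition of integers. *)
Lemma phi_sum_gap n m x : (z3_val n x + m < 3 ^ n)%N -> phi_sum m x = gap_sum (z3_val n x) m.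
Proof.
move=> h; apply: eq_bigr => i _; have im := ltn_ord i.
have e : z3_val n (iter i z3_succ x) = (z3_val n x + i)%N by apply: z3_val_iter; lia.
by rewrite (@phi_gap n) e //; apply/eqP; lia.
Qed.

(** Such a set is a finite union of finite intersections of cylinders. *)
Lemma z3_measurable_finite n (Q : set z3) :
  (forall x y, (forall i, (i < n)%N -> x i = y i) -> Q x -> Q y) -> measurable Q.
Proof.
elim: n Q => [|n IH] Q Qn.
  have [[x Qx]|nQ] := pselect (exists x, Q x).
    suff -> : Q = setT by exact: measurableT.
    by apply/seteqP; split => // y _; apply: Qn Qx.
  suff -> : Q = set0 by exact: measurable0.
  by apply/seteqP; split => // y Qy; case: nQ; exists y.
pose upd (a : 'I_3) x : z3 := fun i => if i == n then a else x i.
have -> : Q = \bigcup_a ([set x | x n = a] `&` [set x | Q (upd a x)]).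
  apply/seteqP; split => [x Qx|x [a _ [/= xa Qa]]].
    exists (x n) => //; split => //=; suff -> : upd (x n) x = x by [].
    by apply/funext => i; rewrite /upd; case: eqP => [->|].
  suff <- : upd a x = x by [].
  by apply/funext => i; rewrite /upd; case: eqP => [->|].
apply: fin_bigcup_measurable => // a _; apply: measurableI.
  by apply: sub_sigma_algebra; exists n, a.
apply: IH => x y xy /=; apply: Qn => i; rewrite ltnS leq_eqVlt /upd.
by case: eqVneq => //= _; exact: xy.
Qed.

Lemma z3_val_eq n x y : (forall i, (i < n)%N -> x i = y i) -> z3_val n x = z3_val n y.
Proof. by move=> xy; apply: eq_bigr => i _; rewrite xy. Qed.

Lemma z3_measurable_val n (Q : set nat) : measurable [set x | Q (z3_val n x)].
Proof. by apply: (@z3_measurable_finite n) => x y /z3_val_eq /= ->. Qed.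

Lemma z3_measurable_phi j : measurable [set x | phi x = j].
Proof.
pose A k := [set x : z3 | (forall i, (i < k)%N -> (x i : nat) = 2%N) /\ (x k : nat) <> 2%N].
have mA k (B : set nat) : measurable (A k `&` [set x | B (x k)]).
  apply: (@z3_measurable_finite k.+1) => x y xy [[x2 xk] Bx].
  split; last by rewrite /= -xy.
  split; last by rewrite -xy.
  by move=> i ik; rewrite -xy; [exact: x2 | rewrite ltnS ltnW].
have phiA k x : A k x -> phi x = x k.
  move=> [x2 xk]; rewrite /phi; case: pselect => [e|[]]; last by exists k; apply/eqP.
  case: ex_minnP => n xn minn; congr (nat_of_ord (x _)); apply/eqP.
  rewrite eqn_leq minn /=; last exact/eqP.
  by rewrite leqNgt; apply: contra xn => /x2 ->.
pose N := [set x : z3 | forall i, (x i : nat) = 2%N].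
have NA : N = ~` \bigcup_k A k.
  apply/seteqP; split => [x Nx [k _ [_]]|x NAx k]; first by rewrite Nx.
  elim/ltn_ind: k => k IH; apply: contrapT => xk; apply: NAx.
  by exists k => //; split.
have mAk k : measurable (A k) by have := mA k setT; rewrite setIT.
have mN : measurable N.
  by rewrite NA; apply: measurableC; apply: bigcupT_measurable.
have -> : [set x | phi x = j] = \bigcup_k (A k `&` [set x | (x k : nat) = j]) `|`
    (N `&` [set x | 0%N = j]).
  apply/seteqP; split => [x /= xj|x [[k _ [Ak /= xk]]|[Nx /= <-]]].
  - have [[k _ Ak]|] := pselect ((\bigcup_k A k) x).
      by left; exists k => //; split => //=; rewrite -(phiA k).
    rewrite -[~ _]/((~` _) x) -NA => Nx; right; split => //=; rewrite -xj /phi.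
    by case: pselect => // -[n xn]; exfalso; move: xn; rewrite Nx.
  - by rewrite (phiA k).
  - by rewrite /phi; case: pselect => // -[n xn]; exfalso; move: xn; rewrite Nx.
apply: measurableU.
  by apply: bigcupT_measurable => k; exact: (mA k [set u | u = j]).
by have [<-|j0] := eqVneq 0%N j; [rewrite (_ : [set _ | _] = setT) ?setIT //; apply/seteqP; split
 | rewrite (_ : [set _ | _] = set0) ?setI0 //; apply/seteqP; split => // x /= /eqP; rewrite (negbTE j0)].
Qed.

Lemma z3_succ_measurable (A : set z3) : measurable A -> measurable (z3_succ @^-1` A).
Proof.
move=> mA; have : measurable_fun [set: z3] z3_succ; last first.
  by move/(_ measurableT _ mA); rewrite setTI.
apply: (@measurability _ _ _ _ setT z3_succ z3_cylinders) => //.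
move=> _ [_ [n [a ->]] <-]; rewrite setTI.
have cE x y k : (forall i, (i < k)%N -> x i = y i) -> z3_carry x z3_one k = z3_carry y z3_one k.
  elim: k => //= k IH xy; rewrite IH => [|i ik]; last by apply: xy; rewrite ltnS ltnW.
  by rewrite xy.
apply: (@z3_measurable_finite n.+1) => x y xy /=.
by rewrite /z3_succ /z3_add (cE x y) ?xy // => i i_n; apply: xy; rewrite ltnS ltnW.
Qed.

Lemma z3_measurable_phi_sum m j : measurable [set x | phi_sum m x = j].
Proof.
elim: m j => [|m IH] j.
  rewrite (_ : [set _ | _] = [set x | (fun=> 0%N = j) (z3_val 0 x)]).
    exact: (@z3_measurable_val 0 (fun=> 0%N = j)).
  by apply/seteqP; split => x /=; rewrite /phi_sum big_ord0.
have mi A : measurable A -> measurable (iter m z3_succ @^-1` A).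
  by elim: {IH j} m A => // m IH A mA; exact: (IH _ (z3_succ_measurable mA)).
have -> : [set x | phi_sum m.+1 x = j] = \bigcup_(i in [set i | (i <= j)%N])
    ([set x | phi_sum m x = i] `&` iter m z3_succ @^-1` [set x | phi x = (j - i)%N]).
  apply/seteqP; split => [x /=|x [i /= ij [/= xi xj]]].
    rewrite /phi_sum big_ord_recr /= => <-; exists (phi_sum m x); first exact: leq_addr.
    by split => //=; rewrite addKn.
  by rewrite /phi_sum big_ord_recr /= xj -/(phi_sum m x) xi subnKC.
apply: bigcup_measurable => i _; apply: measurableI; first exact: IH.
by apply: mi; exact: z3_measurable_phi.
Qed.

Section Haar.
Variables (R : realType) (lam : probability z3 R).
Hypothesis lam_haar : z3_haar lam.

Let lam_val_sum n (Q : pred nat) :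
  lam [set x | Q (z3_val n x)] = (\sum_(a < 3 ^ n | Q a) lam [set x | z3_val n x = a])%E.
Proof.
rewrite -measure_bigsetU_ord; last 2 first.
- by move=> i; exact: (@z3_measurable_val n [set u | u = nat_of_ord i]).
- by move=> i j _ _ [x [/= xi xj]]; apply: val_inj; rewrite /= -xi.
congr (lam _); rewrite -bigcup_pred; apply/seteqP; split => [x /= Qx|x [a /= Qa /= ->]] //.
by exists (Ordinal (z3_val_lt n x)).
Qed.

(** Invariance under the addition of 1 makes the residue modulo 3^n uniform. *)
Lemma haar_val1 n a : (a < 3 ^ n)%N -> lam [set x | z3_val n x = a] = (3 ^+ n)^-1%:E.
Proof.
have [->|n0] := posnP n.
  rewrite expn0 ltnS leqn0 => /eqP ->.
  rewrite (_ : [set _ | _] = setT) ?probability_setT ?expr0 ?invr1 //.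
  by apply/seteqP; split => x //= _; rewrite /z3_val big_ord0.
have c a' : (a'.+1 < 3 ^ n)%N ->
    lam [set x | z3_val n x = a'.+1] = lam [set x | z3_val n x = a'].
  move=> an; rewrite -(lam_haar z3_one); last exact: (@z3_measurable_val n (fun u => u = a'.+1)).
  congr (lam _); apply/seteqP; split => x /=.
    have := z3_valD n z3_one x; rewrite z3_val_one //.
    have := z3_val_lt n x; have := z3_val_lt n (z3_add z3_one x).
    by case: z3_carry => /=; lia.
  have := z3_valD n z3_one x; rewrite z3_val_one //.
  have := z3_val_lt n x; have := z3_val_lt n (z3_add z3_one x).
  by case: z3_carry => /=; lia.
have c0 b : (b < 3 ^ n)%N -> lam [set x | z3_val n x = b] = lam [set x | z3_val n x = 0%N].
  by elim: b => // b IH bn; rewrite c // IH // ltnW.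
move=> an; rewrite c0 //.
have := fin_num_measure lam _ (@z3_measurable_val n [set u | u = 0%N]).
rewrite /=; have := lam_val_sum n predT.
rewrite (_ : [set _ | predT _] = setT); last by apply/seteqP; split.
rewrite probability_setT (eq_bigr (fun=> lam [set x | z3_val n x = 0%N])) => [|i _]; last exact: c0.
case: (lam _) => // l h _; move: h; rewrite sumEFin sumr_const card_ord => -[h].
congr (_%:E); rewrite -natrX -[l](mulfK (_ : (3 ^ n)%:R != 0 :> R)) ?pnatr_eq0 ?expn_eq0 //.
by rewrite mulr_natr -h mul1r.
Qed.

Lemma haar_val n (Q : pred nat) :
  fine (lam [set x | Q (z3_val n x)]) = (\sum_(a < 3 ^ n) Q a)%:R / 3 ^+ n.
Proof.
rewrite lam_val_sum (eq_bigr (fun=> (3 ^+ n)^-1%:E)) => [|i _]; last exact: haar_val1.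
have -> : (\sum_(a < 3 ^ n) Q a = \sum_(a < 3 ^ n | Q a) 1)%N.
  by rewrite [RHS]big_mkcond; apply: eq_bigr => a _; case: (Q a).
by rewrite sumEFin /= sumr_const -sum1_card mulr_natl.
Qed.

(** The two laws are those of functions that coincide unless one of the m steps
    produces a carry beyond the n first digits. *)
Lemma haar_gap m j n :
  `|fine (lam [set x | phi_sum m x = j]) - (gap_poly R n m)`_j| <= m%:R / 3 ^+ n.
Proof.
rewrite coef_gap_poly -(haar_val n (fun a => gap_sum a m == j)).
set A := [set x | phi_sum m x = j]; set B := [set x | gap_sum (z3_val n x) m == j].
pose C := [set x | (3 ^ n <= z3_val n x + m)%N].
have mA : measurable A by exact: z3_measurable_phi_sum.
have mB : measurable B by exact: (@z3_measurable_val n (fun u => gap_sum u m == j)).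
have mC : measurable C by exact: (@z3_measurable_val n (fun u => 3 ^ n <= u + m)%N).
have Cm : fine (lam C) <= m%:R / 3 ^+ n.
  rewrite (haar_val n (fun u => 3 ^ n <= u + m)%N) ler_wpM2r ?invr_ge0 ?exprn_ge0 //.
  rewrite ler_nat.
  have sm N : (m <= N)%N -> (\sum_(a < N) (N <= a + m))%N = m.
    move=> mN; rewrite -(subnK mN) big_split_ord /= big1 ?add0n => [|i _]; last first.
      by have := ltn_ord i; case: leqP => //; lia.
    rewrite -[RHS]card_ord -sum1_card; apply: eq_bigr => i _.
    by rewrite addnAC leq_addr.
  have [mn|nm] := leqP m (3 ^ n); first by rewrite sm.
  apply: leq_trans (ltnW nm); rewrite -[leqRHS]card_ord -sum1_card leq_sum // => i _.
  exact: leq_b1.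
have AB x : ~ C x -> A x <-> B x.
  by move=> /negP; rewrite -ltnNge => /phi_sum_gap; rewrite /A /B /= => ->; split => /eqP.
have le1 (X Y : set z3) : measurable X -> measurable Y -> X `<=` Y `|` C ->
    fine (lam X) <= fine (lam Y) + fine (lam C).
  move=> mX mY XY; rewrite -lee_fin EFinD !fineK ?fin_num_measure //.
  apply: le_trans (measureU2 _ _ _) => //.
  by apply: le_measure; rewrite ?inE //; exact: measurableU.
have AC := le1 A B mA mB; have BC := le1 B A mB mA.
have {}AC : fine (lam A) <= fine (lam B) + fine (lam C).
  by apply: AC => x Ax; have [Cx|/AB e] := pselect (C x); [right | left; apply/e].
have {}BC : fine (lam B) <= fine (lam A) + fine (lam C).
  by apply: BC => x Bx; have [Cx|/AB e] := pselect (C x); [right | left; apply/e].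
by rewrite ler_norml; apply/andP; split; lra.
Qed.

Lemma chacon_poly_gap m : coef_cvg (gap_poly R ^~ m) (chacon_poly lam m).
Proof.
move=> j.
have h1 : (gap_poly R n m)`_j @[n --> \oo] --> fine (lam [set x | phi_sum m x = j]).
  apply/cvgrPdist_le => e e0.
  have : \forall n \near \oo, m%:R / 3 ^+ n < e by apply: (cvgr_lt (0 : R)) => //; exact: inv_pow3_cvg.
  by apply: filterS => n ne; apply: le_trans (haar_gap m j n) (ltW ne).
rewrite /chacon_poly coef_poly; case: ifP => // /negbT; rewrite -leqNgt => mj.
suff e : fine (lam [set x | phi_sum m x = j]) = 0 by move: h1; rewrite e.
rewrite (_ : [set _ | _] = set0) ?measure0 //.
apply/seteqP; split => // x /= xj.
have : (phi_sum m x <= m)%N.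
  by rewrite -[leqRHS]card_ord -sum1_card; apply: leq_sum => i _; exact: phi_le1.
by rewrite xj leqNgt mj.
Qed.

End Haar.

End ThreeAdic.

(** * Geometry of the towers *)

Lemma height_gt0 n : (0 < height n)%N.
Proof. by case: n => // n; rewrite /= addn1. Qed.

Lemma height_gt n : (n < height n)%N.
Proof. by elim: n => //= n IH; lia. Qed.

(** Position in Tower n.+1 of the bottom of the copy of rank c of Tower n; the
    spacer sits between the copies of ranks 1 and 2. *)
Definition copy_pos (n c : nat) : nat := (c * height n + (c == 2%N))%N.

(** Position in a higher tower of the bottom of the copy of rank a of Tower n. It
    does not depend on the higher tower, since every tower is the bottom part of
    the next one. *)
Definition col_pos (n a : nat) : nat := (a * height n + gap_sum 0 a)%N.

Lemma col_pos3 n a c : (c < 3)%N ->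
  col_pos n (3 * a + c) = (col_pos n.+1 a + copy_pos n c)%N.
Proof.
move=> c3; rewrite /col_pos /copy_pos gap_sumD add0n.
have := @gap_sum3 0 0 a isT; rewrite addn0 muln0 => ->.
suff -> : gap_sum (3 * a) c = (c == 2%N) by rewrite /=; nia.
have := gap3 a; have := gap31 a => g1 g0.
case: c c3 => [|[|[|//]]] _; rewrite -?[2%N]/(1.+1) ?gap_sumS ?gap_sum0 ?addn0 ?g0 ?g1 //.
Qed.

Lemma col_posD n a q : col_pos n (a + q) = (col_pos n a + q * height n + gap_sum a q)%N.
Proof. by rewrite /col_pos gap_sumD add0n mulnDl; lia. Qed.

Lemma col_pos_inj n a b i j : (i < height n)%N -> (j < height n)%N ->
  (col_pos n a + i = col_pos n b + j)%N -> a = b /\ i = j.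
Proof.
move=> ih jh e.
have lt u v k l : (k < height n)%N -> (col_pos n u + k = col_pos n v + l)%N -> (v <= u)%N.
  move=> kh; case: (leqP v u) => // uv; rewrite -(subnKC uv) addSnnS col_posD; nia.
have ab : a = b by apply/eqP; rewrite eqn_leq (lt _ _ _ _ ih e) (lt _ _ _ _ jh (esym e)).
by move: e; rewrite ab => /addnI.
Qed.

Lemma height_split n i : (i < height n.+1)%N ->
  (exists c j, [/\ (c < 3)%N, (j < height n)%N & i = copy_pos n c + j]%N) \/ i = (2 * height n)%N.
Proof.
rewrite /= /copy_pos => ih.
have [i1|i1] := ltnP i (height n); first by left; exists 0%N, i.
have [i2|i2] := ltnP i (2 * height n).
  by left; exists 1%N, (i - height n)%N; split => //=; lia.
have [->|i3] := eqVneq i (2 * height n)%N; first by right.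
by left; exists 2%N, (i - 2 * height n - 1)%N; split => //=; lia.
Qed.

Lemma copy_pos_lt n c j : (c < 3)%N -> (j < height n)%N -> (copy_pos n c + j < height n.+1)%N.
Proof. by rewrite /= /copy_pos; case: c => [|[|[|]]] //=; lia. Qed.

Section Towers.
Variable R : realType.
Local Notation w := (@width R).
Local Notation base := (@base R).
Local Notation level := (@level R).

Lemma levelE n i x : level n i x = ((base n i <= x) && (x < base n i + w n)) :> Prop.
Proof. by rewrite /level /= in_itv. Qed.

Lemma width_gt0 n : 0 < w n.
Proof. by rewrite /width !divr_gt0 // exprn_gt0. Qed.

Lemma widthS n : w n = 3 * w n.+1.
Proof. by rewrite /width exprS; field; rewrite expf_neq0. Qed.

Lemma widthD n s : w (n + s) = w n / 3 ^+ s.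
Proof. by rewrite /width exprD; field; rewrite !expf_neq0. Qed.

Lemma width_height n : w n * (height n)%:R = 1 - w n / 2.
Proof.
elim: n => [|n IH]; first by rewrite /width /= expr0; field.
rewrite /= natrD natrM; move: IH; rewrite widthS => IH; nra.
Qed.

Lemma spacerE n : spacer R n.+1 = 1 - w n / 2.
Proof. by rewrite /spacer /width exprS; congr (_ - _); field; rewrite expf_neq0. Qed.

Lemma base_copy n c j : (c < 3)%N -> (j < height n)%N ->
  base n.+1 (copy_pos n c + j) = base n j + c%:R * w n.+1.
Proof.
move=> c3 jh; rewrite /Defs.base /=.
have sb := size_bases R n.
case: c c3 => [|[|[|//]]] _; rewrite /copy_pos /=.
- by rewrite add0n nth_cat sb jh mul0r addr0.
- rewrite mul1n addn0 nth_cat sb ltnNge leq_addr /= addKn.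
  by rewrite nth_cat size_map sb jh (nth_map 0) ?sb // mul1r.
- rewrite nth_cat sb ifF; last by lia.
  rewrite nth_cat size_map sb ifF; last by lia.
  rewrite (_ : (2 * height n + 1 + j - height n - height n = j.+1)%N); last by lia.
  by rewrite /= (nth_map 0) ?sb.
Qed.

Lemma base_spacer n : base n.+1 (2 * height n) = spacer R n.+1.
Proof.
rewrite /Defs.base /=; have sb := size_bases R n.
have h0 := height_gt0 n.
rewrite nth_cat sb ifF; last by lia.
rewrite nth_cat size_map sb ifF; last by lia.
by rewrite (_ : (2 * height n - height n - height n = 0)%N); last by lia.
Qed.

Lemma base_bounds n i : (i < height n)%N -> 0 <= base n i /\ base n i + w n <= 1 - w n / 2.
Proof.
elim: n i => [|n IH] i ih.
  move: ih => /=; rewrite ltnS leqn0 => /eqP ->.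
  by rewrite /Defs.base /= /width expr0 divr1; split; lra.
have w0 := width_gt0 n.+1; have ws := widthS n.
case: (height_split ih) => [[c [j [c3 jh ->]]]|->].
  have [b0 b1] := IH j jh; rewrite base_copy //.
  have c2 : c%:R <= 2 :> R by rewrite ler_nat.
  have c0 : 0 <= c%:R :> R by [].
  split; nra.
rewrite base_spacer spacerE; split; last by lra.
by rewrite -width_height mulr_ge0 // ltW // width_gt0.
Qed.

Lemma level_copy n c j x : (c < 3)%N -> (j < height n)%N ->
  level n.+1 (copy_pos n c + j) x -> level n j x.
Proof.
move=> c3 jh; rewrite !levelE base_copy //.
have w0 := width_gt0 n.+1; have ws := widthS n.
have c2 : c%:R <= 2 :> R by rewrite ler_nat.
have c0 : 0 <= c%:R :> R by [].
by move=> /andP[h1 h2]; apply/andP; split; nra.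
Qed.

Lemma level_copy_ex n j x : (j < height n)%N -> level n j x ->
  exists2 c, (c < 3)%N & level n.+1 (copy_pos n c + j) x.
Proof.
move=> jh; rewrite levelE => /andP[h1 h2].
have ws := widthS n.
have [x1|x1] := ltP x (base n j + w n.+1).
  by exists 0%N => //; rewrite levelE base_copy // mul0r addr0 h1.
have [x2|x2] := ltP x (base n j + 2 * w n.+1).
  by exists 1%N => //; rewrite levelE base_copy // mul1r x1 /=; lra.
by exists 2%N => //; rewrite levelE base_copy // x2 /=; lra.
Qed.

Lemma level_ex n x : 0 <= x < 1 - w n / 2 -> exists2 i, (i < height n)%N & level n i x.
Proof.
elim: n => [|n IH] /andP[x0 x1].
  exists 0%N => //; rewrite levelE /Defs.base /= x0 /=.
  by move: x1; rewrite /width expr0 divr1; lra.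
have ws := widthS n; have w0 := width_gt0 n.+1.
have [x2|x2] := ltP x (1 - w n / 2).
  have [|i ih ix] := IH; first by rewrite x0.
  have [c c3 cx] := level_copy_ex ih ix.
  by exists (copy_pos n c + i)%N => //; exact: copy_pos_lt.
exists (2 * height n)%N; first by rewrite /=; have := height_gt0 n; lia.
by rewrite levelE base_spacer spacerE x2 /=; lra.
Qed.

Lemma level_lt n i x : (i < height n)%N -> level n i x -> 0 <= x < 1 - w n / 2.
Proof.
move=> /base_bounds[b0 b1]; rewrite levelE => /andP[h1 h2]; apply/andP; split; lra.
Qed.

Lemma level_inj n i j x : (i < height n)%N -> (j < height n)%N ->
  level n i x -> level n j x -> i = j.
Proof.
elim: n i j => [|n IH] i j; first by rewrite /= !ltnS !leqn0 => /eqP -> /eqP ->.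
have ws := widthS n; have w0 := width_gt0 n.+1.
have sp c k : (c < 3)%N -> (k < height n)%N -> level n.+1 (copy_pos n c + k) x ->
    level n.+1 (2 * height n) x -> False.
  move=> c3 kh /(level_copy c3 kh) /(level_lt kh)/andP[_ x1].
  by rewrite levelE base_spacer spacerE => /andP[]; rewrite leNgt x1.
move=> /height_split[[c [k [c3 kh ->]]]|->] /height_split[[d [l [d3 lh ->]]]|->] //.
- move=> h1 h2.
  have kl : k = l by apply: IH => //; [exact: level_copy h1 | exact: level_copy h2].
  move: h1 h2; rewrite kl !levelE !base_copy // => /andP[a1 a2] /andP[b1 b2].
  suff -> : c = d by [].
  have cd : (c < d + 1)%N by rewrite -(ltr_nat R) natrD; nra.
  have dc : (d < c + 1)%N by rewrite -(ltr_nat R) natrD; nra.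
  lia.
- by move=> h1 h2; case: (sp _ _ c3 kh h1 h2).
- by move=> h1 h2; case: (sp _ _ d3 lh h2 h1).
Qed.

Lemma level_col n s a i : (a < 3 ^ s)%N -> (i < height n)%N ->
  (col_pos n a + i < height (n + s))%N /\ level (n + s) (col_pos n a + i) `<=` level n i.
Proof.
elim: s n a i => [|s IH] n a i.
  rewrite expn0 ltnS leqn0 => /eqP -> ih; rewrite addn0 /col_pos mul0n gap_sum0 /=; split => //.
move=> as1 ih; rewrite (divn_eq a 3) mulnC; set b := (a %/ 3)%N; set c := (a %% 3)%N.
have c3 : (c < 3)%N by rewrite ltn_pmod.
have b3 : (b < 3 ^ s)%N by rewrite ltn_divLR // mulnC -expnS.
rewrite col_pos3 // -addnA addnS -addSn.
have [h1 h2] := IH n.+1 b _ b3 (copy_pos_lt c3 ih); split => // x /h2.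
exact: level_copy.
Qed.

Lemma level_shift n i j x : level n i x -> level n j (x - base n i + base n j).
Proof. by rewrite !levelE => /andP[h1 h2]; apply/andP; split; lra. Qed.

(** A level below the top of Tower n is cut into levels of Tower n + s that are
    moved by the same translation, so the map does not depend on the tower. The
    boolean b selects whether x lies on the lower or on the upper level of the
    pair, which serves for the map and for its inverse at once. *)
Lemma chacon_step_refine n i s x : (i.+1 < height n)%N ->
  (forall b : bool, level n (i + b) x -> exists j, [/\ (j.+1 < height (n + s))%N,
    level (n + s) (j + b) x & base (n + s) j.+1 - base (n + s) j = base n i.+1 - base n i]).
Proof.
elim: s n i => [|s IH] n i ih b ix; first by exists i; rewrite addn0.
have ih' : (i + b < height n)%N by case: b {ix} => /=; lia.
have [c c3 cx] := level_copy_ex ih' ix.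
rewrite addnS -addSn.
have ci : ((copy_pos n c + i).+1 < height n.+1)%N by rewrite -addnS; exact: copy_pos_lt.
have := IH n.+1 _ ci b; rewrite -addnA => /(_ cx)[j [jh jx jb]].
exists j; split => //; rewrite jb -addnS !base_copy // ; last exact: ltnW.
by ring.
Qed.

Lemma step_unique n i m j x (b : bool) : (i.+1 < height n)%N -> (j.+1 < height m)%N ->
  level n (i + b) x -> level m (j + b) x ->
  base n i.+1 - base n i = base m j.+1 - base m j.
Proof.
move=> ih jh ix jx.
have [k [kh kx kb]] := @chacon_step_refine n i m x ih b ix.
have [l [lh lx lb]] := @chacon_step_refine m j n x jh b jx.
rewrite -kb -lb (addnC m); rewrite (addnC m) in lh lx.
suff -> : k = l by [].
by apply: (@addIn b); apply: (level_inj _ _ kx lx); case: b {ix jx kx lx}; rewrite ?addn0 ?addn1 // ltnW.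
Qed.

Lemma chacon_level n i x : (i.+1 < height n)%N -> level n i x ->
  chacon x = x - base n i + base n i.+1.
Proof.
move=> ih ix; rewrite /chacon; apply: xget_unique; first by exists n, i.
move=> _ [m [j [jh jx ->]]].
have := @step_unique n i m j x false ih jh; rewrite !addn0 => /(_ ix jx); lra.
Qed.

Lemma chacon_inv_level n i x : (i.+1 < height n)%N -> level n i.+1 x ->
  chacon_inv x = x - base n i.+1 + base n i.
Proof.
move=> ih ix; rewrite /chacon_inv; apply: xget_unique; first by exists n, i.
move=> _ [m [j [jh jx ->]]].
have := @step_unique n i m j x true ih jh; rewrite !addn1 => /(_ ix jx); lra.
Qed.

Lemma iter_chacon n i d x : (i + d < height n)%N -> level n i x ->
  iter d (@chacon R) x = x - base n i + base n (i + d).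
Proof.
move=> + ix; elim: d => [|d IH] ih; first by rewrite addn0 subrK.
rewrite iterS IH; last by lia.
rewrite (@chacon_level n (i + d)) ?addnS; first by lra.
  by rewrite addnS in ih.
exact: level_shift.
Qed.

Lemma iter_chacon_inv n i d x : (i + d < height n)%N -> level n (i + d) x ->
  iter d (@chacon_inv R) x = x - base n (i + d) + base n i.
Proof.
elim: d i => [|d IH] i ih ix; first by rewrite addn0 subrK.
rewrite -addSnnS in ih ix *; rewrite iterS (IH i.+1) // (@chacon_inv_level n i); first by lra.
  by lia.
exact: level_shift.
Qed.

Lemma koopman_pow_level n i j f x : (i < height n)%N -> (j < height n)%N -> level n i x ->
  koopman_pow (j%:Z - i%:Z) f x = f (x - base n i + base n j).
Proof.
move=> ih jh ix; have [ij|ji] := leqP i j.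
  rewrite -(subnKC ij) in jh *; rewrite (_ : _ - _ = (j - i)%N :> int); last by lia.
  by rewrite /koopman_pow /= (iter_chacon jh ix).
rewrite -(subnKC (ltnW ji)) in ih ix *; rewrite (_ : _ - _ = Negz (i - j).-1); last by rewrite NegzE; lia.
rewrite /koopman_pow [LHS]/= -iterS prednK; last by lia.
by rewrite (iter_chacon_inv ih ix).
Qed.

End Towers.

(** * Measure of the levels and invariance of the measure *)

Lemma lebesgue_measure_shift (R : realType) (c : R) (A : set (measurableTypeR R)) :
  measurable A -> lebesgue_measure ((fun x => x + c) @^-1` A) = lebesgue_measure A.
Proof.
move=> mA; have mf : measurable_fun setT (fun x : measurableTypeR R => x + c : measurableTypeR R).
  by apply: measurable_funD => //; exact: measurable_cst.
pose f : {mfun measurableTypeR R >-> measurableTypeR R} := HB.pack (fun x : measurableTypeR R => x + c : measurableTypeR R) (isMeasurableFun.Build _ _ _ _ _ mf).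
rewrite [RHS](@lebesgue_measure_unique R (pushforward lebesgue_measure f)) //.
move=> _ [[a b] _ <-].
rewrite -[RHS]/(lebesgue_measure ((fun x => x + c) @^-1` [set` `]a, b]])).
have -> : (fun x => x + c) @^-1` [set` `]a, b]] = `]a - c, b - c]%classic.
  by apply/seteqP; split => x /=; rewrite !in_itv /= ltrBlDr lerBrDr.
by rewrite !lebesgue_measure_itv /= !lte_fin ltrD2r -!EFinB opprD addrACA subrr addr0.
Qed.

Section Measure.
Variable R : realType.
Local Notation w := (@width R).
Local Notation level := (@level R).
Local Notation mu := (@chacon_prob R).

Definition pr (A : set R) : R := fine (mu A).

Lemma pr_fin A : measurable A -> mu A = (pr A)%:E.
Proof. by move=> mA; rewrite /pr fineK // fin_num_measure. Qed.

Lemma pr_ge0 A : 0 <= pr A.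
Proof. by rewrite fine_ge0. Qed.

Lemma le_pr A B : measurable A -> measurable B -> A `<=` B -> pr A <= pr B.
Proof.
move=> mA mB AB; rewrite -lee_fin -!pr_fin //.
by apply: le_measure; rewrite ?inE.
Qed.

Lemma pr_setC A : measurable A -> pr (~` A) = 1 - pr A.
Proof.
move=> mA; have := probability_setC mu mA.
by rewrite /= (pr_fin mA) (pr_fin (measurableC mA)) -EFinB => -[].
Qed.

Lemma prIC A B : measurable A -> measurable B -> pr A <= pr (A `&` B) + (1 - pr B).
Proof.
move=> mA mB; rewrite -pr_setC // -lee_fin EFinD -!pr_fin //; [|exact: measurableC|exact: measurableI].
apply: le_trans (measureU2 _ _ _); [|exact: measurableI|exact: measurableC].
apply: le_measure; rewrite ?inE //.
  by apply: measurableU; [exact: measurableI | exact: measurableC].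
by move=> x Ax; have [Bx|Bx] := pselect (B x); [left | right].
Qed.

Lemma measurable_level n i : measurable (level n i).
Proof. exact: measurable_itv. Qed.

Lemma pr_sub01 (A : set R) : A `<=` `[0, 1[%classic -> mu A = lebesgue_measure A.
Proof. by move=> A01; rewrite /chacon_prob /mrestr setIidl. Qed.

Lemma level_sub01 n i : (i < height n)%N -> level n i `<=` `[0, 1[%classic.
Proof.
move=> ih x /(level_lt ih)/andP[x0 x1]; rewrite /= in_itv /= x0 /=.
have := @width_gt0 R n; lra.
Qed.

Lemma pr_level n i : (i < height n)%N -> pr (level n i) = w n.
Proof.
move=> ih; rewrite /pr pr_sub01; last exact: level_sub01.
rewrite lebesgue_measure_itv /= lte_fin ltrDl width_gt0 -EFinB /=.
by rewrite addrAC subrr add0r.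
Qed.

(** Distinct levels of one tower are disjoint. *)
Lemma pr_levels (I : finType) (P : pred I) n (t : I -> nat) (A : set R) :
  measurable A -> (forall i, P i -> (t i < height n)%N) -> {in P &, injective t} ->
  pr (A `&` \bigcup_(i in [set` P]) level n (t i)) = \sum_(i | P i) pr (A `&` level n (t i)).
Proof.
move=> mA th tinj; rewrite {1}/pr setI_bigcupr measure_fin_bigcup //=.
- rewrite -(@bigfs _ _ _ _ (index_enum I)) ?index_enum_uniq //; last by move=> i _; rewrite mem_index_enum.
  rewrite (eq_bigr (fun i => (pr (A `&` level n (t i)))%:E)) ?sumEFin // => i _.
  by rewrite pr_fin //; apply: measurableI => //; exact: measurable_level.
- move=> i j /= Pi Pj [x [[_ ix] [_ jx]]].
  by apply: tinj => //; apply: level_inj ix jx; exact: th.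
- by move=> i _; apply: measurableI => //; exact: measurable_level.
Qed.

End Measure.

Section Preserving.
Variable R : realType.
Local Notation w := (@width R).
Local Notation base := (@base R).
Local Notation level := (@level R).

Lemma width_cvg0 : w n @[n --> \oo] --> (0 : R).
Proof.
have -> : w = (fun n => 2 / 3 / 3 ^+ n) by [].
exact: inv_pow3_cvg.
Qed.

(** Used to prove identities by neglecting a bounded number of levels in each tower. *)
Lemma eq_width_bound (x y c : R) : (forall n, `|x - y| <= c * w n) -> x = y.
Proof.
move=> h; apply/eqP; rewrite -subr_eq0 -normr_le0.
have cw : c * w n @[n --> \oo] --> (c * 0 : R) by apply: cvgMl_tmp; exact: width_cvg0.
rewrite -(mulr0 c) -(cvg_lim _ cw) //; apply: limr_ge; first exact: cvgP cw.
exact: nearW.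
Qed.

Lemma measurable_shift (c : R) (A : set R) : measurable A -> measurable ((fun x => x + c) @^-1` A).
Proof.
move=> mA; rewrite -[X in measurable X]setTI.
suff : measurable_fun setT (fun x : R => x + c) by apply.
by apply: measurable_funD => //; exact: measurable_cst.
Qed.

Lemma pr_level_shift n i j (A : set R) : (i < height n)%N -> (j < height n)%N -> measurable A ->
  pr (level n i `&` (fun x => x + (base n j - base n i)) @^-1` A) = pr (level n j `&` A).
Proof.
move=> ih jh mA.
have mj : measurable (level n j `&` A) by apply: measurableI => //; exact: measurable_level.
rewrite /pr !pr_sub01; last 2 first.
- by move=> x [ix _]; apply: level_sub01 ix.
- by move=> x [ix _]; apply: level_sub01 ix.
congr fine; rewrite -[RHS](lebesgue_measure_shift (base n j - base n i)) //.
congr (lebesgue_measure _); apply/seteqP; split => x /= [h1 h2]; split => //.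
  by move: h1; rewrite !levelE => /andP[a b]; apply/andP; split; lra.
by move: h1; rewrite !levelE => /andP[a b]; apply/andP; split; lra.
Qed.

(** A map that translates level i of Tower n onto level [sg n i] for all levels
    but at most one in each tower preserves the measure: the exceptional level
    has measure [width n]. This covers the map and its inverse. *)
Section PiecewiseTranslation.
Variables (S : R -> R) (D : nat -> nat -> bool) (sg : nat -> nat -> nat).
Hypothesis S_level : forall n i x, (i < height n)%N -> D n i -> level n i x ->
  S x = x + (base n (sg n i) - base n i).
Hypothesis S_out : forall x, (forall n i, (i < height n)%N -> D n i -> ~ level n i x) -> S x = x.
Hypothesis sg_lt : forall n i, (i < height n)%N -> D n i -> (sg n i < height n)%N.
Hypothesis sg_inj : forall n, {in [pred i | D n i] &, injective (sg n)}.
Hypothesis D_card : forall n, (height n <= #|[pred i : 'I_(height n) | D n i]| + 1)%N.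

Lemma piecewise_measurable (A : set R) : measurable A -> measurable (S @^-1` A).
Proof.
move=> mA.
pose U := \bigcup_n \bigcup_(i in [set i | (i < height n)%N && D n i]) level n i.
have mU : measurable U.
  by apply: bigcupT_measurable => n; apply: bigcup_measurable => i _; exact: measurable_level.
have -> : S @^-1` A = (\bigcup_n \bigcup_(i in [set i | (i < height n)%N && D n i])
     (level n i `&` (fun x => x + (base n (sg n i) - base n i)) @^-1` A)) `|` (A `\` U).
  apply/seteqP; split => [x /= Ax|x].
    have [[n _ [i /= /andP[ih iD] ix]]|nUx] := pselect (U x).
      by left; exists n => //; exists i; [exact/andP | split => //=; rewrite -S_level].
    right; split => //; rewrite -(@S_out x) // => n i ih iD ix; apply: nUx.
    by exists n => //; exists i => //; exact/andP.
  move=> [[n _ [i /= /andP[ih iD] [ix Ax]]]|[Ax nUx]] /=.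
    by rewrite (S_level ih iD ix).
  rewrite S_out // => n i ih iD ix; apply: nUx.
  by exists n => //; exists i => //; exact/andP.
apply: measurableU; last exact: measurableD.
apply: bigcupT_measurable => n; apply: bigcup_measurable => i _; apply: measurableI.
  exact: measurable_level.
exact: measurable_shift.
Qed.

Lemma piecewise_preserving (A : set R) : measurable A -> pr (S @^-1` A) = pr A.
Proof.
move=> mA; apply: (@eq_width_bound _ _ 2) => n.
have mSA := piecewise_measurable mA.
pose P := [pred i : 'I_(height n) | D n i].
have sI : {in P &, injective (fun i : 'I_(height n) => sg n i)}.
  by move=> i j Pi Pj /(sg_inj Pi Pj) /val_inj.
have iI : {in P &, injective (fun i : 'I_(height n) => (i : nat))}.
  by move=> i j _ _ /val_inj.
have sgP (i : 'I_(height n)) : P i -> (sg n i < height n)%N by move=> Pi; exact: sg_lt.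
have c1 := pr_levels mSA (fun i _ => ltn_ord i) iI.
have c2 := pr_levels mA sgP sI.
have d1 := pr_levels (measurableT : measurable [set: R]) (fun i _ => ltn_ord i) iI.
have d2 := pr_levels (measurableT : measurable [set: R]) sgP sI.
set U := \bigcup_(i in _) _ in c1 d1; set V := \bigcup_(i in _) _ in c2 d2.
have mU : measurable U by apply: fin_bigcup_measurable => // i _; exact: measurable_level.
have mV : measurable V by apply: fin_bigcup_measurable => // i _; exact: measurable_level.
have e12 : pr (S @^-1` A `&` U) = pr (A `&` V).
  rewrite c1 c2; apply: eq_bigr => i Pi.
  rewrite [in RHS]setIC -(@pr_level_shift n i) ?sg_lt //; congr (pr _).
  apply/seteqP; split => x /= [h1 h2]; split => //.
    by rewrite -(S_level _ Pi h2).
  by rewrite (S_level _ Pi h1).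
have cst (t : 'I_(height n) -> nat) : (forall i, P i -> (t i < height n)%N) ->
    1 - w n * 2 <= \sum_(i | P i) pr (setT `&` level n (t i)).
  move=> th; rewrite (eq_bigr (fun=> w n)) => [|i Pi]; last by rewrite setTI pr_level // th.
  rewrite sumr_const -mulr_natr; have := width_height R n.
  have := D_card n; rewrite -/P -(ler_nat R) natrD => ch; have := width_gt0 R n; nra.
rewrite setTI in d1; rewrite setTI in d2.
have u1 := cst _ (fun i _ => ltn_ord i); have v1 := cst _ sgP.
rewrite -d1 in u1; rewrite -d2 in v1.
have b1 := prIC mSA mU; have b2 := prIC mA mV.
have b3 : pr (S @^-1` A `&` U) <= pr (S @^-1` A) by apply: le_pr => //; exact: measurableI.
have b4 : pr (A `&` V) <= pr A by apply: le_pr => //; exact: measurableI.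
rewrite ler_norml; apply/andP; split; lra.
Qed.

End PiecewiseTranslation.

Lemma card_ord_but (n : nat) (Q : pred 'I_n) (i0 : 'I_n) :
  (forall i, i != i0 -> Q i) -> (n <= #|Q| + 1)%N.
Proof.
move=> QP; have : (#|~: [set i0]%SET| <= #|Q|)%N.
  by apply: subset_leq_card; apply/fintype.subsetP => i; rewrite !inE; exact: QP.
by have := cardsC [set i0]%SET; rewrite cards1 card_ord; lia.
Qed.

Let topP n : (forall i : 'I_(height n), i != Ordinal (etrans (ltn_predL _) (height_gt0 n)) -> (i.+1 < height n)%N).
Proof. by move=> i; rewrite -val_eqE /=; have := ltn_ord i; lia. Qed.

Let chacon_spec (A : set R) : measurable A ->
  measurable (@chacon R @^-1` A) /\ pr (@chacon R @^-1` A) = pr A.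
Proof.
have H1 n i x : (i < height n)%N -> (i.+1 < height n)%N -> level n i x ->
    chacon x = x + (base n i.+1 - base n i).
  by move=> _ ih ix; rewrite (chacon_level ih ix); lra.
have H2 x : (forall n i, (i < height n)%N -> (i.+1 < height n)%N -> ~ level n i x) -> chacon x = x.
  by move=> h; rewrite /chacon xgetPN // => _ [n [i [ih ix _]]]; apply: h ix => //; exact: ltnW.
have H4 (n : nat) : {in [pred i | i.+1 < height n]%N &, injective S} by move=> i j _ _ [].
move=> mA; split; first exact: (@piecewise_measurable _ (fun n i => i.+1 < height n)%N (fun=> S)).
apply: (@piecewise_preserving _ (fun n i => i.+1 < height n)%N (fun=> S)) => // n.
exact: card_ord_but (@topP n).
Qed.

Let chacon_inv_spec (A : set R) : measurable A ->
  measurable (@chacon_inv R @^-1` A) /\ pr (@chacon_inv R @^-1` A) = pr A.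
Proof.
have H1 n i x : (i < height n)%N -> (0 < i)%N -> level n i x ->
    chacon_inv x = x + (base n i.-1 - base n i).
  by case: i => // i ih _ ix; rewrite (chacon_inv_level ih ix) /=; lra.
have H2 x : (forall n i, (i < height n)%N -> (0 < i)%N -> ~ level n i x) -> chacon_inv x = x.
  by move=> h; rewrite /chacon_inv xgetPN // => _ [n [i [ih ix _]]]; apply: h ix => //; exact: ltnW.
have H3 n i : (i < height n)%N -> (0 < i)%N -> (i.-1 < height n)%N by lia.
have H4 (n : nat) : {in [pred i | 0 < i]%N &, injective predn} by move=> [|i] [|j] //= _ _ ->.
move=> mA; split; first exact: (@piecewise_measurable _ (fun n i => 0 < i)%N (fun=> predn)).
have Hc n : (height n <= #|[pred i : 'I_(height n) | 0 < i]%N| + 1)%N.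
  apply: (@card_ord_but _ _ (Ordinal (height_gt0 n))) => i.
  by rewrite -val_eqE /= lt0n.
exact: (@piecewise_preserving _ (fun n i => 0 < i)%N (fun=> predn) H1 H2 H3 H4 Hc).
Qed.

(** The point map underlying [koopman_pow]. *)
Definition power (k : int) : R -> R :=
  match k with
  | Posz n => iter n (@chacon R)
  | Negz n => iter n.+1 (@chacon_inv R)
  end.

Lemma koopman_powE k f : koopman_pow k f = f \o power k.
Proof. by case: k. Qed.

Lemma measurable_power_pre k (A : set R) : measurable A -> measurable (power k @^-1` A).
Proof.
have it (S : R -> R) n : (forall A, measurable A -> measurable (S @^-1` A)) ->
    forall A, measurable A -> measurable (iter n S @^-1` A).
  move=> mS; elim: n => // n IH B mB; exact: (IH _ (mS _ mB)).
case: k => n; apply: it => B mB; [exact: (chacon_spec mB).1 | exact: (chacon_inv_spec mB).1].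
Qed.

Lemma pr_power_pre k (A : set R) : measurable A -> pr (power k @^-1` A) = pr A.
Proof.
have it (S : R -> R) n : (forall A, measurable A -> measurable (S @^-1` A) /\ pr (S @^-1` A) = pr A) ->
    forall A, measurable A -> pr (iter n S @^-1` A) = pr A.
  move=> mS; elim: n => // n IH B mB; have [m1 p1] := mS _ mB.
  by rewrite -p1; exact: (IH _ m1).
case: k => n; apply: it => B mB; [exact: chacon_spec | exact: chacon_inv_spec].
Qed.

Lemma measurable_power k : measurable_fun setT (power k).
Proof. by move=> _ A mA; rewrite setTI; exact: measurable_power_pre. Qed.

Lemma power_level k n i j x : (i < height n)%N -> (j < height n)%N -> level n i x ->
  (i%:Z + k = j%:Z)%R -> power k x = x - base n i + base n j.
Proof.
move=> ih jh ix e; have := koopman_pow_level id ih jh ix.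
by rewrite koopman_powE /= => <-; congr (power _ _); lia.
Qed.

End Preserving.

(** * Scalar product and norm of L^2 *)

Section L2.
Variable R : realType.
Local Notation mu := (@chacon_prob R).
Local Notation L2 := (@L2 R).
Implicit Types (f g h : R -> R).

Lemma ae_mono (P Q : R -> Prop) : (forall x, P x -> Q x) ->
  {ae mu, forall x, P x} -> {ae mu, forall x, Q x}.
Proof. exact: (@filterS _ _ (ae_filter_ringOfSetsType mu)). Qed.

Lemma L2_measurable f : f \in L2 -> measurable_fun setT f.
Proof. by rewrite inE => /andP[]; rewrite inE. Qed.

Lemma L2_mul_integrable f g : f \in L2 -> g \in L2 ->
  mu.-integrable setT (EFin \o (fun x => f x * g x)).
Proof. by move=> fL gL; apply/Lfun1_integrable; exact: Lfun2_mul_Lfun1. Qed.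

Lemma L2_intro f : measurable_fun setT f ->
  mu.-integrable setT (EFin \o (fun x => f x * f x)) -> f \in L2.
Proof.
move=> mf /integrableP[_ fi]; rewrite /L2 /Lfun inE; apply/andP; split; first by rewrite inE.
rewrite inE /= /finite_norm unlock; apply: poweR_lty.
apply: le_lt_trans fi; apply: ge0_le_integral => //=.
- apply/measurable_EFinP; apply: (@measurableT_comp _ _ _ _ _ _ (@powR R ^~ 2)) => //.
  exact: measurableT_comp.
- by apply/measurable_EFinP; apply: measurableT_comp => //; exact: measurable_funM.
- by move=> x _; rewrite lee_fin powR_mulrn // normrM expr2.
Qed.

Lemma L2_bounded f (c : R) : measurable_fun setT f -> (forall x, `|f x| <= c) -> f \in L2.
Proof.
move=> mf fc; apply: L2_intro => //.
apply: (@le_integrable _ _ _ mu setT measurableT _ (cst (c * c)%:E)).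
- by apply/measurable_EFinP; exact: measurable_funM.
- have c0 : 0 <= c := le_trans (normr_ge0 _) (fc 0).
  by move=> x _ /=; rewrite lee_fin !normrM (ger0_norm c0) ler_pM.
- exact: finite_measure_integrable_cst.
Qed.

Lemma L2_lin a f g : f \in L2 -> g \in L2 -> (fun x => a * f x + g x) \in L2.
Proof.
move=> fL gL.
have [mf mg] := (L2_measurable fL, L2_measurable gL).
have fg := L2_mul_integrable fL gL; have ff := L2_mul_integrable fL fL; have gg := L2_mul_integrable gL gL.
apply: L2_intro.
  by apply: measurable_funD => //; exact: measurable_funM.
have -> : EFin \o (fun x => (a * f x + g x) * (a * f x + g x)) =
    ((fun x => (a * a)%:E * (EFin \o (fun x => (f x * f x)%R)) x) \+
    ((fun x => (2 * a)%:E * (EFin \o (fun x => (f x * g x)%R)) x) \+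
     (EFin \o (fun x => (g x * g x)%R))))%E.
  by apply/funext => x /=; rewrite -!EFinM -!EFinD; congr (_%:E); ring.
by apply: integrableD => //; [exact: integrableZl | apply: integrableD => //; exact: integrableZl].
Qed.

Lemma L2_cst c : (cst c) \in L2.
Proof. exact: Lfun_cst. Qed.

Lemma L2_add f g : f \in L2 -> g \in L2 -> (fun x => f x + g x) \in L2.
Proof.
move=> fL gL; have := L2_lin 1 fL gL.
by rewrite (_ : (fun x => _) = (fun x => f x + g x)) //; apply/funext => x /=; rewrite mul1r.
Qed.

Lemma L2_sub f g : f \in L2 -> g \in L2 -> (fun x => f x - g x) \in L2.
Proof.
move=> fL gL; have := L2_lin (-1) gL fL.
by rewrite (_ : (fun x => _) = (fun x => f x - g x)) //; apply/funext => x /=; rewrite mulN1r addrC.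
Qed.

Definition dot f g : R := \int[mu]_x (f x * g x).

Lemma dotC f g : dot f g = dot g f.
Proof. by apply: eq_Rintegral => x _; rewrite mulrC. Qed.

Lemma dot_linl a f g h : f \in L2 -> g \in L2 -> h \in L2 ->
  dot (fun x => a * f x + g x) h = a * dot f h + dot g h.
Proof.
move=> fL gL hL; have fh := L2_mul_integrable fL hL; have gh := L2_mul_integrable gL hL.
rewrite /dot -RintegralZl // -RintegralD //.
  by apply: eq_Rintegral => x _; rewrite mulrDl mulrA.
exact: (integrableZl measurableT a fh).
Qed.

Lemma dotZl a f h : f \in L2 -> h \in L2 -> dot (fun x => a * f x) h = a * dot f h.
Proof.
move=> fL hL; rewrite /dot -RintegralZl //; last exact: L2_mul_integrable.
by apply: eq_Rintegral => x _; rewrite mulrA.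
Qed.

Lemma dotDl f g h : f \in L2 -> g \in L2 -> h \in L2 ->
  dot (fun x => f x + g x) h = dot f h + dot g h.
Proof.
move=> fL gL hL; rewrite -[dot f h]mul1r -dot_linl //.
by apply: eq_Rintegral => x _; rewrite mul1r.
Qed.

Lemma dotBl f g h : f \in L2 -> g \in L2 -> h \in L2 ->
  dot (fun x => f x - g x) h = dot f h - dot g h.
Proof.
move=> fL gL hL; rewrite addrC -mulN1r -dot_linl //.
by apply: eq_Rintegral => x _; rewrite mulN1r addrC.
Qed.

Lemma dotDr f g h : f \in L2 -> g \in L2 -> h \in L2 ->
  dot h (fun x => f x + g x) = dot h f + dot h g.
Proof. by move=> fL gL hL; rewrite dotC dotDl // !(dotC _ h). Qed.

Lemma dotBr f g h : f \in L2 -> g \in L2 -> h \in L2 ->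
  dot h (fun x => f x - g x) = dot h f - dot h g.
Proof. by move=> fL gL hL; rewrite dotC dotBl // !(dotC _ h). Qed.

Lemma dot_ge0 f : 0 <= dot f f.
Proof. by apply: Rintegral_ge0 => x _; rewrite -expr2 sqr_ge0. Qed.

Definition nrm f : R := Num.sqrt (dot f f).

Lemma nrm_ge0 f : 0 <= nrm f. Proof. exact: sqrtr_ge0. Qed.

Lemma nrm_sq f : nrm f ^+ 2 = dot f f.
Proof. by rewrite sqr_sqrtr // dot_ge0. Qed.

(** The quadratic polynomial t |-> dot (t f + g) (t f + g) is nonnegative. *)
Lemma cauchy_schwarz f g : f \in L2 -> g \in L2 -> `|dot f g| <= nrm f * nrm g.
Proof.
move=> fL gL.
have q t : 0 <= t ^+ 2 * dot f f + 2 * t * dot f g + dot g g.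
  have := dot_ge0 (fun x => t * f x + g x).
  rewrite dot_linl //; last exact: L2_lin.
  rewrite (dotC f) (dotC g) !dot_linl // (dotC g f); set a := dot f f; set b := dot f g; set c := dot g g.
  by move=> h; apply: le_trans h _; rewrite le_eqVlt; apply/orP; left; apply/eqP; ring.
rewrite -(ler_sqr (normr_ge0 _)); last by rewrite nnegrE mulr_ge0 // nrm_ge0.
rewrite real_normK ?num_real // exprMn !nrm_sq.
have [f0|f0] := eqVneq (dot f f) 0.
  have [->|b0] := eqVneq (dot f g) 0; first by rewrite expr0n /= mulr_ge0 ?dot_ge0.
  have := q (- (dot g g + 1) / (2 * dot f g)); rewrite f0 mulr0 add0r.
  rewrite (_ : 2 * _ * _ = - (dot g g + 1)); last by field.
  by rewrite opprD addrAC addNr add0r oppr_ge0 ler10.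
have f1 : 0 < dot f f by rewrite lt_def f0 dot_ge0.
have := q (- dot f g / dot f f).
have -> : (- dot f g / dot f f) ^+ 2 * dot f f + 2 * (- dot f g / dot f f) * dot f g + dot g g =
   (dot f f * dot g g - dot f g ^+ 2) / dot f f by field.
by rewrite pmulr_lge0 ?invr_gt0 // subr_ge0.
Qed.

Lemma nrmD f g : f \in L2 -> g \in L2 -> nrm (fun x => f x + g x) <= nrm f + nrm g.
Proof.
move=> fL gL; have fgL := L2_add fL gL.
rewrite -(ler_sqr (nrm_ge0 _)); last by rewrite nnegrE addr_ge0 // nrm_ge0.
rewrite nrm_sq dotDl // !dotDr // sqrrD !nrm_sq (dotC g f).
have := cauchy_schwarz fL gL; rewrite ler_norml => /andP[_ h]; lra.
Qed.

Lemma nrm_eq0 f : f \in L2 -> dot f f = 0 -> f = cst 0 %[ae mu].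
Proof.
move=> fL f0.
have ff := L2_mul_integrable fL fL.
have : (\int[mu]_x (f x * f x)%:E = 0)%E.
  by rewrite -[LHS]fineK; [rewrite -[fine _]/(dot f f) f0 | exact: integrable_fin_num].
have mf := L2_measurable fL.
move=> i0; have : ae_eq mu setT (EFin \o (fun x => f x * f x)) (cst 0%E).
  apply/ae_eq_integral_abs => //.
    by apply/measurable_EFinP; exact: measurable_funM.
  rewrite -[RHS]i0; apply: eq_integral => x _ /=.
  by rewrite ger0_norm // -expr2 sqr_ge0.
apply: filterS => x /(_ I) /= [] /eqP; rewrite mulf_eq0 orbb => /eqP fx _; exact: fx.
Qed.

Lemma dot_ae f f' g : f \in L2 -> f' \in L2 -> g \in L2 -> f = f' %[ae mu] -> dot f g = dot f' g.
Proof.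
move=> fL fL' gL ff'; congr fine; apply: ae_eq_integral => //.
- by apply/measurable_EFinP; apply: measurable_funM; exact: L2_measurable.
- by apply/measurable_EFinP; apply: measurable_funM; exact: L2_measurable.
- by apply: (ae_mono _ ff') => x h xT /=; rewrite h.
Qed.

Lemma L2_eq_dot f g : f \in L2 -> g \in L2 -> (forall h, h \in L2 -> dot f h = dot g h) ->
  L2_eq f g.
Proof.
move=> fL gL fg; have fgL := L2_sub fL gL.
have : dot (fun x => f x - g x) (fun x => f x - g x) = 0.
  by rewrite dotBl // fg // subrr.
move/(nrm_eq0 fgL); apply: ae_mono => x h xT; have := h xT => /=.
by move/eqP; rewrite subr_eq0 => /eqP.
Qed.

Lemma Lnorm_nrm f : f \in L2 -> 'N[mu]_2%:E[EFin \o f]%E = (nrm f)%:E.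
Proof.
move=> fL; rewrite unlock.
have -> : (\int[mu]_x (`|(EFin \o f) x| `^ 2) = (dot f f)%:E)%E.
  rewrite /dot /Rintegral fineK; last by apply: integrable_fin_num => //; exact: L2_mul_integrable.
  apply: eq_integral => x _ /=; rewrite powR_mulrn // -normrX ger0_norm ?sqr_ge0 //.
by rewrite poweR_EFin /nrm powR12_sqrt // dot_ge0.
Qed.

Lemma integrable_power k f : mu.-integrable setT (EFin \o f) ->
  mu.-integrable setT (EFin \o (f \o power k)) /\
  \int[mu]_x (f (power k x)) = \int[mu]_x f x.
Proof.
move=> fi.
have mp : measurable_fun [set: measurableTypeR R] (@power R k : measurableTypeR R -> measurableTypeR R).
  exact: measurable_power.
pose p : {mfun measurableTypeR R >-> measurableTypeR R} := HB.pack (@power R k : measurableTypeR R -> measurableTypeR R) (isMeasurableFun.Build _ _ _ _ _ mp).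
have e A : measurable A -> A `<=` setT -> mu A = pushforward mu p A.
  move=> mA _; rewrite -[RHS]/(mu (power k @^-1` A)) (pr_fin mA) -(pr_power_pre k mA) -pr_fin //.
  exact: measurable_power_pre.
have mf : measurable_fun setT (EFin \o f) by case/integrableP : fi.
have fp : mu.-integrable setT (EFin \o (f \o power k)).
  apply/integrableP; split.
    by apply/measurable_EFinP; apply: measurableT_comp => //; exact/measurable_EFinP.
  have := @ge0_integral_pushforward _ _ (measurableTypeR R) (measurableTypeR R) R (power k) mp mu setT (fun x => `|(f x)%:E|%E) measurableT.
  rewrite preimage_setT /= => <- //.
    by rewrite -(@eq_measure_integral _ _ R setT (pushforward mu p) mu _ e); case/integrableP : fi.
  by apply/measurable_EFinP; apply: measurableT_comp => //; exact/measurable_EFinP.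
split => //; congr fine.
have i1 := @integral_pushforward _ _ (measurableTypeR R) (measurableTypeR R) R (power k) mp mu setT
  (EFin \o f) mf fp measurableT.
apply: etrans (esym i1) _; symmetry.
exact: (@eq_measure_integral _ _ R setT (pushforward mu p) mu _ e).
Qed.

Lemma L2_power k f : f \in L2 -> f \o power k \in L2.
Proof.
move=> fL; apply: L2_intro.
  by apply: measurableT_comp; [exact: L2_measurable | exact: measurable_power].
exact: (integrable_power k (L2_mul_integrable fL fL)).1.
Qed.

Lemma dot_power k f g : f \in L2 -> g \in L2 -> dot (f \o power k) (g \o power k) = dot f g.
Proof. by move=> fL gL; exact: (integrable_power k (L2_mul_integrable fL gL)).2. Qed.

Lemma nrm_power k f : f \in L2 -> nrm (f \o power k) = nrm f.
Proof. by move=> fL; rewrite /nrm dot_power. Qed.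

End L2.

(** * Density of the step functions *)

Section Density.
Variable R : realType.
Local Notation w := (@width R).
Local Notation base := (@base R).
Local Notation level := (@level R).
Local Notation mu := (@chacon_prob R).
Local Notation L2 := (@L2 R).
Implicit Types (f g h : R -> R).

Definition step (N : nat) (c : nat -> R) (x : R) : R :=
  \sum_(i < height N) c i * \1_(level N i) x.

Lemma step_level N c i x : (i < height N)%N -> level N i x -> step N c x = c i.
Proof.
move=> ih ix; rewrite /step (bigD1 (Ordinal ih)) //= indicE mem_set // mulr1.
rewrite big1 ?addr0 // => j ji; rewrite indicE memNset ?mulr0 // => jx.
by move/eqP: ji; apply; apply: val_inj => /=; exact: level_inj jx ix.
Qed.

Lemma step_out N c x : (forall i, (i < height N)%N -> ~ level N i x) -> step N c x = 0.
Proof. by move=> h; rewrite /step big1 // => i _; rewrite indicE memNset ?mulr0 //; exact: h. Qed.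

Lemma step_bound N c (M : R) : 0 <= M -> (forall i, `|c i| <= M) -> forall x, `|step N c x| <= M.
Proof.
move=> M0 cM x; have [[i [ih ix]]|h] := pselect (exists i, (i < height N)%N /\ level N i x).
  by rewrite (step_level c ih ix).
by rewrite step_out ?normr0 // => i ih ix; apply: h; exists i.
Qed.

Lemma measurable_step N c : measurable_fun setT (step N c).
Proof.
rewrite /step; apply: (@measurable_sum _ _ _ _ _ _ (fun (i : 'I_(height N)) x => c i * \1_(level N i) x)) => i.
by apply: measurable_funM => //; apply: measurable_indic; exact: measurable_level.
Qed.

Lemma step_L2 N c : step N c \in L2.
Proof.
apply: (@L2_bounded _ _ (\sum_(i < height N) `|c i|)); first exact: measurable_step.
move=> x; apply: le_trans (ler_norm_sum _ _ _) _; apply: ler_sum => i _.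
rewrite normrM -[leRHS]mulr1 ler_wpM2l // indicE; case: (_ \in _); rewrite ?normr1 ?normr0 //.
Qed.

(** Levels are only cut when the tower grows, and the new spacers lie outside of
    the previous tower. *)
Lemma level_refine N s i j x y : (i < height N)%N -> (j < height (N + s))%N ->
  level (N + s) j x -> level (N + s) j y -> level N i x -> level N i y.
Proof.
move=> ih; elim: s j => [|s IH] j.
  by rewrite addn0 => jh jx jy ix; rewrite (level_inj ih jh ix jx).
rewrite addnS => /height_split[[c [k [c3 kh ->]]]|->].
  by move=> /(level_copy c3 kh) kx /(level_copy c3 kh) ky; exact: IH kx ky.
rewrite !levelE base_spacer spacerE => /andP[h1 _] _ ix.
have := level_lt ih (_ : level N i x); rewrite levelE => /(_ ix)/andP[_ h2].
have : w (N + s) <= w N.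
  rewrite widthD ler_pdivrMr ?exprn_gt0 // ler_peMr ?exprn_ege1 ?ler1n //.
  exact/ltW/width_gt0.
lra.
Qed.

Lemma step_refine N s c j x y : (j < height (N + s))%N -> level (N + s) j x -> level (N + s) j y ->
  step N c x = step N c y.
Proof.
move=> jh jx jy; rewrite /step; apply: eq_bigr => i _; congr (_ * _).
rewrite !indicE; congr (_%:R); congr nat_of_bool; apply/idP/idP; rewrite !inE.
  exact: level_refine (ltn_ord i) jh jx jy.
exact: level_refine (ltn_ord i) jh jy jx.
Qed.

Lemma L2_dct (u : nat -> R -> R) f g : (forall n, measurable_fun setT (u n)) ->
  measurable_fun setT f -> g \in L2 -> (forall n x, `|f x - u n x| <= g x) ->
  (forall x, 0 <= x < 1 -> u n x @[n --> \oo] --> f x) ->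
  forall e, 0 < e -> \forall n \near \oo, nrm (fun x => f x - u n x) < e.
Proof.
move=> mu_ mf gL fu uf e e0.
have gg := L2_mul_integrable gL gL.
have m2 n : measurable_fun setT (EFin \o (fun x => (f x - u n x) * (f x - u n x))).
  by apply/measurable_EFinP; apply: measurable_funM; apply: measurable_funB.
have ae01 : {ae mu, forall x, x \in `[0, 1[%R}.
  exists (~` `[0, 1[%classic); split.
  - by apply: measurableC; exact: measurable_itv.
  - by rewrite /chacon_prob /mrestr setICl measure0.
  - by move=> x /=.
pose H n := EFin \o (fun x => (f x - u n x) * (f x - u n x)).
have cv : {ae mu, forall x, setT x -> H ^~ x @ \oo --> 0%E}.
  apply: ae_mono ae01 => x x01 _ /=; rewrite in_itv /= in x01; have {}uf := uf x x01.
  apply: cvg_EFin; first exact: nearW.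
  have -> : fine \o (fun n => ((f x - u n x) * (f x - u n x))%:E) = (fun n => (f x - u n x) * (f x - u n x)) by [].
  have d0 : f x - u n x @[n --> \oo] --> (0 : R).
    by rewrite -(subrr (f x)); apply: cvgB => //; exact: cvg_cst.
  by rewrite -[X in _ --> X](mulr0 (0 : R)); apply: cvgM.
have bd : {ae mu, forall x n, setT x ->
    (`|H n x| <= (EFin \o (fun x => (g x * g x)%R)) x)%E}.
  by apply: aeW => x n _ /=; rewrite lee_fin normrM ler_pM.
have [_ _ h] := @dominated_convergence _ _ _ mu setT measurableT H (cst 0%E)
  (EFin \o (fun x => g x * g x)) m2 (measurable_cst _) cv gg bd.
rewrite integral0 in h.
have h' : (fun n => fine (\int[mu]_x H n x)%E) @ \oo --> (0 : R) by exact: fine_cvg h.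
have e2 : 0 < e ^+ 2 by rewrite exprn_gt0.
have near_e : \forall n \near \oo, fine (\int[mu]_x H n x)%E < e ^+ 2.
  exact: (cvgr_lt (0 : R)).
apply: filterS near_e => n /= hn.
by rewrite -(ltr_sqr (nrm_ge0 _)) ?nnegrE ?ltW // nrm_sq.
Qed.

Lemma mu_integralE (F : R -> R) : mu.-integrable setT (EFin \o F) ->
  (\int[mu]_x (F x)%:E = \int[lebesgue_measure]_(x in `[0%R, 1%R[%classic) (F x)%:E)%E.
Proof.
move=> Fi.
have m01 : measurable (`[(0 : R), 1[%classic : set (measurableTypeR R)) by exact: measurable_itv.
have mC : measurable (~` `[(0 : R), 1[%classic : set (measurableTypeR R)) by exact: measurableC.
have mN0 : mu (~` `[(0 : R), 1[%classic) = 0%E by rewrite /chacon_prob /mrestr setICl measure0.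
rewrite (@negligible_integral _ _ _ mu setT _ _ mC measurableT Fi mN0).
rewrite setTD setCK.
apply: (@eq_measure_integral _ (measurableTypeR R) R `[0, 1[%classic lebesgue_measure mu) => A mA A01.
exact: pr_sub01.
Qed.

(** Truncation to the interval from - M to M. Between bounded functions, closeness in
    L^1 gives closeness in L^2, which allows the use of the density of the
    continuous functions in L^1. *)
Definition clip (M y : R) : R := Num.max (- M) (Num.min M y).

Lemma clip_cases M y : 0 <= M ->
  [\/ y <= - M /\ clip M y = - M, (- M <= y /\ y <= M) /\ clip M y = y | M <= y /\ clip M y = M].
Proof.
move=> M0; rewrite /clip; have [My|yM] := leP M y.
  by apply: Or33; split => //; apply/max_idPr; lra.
have [h|h] := leP (- M) y; first by apply: Or32; split => //; split => //; exact: ltW.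
by apply: Or31; split => //; exact: ltW.
Qed.

Lemma clip_bound M y : 0 <= M -> `|clip M y| <= M.
Proof. by move=> M0; case: (clip_cases y M0) => -[h ->]; rewrite ler_norml; apply/andP; split; lra. Qed.

Lemma clip_id M y : `|y| <= M -> clip M y = y.
Proof.
move=> yM; have M0 := le_trans (normr_ge0 _) yM.
by move: yM; rewrite ler_norml => /andP[h1 h2]; case: (clip_cases y M0) => -[h ->]; lra.
Qed.

Lemma clip_le M y : 0 <= M -> `|y - clip M y| <= `|y|.
Proof.
move=> M0; have := ler_norm y; have := ler_norm (- y); rewrite normrN => h1 h2.
by case: (clip_cases y M0) => -[h ->]; rewrite ler_norml; apply/andP; split; lra.
Qed.

Lemma clip_lip M x y : 0 <= M -> `|clip M x - clip M y| <= `|x - y|.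
Proof.
move=> M0; have := ler_norm (x - y); have := ler_norm (- (x - y)); rewrite normrN => h1 h2.
by case: (clip_cases x M0) => -[h ->]; case: (clip_cases y M0) => -[h' ->];
  rewrite ler_norml; apply/andP; split; lra.
Qed.

Lemma measurable_clip M f : measurable_fun setT f -> measurable_fun setT (fun x => clip M (f x)).
Proof.
move=> mf; apply: measurable_maxr; first exact: measurable_cst.
by apply: measurable_minr => //; exact: measurable_cst.
Qed.

(** Dominated convergence of the truncations. *)
Lemma clip_dense f e : f \in L2 -> 0 < e -> exists2 M, 0 <= M & nrm (fun x => f x - clip M (f x)) < e.
Proof.
move=> fL e0; have mf := L2_measurable fL.
have absL : (fun x => `|f x|) \in L2.
  apply: L2_intro; first exact: measurableT_comp.
  rewrite (_ : _ \o _ = EFin \o (fun x => f x * f x)); first exact: L2_mul_integrable.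
  by apply/funext => x /=; rewrite -normrM ger0_norm // -expr2 sqr_ge0.
have b1 (n : nat) x : `|f x - clip n%:R (f x)| <= `|f x| by exact: clip_le.
have b2 x : 0 <= x < 1 -> clip n%:R (f x) @[n --> \oo] --> f x.
  move=> _; apply: cvg_near_cst; exists (Num.bound `|f x|) => // n /= hn.
  apply: clip_id; apply/ltW; apply: lt_le_trans (archi_boundP (normr_ge0 _)) _.
  by rewrite ler_nat.
have [n _ hn] := @L2_dct (fun n x => clip n%:R (f x)) f _ (fun n => measurable_clip n%:R mf) mf absL b1 b2 e e0.
by exists n%:R => //; exact: (hn n (leqnn n)).
Qed.

(** Step functions with the truncated values of g at the bottoms of the levels
    converge pointwise on the union of the towers, since the levels shrink. *)
Lemma step_dense_continuous g M e : continuous g -> 0 <= M -> 0 < e ->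
  exists N c, nrm (fun x => clip M (g x) - step N c x) < e.
Proof.
move=> cg M0 e0; pose c N i := clip M (g (base N i)).
have mg : measurable_fun setT g by exact: continuous_measurable_fun.
have b1 N x : `|clip M (g x) - step N (c N) x| <= cst (M + M) x.
  apply: le_trans (ler_normB _ _) _; apply: lerD; first exact: clip_bound.
  by apply: step_bound => // i; exact: clip_bound.
have b2 x : 0 <= x < 1 -> step N (c N) x @[N --> \oo] --> clip M (g x).
  move=> /andP[x0 x1]; apply/cvgrPdist_lt => d d0.
  have /cvgrPdist_lt /(_ d d0) := cg x; rewrite near_nbhs => -[r /= r0 hr].
  have n1 : \forall N \near \oo, w N < r by apply: (cvgr_lt (0 : R)) => //; exact: width_cvg0.
  have n2 : \forall N \near \oo, w N < 1 - x.
    by apply: (cvgr_lt (0 : R)); [exact: width_cvg0 | rewrite subr_gt0].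
  apply: filterS2 n1 n2 => N wr wx.
  have [|i ih ix] := @level_ex R N x.
    by rewrite x0 /=; have := width_gt0 R N; lra.
  rewrite (step_level _ ih ix); apply: le_lt_trans (clip_lip _ _ M0) _.
  apply: hr => /=; move: ix; rewrite levelE => /andP[h1 h2].
  by rewrite ger0_norm; lra.
have [N _ hN] := L2_dct (fun N => measurable_step N (c N)) (measurable_clip M mg) (L2_cst (M + M)) b1 b2 e0.
by exists N, (c N); exact: (hN N (leqnn N)).
Qed.

Lemma continuous_dense f M e : measurable_fun setT f -> 0 <= M -> 0 < e ->
  exists2 g, continuous g & nrm (fun x => clip M (f x) - clip M (g x)) < e.
Proof.
move=> mf M0 e0; pose h x := clip M (f x).
have mh : measurable_fun setT h by exact: measurable_clip.
have hM x : `|h x| <= M by exact: clip_bound.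
pose E : set (measurableTypeR R) := `[(0 : R), 1[%classic.
have mE : measurable E by exact: measurable_itv.
have lE : (lebesgue_measure E < +oo)%E.
  by rewrite lebesgue_measure_itv /= lte_fin ltr01 -EFinB ltry.
have hi : lebesgue_measure.-integrable E (EFin \o h).
  apply: measurable_bounded_integrable => //; first exact: measurable_funTS.
  by exists M; split; [exact: num_real | move=> t Mt x _; apply: le_trans (hM x) (ltW Mt)].
have [g_ [cg ig]] := approximation_continuous_integrable mE lE hi.
move=> cv.
have d0 : 0 < e ^+ 2 / (2 * M + 1) by rewrite divr_gt0 ?exprn_gt0 //; lra.
have nd : \forall n \near \oo, (\int[lebesgue_measure]_(z in E) `|(h z - g_ n z)%:E| < (e ^+ 2 / (2 * M + 1))%:E)%E.
  by apply: (cv _ (open_ereal_lt' _)); rewrite lte_fin.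
have [n _ /(_ n (leqnn n)) /= hn] := nd.
exists (g_ n) => //.
have mg : measurable_fun setT (g_ n) by exact: continuous_measurable_fun.
have cL : (fun x => clip M (f x) - clip M (g_ n x)) \in L2.
  apply: L2_sub; apply: (@L2_bounded _ _ M); try exact: measurable_clip; move=> x; exact: clip_bound.
rewrite -(ltr_sqr (nrm_ge0 _)) ?nnegrE ?ltW // nrm_sq.
have := mu_integralE (L2_mul_integrable cL cL) => muE.
rewrite /dot /Rintegral muE.
set F := fun x => (clip M (f x) - clip M (g_ n x)) * (clip M (f x) - clip M (g_ n x)).
have mF : measurable_fun setT F.
  by apply: measurable_funM; apply: measurable_funB; exact: measurable_clip.
have mD : measurable_fun setT (fun x => h x - g_ n x) by exact: measurable_funB.
have le1 : (\int[lebesgue_measure]_(x in E) (F x)%:E <=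
   \int[lebesgue_measure]_(x in E) ((2 * M)%:E * `|(h x - g_ n x)%:E|))%E.
  apply: ge0_le_integral => //.
  - by move=> x _; rewrite lee_fin /F -expr2 sqr_ge0.
  - by apply/measurable_EFinP; exact: measurable_funTS.
  - apply: measurable_funeM; apply: measurableT_comp => //.
    by apply/measurable_EFinP; exact: measurable_funTS.
  - move=> x _; rewrite -EFinM lee_fin /F.
    have l1 := clip_lip (f x) (g_ n x) M0.
    have l2 : `|clip M (f x) - clip M (g_ n x)| <= 2 * M.
      apply: le_trans (ler_normB _ _) _.
      by have := clip_bound (f x) M0; have := clip_bound (g_ n x) M0; lra.
    have l3 : `|h x - clip M (g_ n x)| <= `|h x - g_ n x|.
      by rewrite -[in leLHS](clip_id (hM x)); exact: clip_lip.
    by rewrite -expr2 -real_normK ?num_real // expr2; apply: ler_pM.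
have le2 : (\int[lebesgue_measure]_(x in E) (F x)%:E <= (2 * M * (e ^+ 2 / (2 * M + 1)))%:E)%E.
  apply: le_trans le1 _; rewrite ge0_integralZl_EFin //; last 2 first.
  - apply: measurableT_comp => //.
    by apply/measurable_EFinP; exact: measurable_funTS.
  - by rewrite mulr_ge0.
  by rewrite [leRHS]EFinM; apply: lee_wpmul2l; [rewrite lee_fin mulr_ge0 | exact: ltW].
have ge1 : (0 <= \int[lebesgue_measure]_(x in E) (F x)%:E)%E.
  by apply: integral_ge0 => x _; rewrite lee_fin /F -expr2 sqr_ge0.
have fn : (\int[lebesgue_measure]_(x in E) (F x)%:E)%E \is a fin_num.
  by rewrite ge0_fin_numE // (le_lt_trans le2) // ltry.
apply: (@le_lt_trans _ _ (2 * M * (e ^+ 2 / (2 * M + 1)))); first by rewrite -lee_fin fineK.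
rewrite mulrA ltr_pdivrMr; last by lra.
by have := exprn_gt0 2 e0; nra.
Qed.

(** Truncate, approximate by a continuous function, then by a step function. *)
Lemma step_dense f e : f \in L2 -> 0 < e -> exists N c, nrm (fun x => f x - step N c x) < e.
Proof.
move=> fL e0; have e3 : 0 < e / 3 by lra.
have [M M0 h1] := clip_dense fL e3.
have mf := L2_measurable fL.
have [g cg h2] := continuous_dense mf M0 e3.
have [N [c h3]] := step_dense_continuous cg M0 e3.
exists N, c.
have mg : measurable_fun setT g by exact: continuous_measurable_fun.
have cf : (fun x => clip M (f x)) \in L2.
  by apply: (@L2_bounded _ _ M); [exact: measurable_clip | move=> x; exact: clip_bound].
have cgL : (fun x => clip M (g x)) \in L2.
  by apply: (@L2_bounded _ _ M); [exact: measurable_clip | move=> x; exact: clip_bound].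
have s1 := L2_sub fL cf; have s2 := L2_sub cf cgL; have s3 := L2_sub cgL (step_L2 N c).
have := nrmD s1 (L2_add s2 s3); have := nrmD s2 s3.
rewrite (_ : (fun x => f x - step N c x) = (fun x => f x - clip M (f x) +
  (clip M (f x) - clip M (g x) + (clip M (g x) - step N c x)))); first by lra.
by apply/funext => x; ring.
Qed.

End Density.

(** * Correlations along the towers *)

Section Correlation.
Variable R : realType.
Local Notation w := (@width R).
Local Notation base := (@base R).
Local Notation level := (@level R).
Local Notation mu := (@chacon_prob R).
Implicit Types (f g h : R -> R).

Lemma integral_indic_pr (A : set R) : measurable A -> \int[mu]_x (\1_A x) = pr A.
Proof. by move=> mA; rewrite /Rintegral integral_indic // setIT. Qed.

Lemma integrable_bounded f (M : R) : measurable_fun setT f -> (forall x, `|f x| <= M) ->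
  mu.-integrable setT (EFin \o f).
Proof.
move=> mf fM; have := L2_mul_integrable (L2_bounded mf fM) (L2_cst 1).
by rewrite (_ : _ \o _ = EFin \o f) //; apply/funext => x /=; rewrite mulr1.
Qed.

Lemma indic_le1 (A : set R) x : `|\1_A x| <= 1 :> R.
Proof. by rewrite indicE; case: (_ \in _); rewrite ?normr1 ?normr0. Qed.

Lemma Rintegral_sum (I : Type) (r : seq I) (P : pred I) (F : I -> R -> R) :
  (forall i, mu.-integrable setT (EFin \o F i)) ->
  mu.-integrable setT (EFin \o (fun x => \sum_(i <- r | P i) F i x)) /\
  \int[mu]_x (\sum_(i <- r | P i) F i x) = \sum_(i <- r | P i) \int[mu]_x F i x.
Proof.
move=> iF; elim: r => [|i r [i1 e1]].
  have -> : (fun x => \sum_(i <- [::] | P i) F i x) = cst 0 by apply/funext => x; rewrite big_nil.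
  rewrite big_nil Rintegral_cst // mul0r; split => //.
  by apply: (@integrable_bounded _ 0) => // x; rewrite normr0.
rewrite big_cons; case: ifP => Pi; last first.
  have -> : (fun x => \sum_(i <- i :: r | P i) F i x) = (fun x => \sum_(i <- r | P i) F i x).
    by apply/funext => x; rewrite big_cons Pi.
  by split.
have -> : (fun x => \sum_(i <- i :: r | P i) F i x) = (fun x => F i x + \sum_(i <- r | P i) F i x).
  by apply/funext => x; rewrite big_cons Pi.
split; last by rewrite RintegralD // e1.
exact: (integrableD measurableT (iF i) i1).
Qed.

(** The chosen levels are disjoint and all have measure [width n]; on the rest of
    the space only the bound B is known. *)
Lemma integral_levels (I : finType) (P : pred I) n (t : I -> nat) (c : I -> R) h (B : R) :
  measurable_fun setT h -> (forall x, `|h x| <= B) ->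
  (forall i, P i -> (t i < height n)%N) -> {in P &, injective t} ->
  (forall i x, P i -> level n (t i) x -> h x = c i) ->
  `|\int[mu]_x h x - w n * \sum_(i | P i) c i| <= B * (1 - w n * #|P|%:R).
Proof.
move=> mh hB th ti hc.
pose s x := \sum_(i | P i) c i * \1_(level n (t i)) x.
pose U := \bigcup_(i in [set` P]) level n (t i).
have mU : measurable U by apply: fin_bigcup_measurable => // i _; exact: measurable_level.
have ms : measurable_fun setT s.
  rewrite /s; under eq_fun do rewrite big_mkcond.
  apply: (@measurable_sum _ _ _ _ _ _ (fun i x => if P i then c i * \1_(level n (t i)) x else 0)) => i.
  case: (P i); last exact: measurable_cst.
  by apply: measurable_funM => //; apply: measurable_indic; exact: measurable_level.
have sU x : U x -> h x = s x.
  move=> [i /= Pi ix]; rewrite (hc i x Pi ix) /s (bigD1 i) //= indicE mem_set // mulr1.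
  rewrite big1 ?addr0 // => j /andP[Pj ji]; rewrite indicE memNset ?mulr0 // => jx.
  by move/eqP: ji; apply; apply: ti => //; apply: level_inj jx ix; exact: th.
have sN x : ~ U x -> s x = 0.
  move=> nU; rewrite /s big1 // => i Pi; rewrite indicE memNset ?mulr0 // => ix.
  by apply: nU; exists i.
have B0 : 0 <= B := le_trans (normr_ge0 _) (hB 0).
have hs x : `|h x - s x| <= B * \1_(~` U) x.
  have [Ux|nUx] := pselect (U x).
    by rewrite sU // subrr normr0 mulr_ge0.
  by rewrite sN // subr0 indicE mem_set // mulr1.
have sB x : `|s x| <= B.
  have [Ux|nUx] := pselect (U x); first by rewrite -sU.
  by rewrite sN // normr0.
have ih := integrable_bounded mh hB; have iis := integrable_bounded ms sB.
have ind i : mu.-integrable setT (EFin \o (fun x => c i * \1_(level n (t i)) x)).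
  apply: (@integrable_bounded _ `|c i|).
    by apply: measurable_funM => //; apply: measurable_indic; exact: measurable_level.
  by move=> x; rewrite normrM -[leRHS]mulr1 ler_wpM2l // indic_le1.
have int_s : \int[mu]_x s x = w n * \sum_(i | P i) c i.
  have [_ ->] := @Rintegral_sum _ (index_enum I) P (fun i x => c i * \1_(level n (t i)) x) ind.
  rewrite mulr_sumr; apply: eq_bigr => i Pi; rewrite RintegralZl //; last first.
    by apply: (@integrable_bounded _ 1); [apply: measurable_indic; exact: measurable_level | exact: indic_le1].
  by rewrite integral_indic_pr; [rewrite pr_level ?th // mulrC | exact: measurable_level].
rewrite -int_s -RintegralB //.
have mhs : measurable_fun setT (fun x => h x - s x) by exact: measurable_funB.
have ihs : mu.-integrable setT (EFin \o (fun x => h x - s x)).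
  apply: (@integrable_bounded _ (B + B)) => // x; apply: le_trans (ler_normB _ _) _; exact: lerD.
apply: le_trans (le_normr_Rintegral _ ihs) _ => //.
have mC : measurable (~` U) by exact: measurableC.
have iC : mu.-integrable setT (EFin \o (fun x => B * \1_(~` U) x)).
  apply: (@integrable_bounded _ B); first by apply: measurable_funM => //; exact: measurable_indic.
  move=> x; rewrite normrM (ger0_norm B0) -[leRHS]mulr1 ler_wpM2l // indicE.
  by case: (_ \in _); rewrite ?normr1 ?normr0.
have pU : pr U = w n * #|P|%:R.
  have := @pr_levels R I P n t setT measurableT th ti.
  rewrite setTI => ->; rewrite (eq_bigr (fun=> w n)) => [|i Pi]; last by rewrite setTI pr_level // th.
  by rewrite sumr_const mulr_natr.
rewrite -pU -pr_setC // -integral_indic_pr // -RintegralZl //; last first.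
  apply: (@integrable_bounded _ 1); first exact: measurable_indic.
  by move=> x; rewrite indicE; case: (_ \in _); rewrite ?normr1 ?normr0.
apply: le_Rintegral => //.
apply: (@integrable_bounded _ (B + B)); first exact: measurableT_comp.
by move=> x; rewrite normr_id; apply: le_trans (ler_normB _ _) _; exact: lerD.
Qed.

Lemma le_dist_cvg (a b c : R) (u v : nat -> R) : u n @[n --> \oo] --> b ->
  v n @[n --> \oo] --> c -> (\forall n \near \oo, `|a - u n| <= v n) -> `|a - b| <= c.
Proof.
move=> ub vc h.
have ab : `|a - u n| @[n --> \oo] --> `|a - b|.
  by apply: cvg_norm; apply: cvgB => //; exact: cvg_cst.
exact: (ler_cvg_to ab vc).
Qed.

Lemma step_const N n c j x y : (N <= n)%N -> (j < height n)%N -> level n j x -> level n j y ->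
  step N c x = step N c y.
Proof. by move=> Nn; rewrite -(subnKC Nn); exact: step_refine. Qed.

Section GapMean.
Variable P : nat -> {poly R}.
Hypothesis P_lim : forall q, coef_cvg (gap_poly R ^~ q) (P q).

(** Dropping a fixed number Q of copies among 3^s does not change the limit. *)
Lemma gap_mean_cvg (F : nat -> R) q Q : (forall j, `|F j| <= 1) ->
  (3 ^+ s)^-1 * \sum_(b < 3 ^ s - Q) F (gap_sum b q) @[s --> \oo] -->
  \sum_(j < q.+1) (P q)`_j * F j.
Proof.
move=> F1.
have c1 : (3 ^+ s)^-1 * \sum_(b < 3 ^ s) F (gap_sum b q) @[s --> \oo] -->
    \sum_(j < q.+1) (P q)`_j * F j.
  under eq_fun do rewrite -sum_gap_poly.
  apply: (@cvg_sumr _ _ _ _ (fun (j : 'I_q.+1) s => (gap_poly R s q)`_j * F j)) => j _.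
  by apply: cvgMr_tmp; exact: P_lim.
have c2 : (3 ^+ s)^-1 * \sum_(b < 3 ^ s) F (gap_sum b q) -
    (3 ^+ s)^-1 * \sum_(b < 3 ^ s - Q) F (gap_sum b q) @[s --> \oo] --> (0 : R).
  apply: norm_cvg0; apply: (@squeeze_cvgr _ _ _ _ (cst 0) (fun s => Q%:R / 3 ^+ s)).
  - apply: nearW => s; rewrite normr_ge0 /= -mulrBr normrM mulrC.
    rewrite [X in _ * X]ger0_norm ?invr_ge0 ?exprn_ge0 // ler_wpM2r ?invr_ge0 ?exprn_ge0 //.
    rewrite -!(big_mkord xpredT (fun b => F (gap_sum b q))).
    rewrite (@big_cat_nat _ _ _ (3 ^ s - Q)%N 0%N (3 ^ s)%N) ?leq_subr //= addrAC subrr add0r.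
    apply: le_trans (ler_norm_sum _ _ _) _.
    apply: (@le_trans _ _ (\sum_(3 ^ s - Q <= i < 3 ^ s) 1)); first exact: ler_sum.
    by rewrite sumr_const_nat ler_nat; lia.
  - exact: cvg_cst.
  - exact: inv_pow3_cvg.
have c3 : (3 ^+ s)^-1 * \sum_(b < 3 ^ s) F (gap_sum b q) -
    ((3 ^+ s)^-1 * \sum_(b < 3 ^ s) F (gap_sum b q) -
     (3 ^+ s)^-1 * \sum_(b < 3 ^ s - Q) F (gap_sum b q)) @[s --> \oo] -->
   \sum_(j < q.+1) (P q)`_j * F j - 0 by exact: cvgB.
by move: c3; rewrite subr0; under eq_fun do rewrite opprB addrCA subrr addr0.
Qed.

Variables (N : nat) (c d : nat -> R).
Hypothesis c1 : forall i, `|c i| <= 1.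
Hypothesis d1 : forall i, `|d i| <= 1.
Let f := step N c.
Let g := step N d.

(** Let b be the rank, among the copies of Tower n inside Tower n + s, of the
    copy where a point arrives under T^-k. A point of level i in the copy of
    rank b + q i arrives on level q i * height n + i + j - k, where j is the
    number of spacers crossed; a level i is good when this is a level of Tower n
    for all j from 0 to q i. Averaging over b as s grows makes j distributed
    according to P (q i). *)
Lemma corr_bound n (k : nat) (good : pred 'I_(height n)) (q : 'I_(height n) -> nat) :
  (N <= n)%N ->
  (forall i, good i -> (k <= q i * height n + i)%N /\ (q i * height n + i + q i < k + height n)%N) ->
  `|dot (f \o power (- k%:Z)) g -
    w n * \sum_(i < height n | good i) g (base n i) *
       \sum_(j < (q i).+1) (P (q i))`_j * f (base n (q i * height n + i + j - k))|
  <= 1 - w n * #|good|%:R.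
Proof.
move=> Nn qk.
(* The ranks b + q i have to be less than 3^s: the last Q copies are given up. *)
pose Q := \max_(i < height n) q i.
have qQ i : (q i <= Q)%N by exact: (leq_bigmax i).
have f1 x : `|f x| <= 1 by exact: step_bound.
have g1 x : `|g x| <= 1 by exact: step_bound.
have bh i : (i < height n)%N -> level n i (base n i).
  by move=> ih; rewrite levelE lexx /= ltrDl width_gt0.
pose F i j := f (base n (q i * height n + i + j - k)).
pose val s (p : 'I_(3 ^ s - Q) * 'I_(height n)) := g (base n p.2) * F p.2 (gap_sum p.1 (q p.2)).
pose tt s (p : 'I_(3 ^ s - Q) * 'I_(height n)) := (col_pos n (p.1 + q p.2) + p.2)%N.
pose gd s : pred ('I_(3 ^ s - Q) * 'I_(height n)) := fun p => good p.2.
have main s : `|dot (f \o power (- k%:Z)) g - w (n + s) * \sum_(p | gd s p) val s p| <=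
    1 * (1 - w (n + s) * #|gd s|%:R).
  have bnd (p : 'I_(3 ^ s - Q) * 'I_(height n)) : (p.1 + q p.2 < 3 ^ s)%N.
    by have := ltn_ord p.1; have := qQ p.2; lia.
  apply: (@integral_levels _ (gd s) (n + s) (@tt s) (val s)).
  - apply: measurable_funM; last exact: measurable_step.
    by apply: measurableT_comp; [exact: measurable_step | exact: measurable_power].
  - by move=> x; rewrite normrM -[leRHS]mulr1; apply: ler_pM => //=; exact: f1.
  - by move=> p _; have [] := @level_col R n s _ _ (bnd p) (ltn_ord p.2).
  - move=> [a i] [b j] _ _ /= /(col_pos_inj (ltn_ord i) (ltn_ord j)) [ab ij].
    have {}ij : i = j by exact: val_inj.
    by rewrite ij in ab *; congr (_, _); apply: val_inj => /=; move: ab => /addIn.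
  - move=> [b i] x gi /=; rewrite /tt /val /=.
    have [th tsub] := @level_col R n s _ _ (bnd (b, i)) (ltn_ord i); move=> ix.
    have [k1 k2] := qk i gi.
    pose i' := (q i * height n + i + gap_sum b (q i) - k)%N.
    have ge := gap_sum_le b (q i).
    have ih' : (i' < height n)%N by rewrite /i'; lia.
    have bs : (b < 3 ^ s)%N by have := ltn_ord b; lia.
    have [th' tsub'] := @level_col R n s _ _ bs ih'.
    have pe : power (- k%:Z) x = x - base (n + s) (col_pos n (b + q i) + i) + base (n + s) (col_pos n b + i').
      have e : (col_pos n (b + q i) + i = col_pos n b + i' + k)%N by rewrite col_posD /i'; lia.
      by apply: power_level ix _ => //; rewrite e PoszD addrK.
    have lx : level (n + s) (col_pos n b + i') (power (- k%:Z) x).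
      by rewrite pe; exact: level_shift ix.
    rewrite mulrC; congr (_ * _).
      by apply: (@step_const N n d i) => //; [exact: tsub | exact: bh].
    by apply: (@step_const N n c i') => //; [exact: tsub' | exact: bh].
have sumE s : w (n + s) * \sum_(p | gd s p) val s p =
    w n * \sum_(i | good i) g (base n i) * ((3 ^+ s)^-1 * \sum_(b < 3 ^ s - Q) F i (gap_sum b (q i))).
  rewrite widthD -mulrA; congr (_ * _).
  rewrite (_ : \sum_(p | gd s p) val s p = \sum_(i | good i) \sum_(b < 3 ^ s - Q) g (base n i) * F i (gap_sum b (q i))).
    by rewrite mulr_sumr; apply: eq_bigr => i _; rewrite mulrCA -mulr_sumr.
  by rewrite exchange_big /= pair_big_dep /=; apply: eq_bigl => -[b i].
have cardE s : (Q <= 3 ^ s)%N -> w (n + s) * #|gd s|%:R = w n * #|good|%:R * (1 - Q%:R / 3 ^+ s).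
  move=> Qs; have -> : #|gd s| = ((3 ^ s - Q) * #|good|)%N.
    rewrite -!sum1_card -(pair_big_dep xpredT (fun _ i => good i) (fun _ _ => 1%N)) /=.
    by rewrite sum_nat_const card_ord.
  by rewrite widthD natrM natrB // natrX; field; rewrite expf_neq0.
apply: (@le_dist_cvg _ _ _ (fun s => w n * \sum_(i | good i) g (base n i) *
  ((3 ^+ s)^-1 * \sum_(b < 3 ^ s - Q) F i (gap_sum b (q i))))
  (fun s => 1 - w n * #|good|%:R * (1 - Q%:R / 3 ^+ s))).
- apply: cvgMl_tmp.
  apply: (@cvg_sumr _ _ _ _ (fun (i : 'I_(height n)) s => g (base n i) *
    ((3 ^+ s)^-1 * \sum_(b < 3 ^ s - Q) F i (gap_sum b (q i))))) => i _.
  by apply: cvgMl_tmp; apply: gap_mean_cvg => j; exact: f1.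
- have cc : 1 - w n * #|good|%:R * (1 - Q%:R / 3 ^+ s) @[s --> \oo] --> 1 - w n * #|good|%:R * (1 - 0).
    apply: cvgB; first exact: cvg_cst.
    apply: cvgMl_tmp; apply: cvgB; first exact: cvg_cst.
    exact: inv_pow3_cvg.
  by move: cc; rewrite subr0 mulr1.
- exists Q => // s /= Qs; rewrite -sumE -cardE; last by rewrite (leq_trans Qs) // ltnW // ltn_expl.
  by have := main s; rewrite mul1r.
Qed.

End GapMean.

End Correlation.

Lemma card_interval h a b : (#|[pred i : 'I_h | a <= i < b]| <= b - a)%N.
Proof.
rewrite -sum1_card big_mkcond /=.
pose F i := (if (a <= i < b)%N then 1 else 0)%N.
suff : (\sum_(i < h) F i <= minn h b - a)%N by move/leq_trans; apply; lia.
elim: h => [|h IH]; first by rewrite big_ord0.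
rewrite big_ord_recr /= {2}/F; move: IH; set S := (\sum_(i < h) _)%N.
case: ifP => [/andP[h1 h2]|/negbT]; first by lia.
by rewrite negb_and -ltnNge -leqNgt => /orP[]; lia.
Qed.

(** Counting the good levels by their complement, covered by three intervals. *)
Lemma card_good h (good : pred 'I_h) (a1 b1 a2 b2 a3 b3 : nat) :
  (forall i : 'I_h, [|| good i, a1 <= i < b1, a2 <= i < b2 | a3 <= i < b3]%N) ->
  (h <= #|good| + ((b1 - a1) + (b2 - a2) + (b3 - a3)))%N.
Proof.
move=> H.
have c1 := @card_interval h a1 b1; have c2 := @card_interval h a2 b2; have c3 := @card_interval h a3 b3.
rewrite -[leqLHS]card_ord.
have -> : #|'I_h| = #|[predU good & [predU [pred i : 'I_h | a1 <= i < b1]%N &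
    [predU [pred i : 'I_h | a2 <= i < b2]%N & [pred i : 'I_h | a3 <= i < b3]%N]]]|.
  by apply: eq_card => i; rewrite !inE; have /= -> := H i.
have leU (A B : pred 'I_h) : (#|[predU A & B]| <= #|A| + #|B|)%N by rewrite -cardUI leq_addr.
apply: leq_trans (leU _ _) _; rewrite leq_add2l -addnA.
apply: leq_trans (leU _ _) _; apply: leq_add => //.
by apply: leq_trans (leU _ _) _; exact: leq_add.
Qed.

Section Asymptotics.
Variable R : realType.
Local Notation w := (@width R).
Local Notation base := (@base R).
Local Notation level := (@level R).

Lemma width_card n c (x : nat) : (height n <= x + c)%N -> 1 - w n * x%:R <= (c.+1)%:R * w n.
Proof.
rewrite -(ler_nat R) natrD => h; have := width_height R n; have w0 := width_gt0 R n.
by have := ler_wpM2l (ltW w0) h; rewrite mulrDr => h2; rewrite -(natr1 c) mulrDl mul1r; lra.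
Qed.

(** Summation by parts. *)
Lemma shift_pairing (p : {poly R}) q (F : nat -> R) : (size p <= q.+1)%N -> (forall j, `|F j| <= 1) ->
  `|\sum_(j < q.+1) p`_j * F j.+1 - \sum_(j < q.+1) p`_j * F j| <= l1norm ((1 - 'X) * p).
Proof.
move=> sp F1.
have -> : \sum_(j < q.+1) p`_j * F j.+1 - \sum_(j < q.+1) p`_j * F j =
    - \sum_(j < q.+2) ((1 - 'X) * p)`_j * F j.
  rewrite -opprB; congr (- _).
  under [in RHS]eq_bigr do rewrite mulrBl mul1r coefB coefXM mulrBl.
  rewrite sumrB; congr (_ - _).
    by rewrite [RHS]big_ord_recr /= (nth_default _ sp) mul0r addr0.
  by rewrite [RHS]big_ord_recl /= mul0r add0r.
rewrite normrN (@l1normE _ q.+2); last first.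
  rewrite mulrBl mul1r; apply: leq_trans (size_polyD _ _) _; rewrite geq_max size_polyN.
  rewrite (leq_trans sp) //= mulrC; apply: leq_trans (size_polyMleq _ _) _.
  by rewrite size_polyX addn2.
apply: le_trans (ler_norm_sum _ _ _) _; apply: ler_sum => j _.
by rewrite normrM -[leRHS]mulr1 ler_wpM2l.
Qed.

Variable P : nat -> {poly R}.
Hypothesis P_lim : forall q, coef_cvg (gap_poly R ^~ q) (P q).

Section Steps.
Variables (N : nat) (c d : nat -> R).
Hypothesis c1 : forall i, `|c i| <= 1.
Hypothesis d1 : forall i, `|d i| <= 1.
Let f := step N c.
Let g := step N d.

Let f1 x : `|f x| <= 1.
Proof. exact: step_bound. Qed.

Let g1 x : `|g x| <= 1.
Proof. exact: step_bound. Qed.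

(** Going back by k = m h + k' crosses m copies from the levels above k' and
    m + 1 copies from the levels below; few levels are not good. The same number
    of copies is crossed when going back by k + 1, and the level reached is one
    lower, which amounts to one spacer less. *)
Lemma corr_shift_bound n m (k' C : nat) : (N <= n)%N -> (k' <= height n + C)%N ->
  `|dot (f \o power (- (m * height n + k')%N%:Z)) g -
    dot (f \o power (- (m * height n + k').+1%N%:Z)) g| <=
  shift_defect P 0 m + shift_defect P 0 m.+1 + 2 * ((2 * m + C + 4)%N%:R * w n).
Proof.
move=> Nn kC; set h := height n in kC *; set k := (m * h + k')%N.
pose good (i : 'I_h) := ((k' < i) && (i + m < k' + h) || (i + m.+1 < k') && (k' < h + i))%N.
pose q (i : 'I_h) := if (k' < i)%N then m else m.+1.
have qk i : good i -> (k < q i * h + i)%N /\ (q i * h + i + q i < k + h)%N.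
  by rewrite /good /q /k; case: ltnP => ki /=; rewrite ?orbF => H; rewrite ?mulSn; lia.
(* Good levels are those on which [corr_bound] applies to k and to k.+1. *)
have b1 := @corr_bound R P P_lim N c d c1 d1 n k good q Nn.
have b2 := @corr_bound R P P_lim N c d c1 d1 n k.+1 good q Nn.
have {}b1 := b1 (fun i gi => conj (ltnW (qk i gi).1) (qk i gi).2).
have {}b2 := b2 (fun i gi => conj (qk i gi).1 (leqW (qk i gi).2)).
have wg : 1 - w n * #|good|%:R <= (2 * m + C + 4)%N%:R * w n.
  have cg := @card_good h good (h - m) h (k' - m.+1) k'.+1 0 C.+1.
  have {}cg : (h <= #|good| + (2 * m + C + 3))%N.
    apply: leq_trans (cg _) _; last by rewrite leq_add2l; lia.
    by move=> i; have := ltn_ord i; rewrite /good; lia.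
  by have := width_card cg; rewrite -addnS.
set S1 := w n * _ in b1; set S2 := w n * _ in b2.
have S12 : `|S1 - S2| <= shift_defect P 0 m + shift_defect P 0 m.+1.
  rewrite /S1 /S2 -mulrBr -sumrB normrM gtr0_norm ?width_gt0 //.
  set D := shift_defect P 0 m + shift_defect P 0 m.+1.
  have D0 : 0 <= D by rewrite addr_ge0 ?l1norm_ge0.
  apply: (@le_trans _ _ (w n * (h%:R * D))); last first.
    rewrite mulrA width_height; have := width_gt0 R n; nra.
  rewrite (ler_wpM2l (ltW (width_gt0 R n))) //.
  apply: le_trans (ler_norm_sum _ _ _) _.
  apply: (@le_trans _ _ (\sum_(i | good i) D)); last first.
    by rewrite sumr_const -[D *+ _]mulr_natl ler_wpM2r // ler_nat -[leqRHS]card_ord max_card.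
  apply: ler_sum => i gi; have [q1 q2] := qk i gi.
  rewrite -mulrBr normrM -[leRHS]mul1r; apply: ler_pM => //.
  pose F j := f (base n (q i * h + i + j - k.+1)).
  have -> : \sum_(j < (q i).+1) (P (q i))`_j * f (base n (q i * h + i + j - k)) =
      \sum_(j < (q i).+1) (P (q i))`_j * F j.+1.
    apply: eq_bigr => j _; congr (_ * f (base n _)); lia.
  have sp := @shift_pairing _ (q i) F (size_gap_law P_lim (q i)) (fun j => f1 _).
  apply: le_trans sp _.
  have sd p : l1norm ((1 - 'X) * P p) = shift_defect P 0 p by rewrite /shift_defect expr0 mulr1.
  by rewrite sd /q /D; case: ifP => _; rewrite ?lerDl ?lerDr l1norm_ge0.
have := ler_distD S1 (dot (f \o power (- k%:Z)) g) (dot (f \o power (- k.+1%:Z)) g).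
have := ler_distD S2 S1 (dot (f \o power (- k.+1%:Z)) g).
rewrite [`|S2 - dot _ _|]distrC.
move: b1 b2; rewrite -/f -/g => b1 b2; lra.
Qed.

(** When k' is small with respect to h, m copies are crossed from all but few
    levels. The j spacers crossed are part of the time k, so that the level
    reached is that of T^-k' followed by T^j, and T^j is moved to the other
    function. *)
Lemma corr_factor_bound n m (k : nat) (k' : int) : (N <= n)%N ->
  (k%:Z = (m * height n)%N%:Z + k')%R ->
  `|dot (f \o power (- k%:Z)) g -
    \sum_(j < m.+1) (P m)`_j * dot (f \o power (- k')) (g \o power (- j%:Z))| <=
  2 * ((2 * m + 2 * `|k'| + 1)%N%:R * w n).
Proof.
move=> Nn ke; set h := height n in ke *.
pose good (i : 'I_h) := (k <= m * h + i)%N && (m * h + i + m < k + h)%N && (i + m < h)%N.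
have gd i : good i -> [/\ (k <= m * h + i)%N, (m * h + i + m < k + h)%N & (i + m < h)%N].
  by rewrite /good => /andP[/andP[]].
have b1 := @corr_bound R P P_lim N c d c1 d1 n k good (fun=> m) Nn.
have {}b1 := b1 (fun i gi => let: And3 p1 p2 _ := gd i gi in conj p1 p2).
rewrite /= -/f -/g -/h in b1.
set dl := 1 - _ in b1.
have dl_le : dl <= (2 * m + 2 * `|k'| + 1)%N%:R * w n.
  have cg := @card_good h good 0 `|k'|%N (h - (m + `|k'|%N)) h (h - m) h.
  have {}cg : (h <= #|good| + (2 * m + 2 * `|k'|%N))%N.
    apply: leq_trans (cg _) _; last by rewrite leq_add2l; lia.
    by move=> i; have := ltn_ord i; rewrite /good; lia.
  by have := width_card cg; rewrite -addn1.
pose F (i : 'I_h) j := f (base n (m * h + i + j - k)).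
pose Y j := w n * \sum_(i | good i) g (base n i) * F i j.
have bj (j : 'I_m.+1) : `|dot (f \o power (- k')) (g \o power (- j%:Z)) - Y j| <= dl.
  have jm : (j <= m)%N by rewrite -ltnS.
  have := @integral_levels R _ good n (fun i : 'I_h => (i + j)%N)
     (fun i => g (base n i) * F i j)
     (fun x => f (power (- k') x) * g (power (- j%:Z) x)) 1.
  rewrite mul1r; apply.
  - apply: measurable_funM; apply: measurableT_comp; try exact: measurable_step; exact: measurable_power.
  - by move=> x; rewrite normrM -[leRHS]mulr1; apply: ler_pM => //=; exact: f1.
  - by move=> i /gd[_ _]; lia.
  - by move=> i i' _ _ /addIn; exact: val_inj.
  - move=> i x gi ix; have [p1 p2 p3] := gd i gi.
    have ih : (i + j < h)%N by lia.
    have bh u : (u < height n)%N -> level n u (base n u).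
      by move=> uh; rewrite levelE lexx /= ltrDl width_gt0.
    rewrite mulrC; congr (_ * _).
      apply: (@step_const R N n d i) => //; last exact: bh.
      rewrite (@power_level R _ n (i + j) i) //; first exact: level_shift ix.
      by rewrite PoszD addrK.
    have uh : (m * h + i + j - k < height n)%N by rewrite -/h; lia.
    apply: (@step_const R N n c (m * h + i + j - k)) => //; last exact: bh.
    rewrite (@power_level R _ n (i + j) (m * h + i + j - k)) //; first exact: level_shift ix.
    by lia.
have YE : w n * \sum_(i < h | good i) g (base n i) * \sum_(j < m.+1) (P m)`_j * F i j =
    \sum_(j < m.+1) (P m)`_j * Y j.
  rewrite /Y mulr_sumr.
  under [RHS]eq_bigr do rewrite mulrCA mulr_sumr mulr_sumr.
  rewrite exchange_big /=; apply: eq_bigr => i _; rewrite mulr_sumr mulr_sumr; apply: eq_bigr => j _.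
  by ring.
rewrite [X in `|_ - X|]YE in b1.
have b2 : `|\sum_(j < m.+1) (P m)`_j * Y j -
    \sum_(j < m.+1) (P m)`_j * dot (f \o power (- k')) (g \o power (- j%:Z))| <= dl.
  rewrite -sumrB; apply: le_trans (ler_norm_sum _ _ _) _.
  have dl0 : 0 <= dl := le_trans (normr_ge0 _) b1.
  apply: (@le_trans _ _ (\sum_(j < m.+1) `|(P m)`_j| * dl)).
    apply: ler_sum => j _; rewrite -mulrBr normrM ler_wpM2l // distrC; exact: bj.
  rewrite -mulr_suml -[leRHS]mul1r ler_wpM2r //.
  by rewrite -(l1normE (size_gap_law P_lim m)); exact: l1norm_gap_law.
set Z := \sum_(j < m.+1) (P m)`_j * dot _ _ in b2 *.
have := ler_distD (\sum_(j < m.+1) (P m)`_j * Y j) (dot (f \o power (- k%:Z)) g) Z.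
lra.
Qed.

End Steps.
End Asymptotics.

(** * Greedy expansions *)

Section Greedy.
Local Open Scope nat_scope.
Implicit Types k l r s n : nat.

Lemma greedy_index_ge k n : height n <= k -> n <= greedy_index k.
Proof.
move=> hk; have nk : n < k by exact: leq_trans (height_gt n) hk.
exact: (@leq_bigmax_cond _ (fun i : 'I_k => height i <= k) (fun i : 'I_k => (i : nat)) (Ordinal nk) hk).
Qed.

Lemma height_greedy_index k : 0 < k -> height (greedy_index k) <= k.
Proof.
move=> k0; have h0 : 0 < #|[pred i : 'I_k | height i <= k]|.
  by apply/card_gt0P; exists (Ordinal k0).
have [i hi e] := eq_bigmax_cond (fun i : 'I_k => (i : nat)) h0.
by have -> : greedy_index k = i by rewrite -e.
Qed.

Lemma greedy_index_lt k : k < height (greedy_index k).+1.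
Proof. by rewrite ltnNge; apply/negP => /greedy_index_ge; rewrite ltnn. Qed.

Lemma greedy_remE k l : greedy_rem k l =
  greedy_digit k l * height (greedy_index k - l) + greedy_rem k l.+1.
Proof. exact: divn_eq. Qed.

Lemma greedy_remS_lt k l : greedy_rem k l.+1 < height (greedy_index k - l).
Proof. by rewrite /= ltn_mod height_gt0. Qed.

Lemma greedy_rem_le k l : l <= greedy_index k -> greedy_rem k l <= 3 * height (greedy_index k - l).
Proof.
move=> ln; case: l ln => [_|l ln].
  by rewrite subn0; have := greedy_index_lt k; rewrite /=; lia.
have := greedy_remS_lt k l; rewrite -(subnSK ln) /=; lia.
Qed.

Lemma greedy_digit_le3 k l : l <= greedy_index k -> greedy_digit k l <= 3.
Proof.
move=> /greedy_rem_le h; rewrite /greedy_digit -ltnS ltn_divLR ?height_gt0 //.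
by apply: leq_ltn_trans h _; rewrite ltn_mul2r height_gt0.
Qed.

Lemma greedy_digit3 k l l' : l <= greedy_index k -> greedy_digit k l = 3 -> l < l' ->
  greedy_digit k l' = 0.
Proof.
move=> /greedy_rem_le h d3 ll'.
have z d : greedy_rem k (l.+1 + d) = 0.
  elim: d => [|d IH]; last first.
    by rewrite addnS -[LHS]/(greedy_rem k (l.+1 + d) %% height (greedy_index k - (l.+1 + d))) IH mod0n.
  by rewrite addn0; move: h; rewrite greedy_remE d3; lia.
by rewrite /greedy_digit -(subnKC ll') z div0n.
Qed.

(** Since height n = 3 * height n.-1 + 1, rewriting the leading digits in terms of
    a lower height adds 1 for each copy counted, at each stage. *)
Definition value_drift (a : nat -> nat) r := \sum_(i < r) ternary_value a i.

Lemma greedy_ternary k r : r <= greedy_index k ->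
  k = ternary_value (greedy_digit k) r * height (greedy_index k - r) +
      value_drift (greedy_digit k) r + greedy_rem k r.+1.
Proof.
rewrite /value_drift; elim: r => [|r IH] rn.
  by rewrite big_ord0 addn0 [LHS](greedy_remE k 0).
have := IH (ltnW rn); rewrite greedy_remE -(subnSK rn) [height _.+1]/=.
have -> : \sum_(i < r.+1) ternary_value (greedy_digit k) i =
    \sum_(i < r) ternary_value (greedy_digit k) i + ternary_value (greedy_digit k) r.
  by rewrite big_ord_recr.
rewrite [ternary_value _ r.+1]/=; nia.
Qed.

Lemma ternary_value_eq (a b : nat -> nat) r : (forall l, l <= r -> a l = b l) -> ternary_value a r = ternary_value b r.
Proof. by elim: r => [|r IH] ab /=; rewrite ?IH ?ab // => l lr; apply: ab; exact: leqW. Qed.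

Lemma value_drift_eq (a b : nat -> nat) r : (forall l, l <= r -> a l = b l) ->
  value_drift a r = value_drift b r.
Proof.
move=> ab; apply: eq_bigr => i _; apply: ternary_value_eq => l li; apply: ab.
by rewrite (leq_trans li) // ltnW.
Qed.

Lemma greedy_rem_zeros k r s : (forall l, r < l <= r + s -> greedy_digit k l = 0) ->
  greedy_rem k r.+1 = greedy_rem k (r + s).+1.
Proof.
elim: s => [|s IH] h; first by rewrite addn0.
rewrite IH => [|l /andP[l1 l2]]; last by apply: h; rewrite l1 addnS leqW.
by rewrite greedy_remE -addnS h ?mul0n //; lia.
Qed.

(** Since 2 h_i = h_(i+1) - h_i - 1, a block of twos telescopes. *)
Lemma greedy_rem_twos k r s : r + s <= greedy_index k ->
  (forall l, r < l <= r + s -> greedy_digit k l = 2) ->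
  greedy_rem k r.+1 + s + height (greedy_index k - (r + s)) =
  height (greedy_index k - r) + greedy_rem k (r + s).+1.
Proof.
elim: s => [|s IH] rs h; first by rewrite !addn0 addnC.
rewrite addnS in rs.
have e : greedy_rem k r.+1 + s + height (greedy_index k - (r + s)) =
    height (greedy_index k - r) + greedy_rem k (r + s).+1.
  apply: IH => [|l /andP[l1 l2]]; first exact: ltnW.
  by apply: h; rewrite l1 addnS leqW.
move: e; rewrite !addnS [greedy_rem k (r + s).+1]greedy_remE h; last by lia.
rewrite -(subnSK rs) [height _.+1]/=; lia.
Qed.

End Greedy.

(** * Correlations along the sequence *)

Section Sequence.
Variables (R : realType) (k : nat -> nat).
Hypothesis k_gt0 : forall j, (0 < k j)%N.
Hypothesis k_infty : k j @[j --> \oo] --> \oo.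
Variable alpha : nat -> nat.
Hypothesis k_alpha : forall l, \forall j \near \oo, greedy_digit (k j) l = alpha l.
Local Notation w := (@width R).

Lemma near_k_ge M : \forall j \near \oo, (M <= k j)%N.
Proof. by have := @k_infty [set x | (M <= x)%N]; apply; exists M. Qed.

Lemma near_greedy_index M : \forall j \near \oo, (M <= greedy_index (k j))%N.
Proof. by apply: filterS (near_k_ge (height M)) => j; exact: greedy_index_ge. Qed.

Lemma near_digits r : \forall j \near \oo, forall l, (l <= r)%N -> greedy_digit (k j) l = alpha l.
Proof.
elim: r => [|r IH]; first by apply: filterS (k_alpha 0) => j h l; rewrite leqn0 => /eqP ->.
apply: filterS2 IH (k_alpha r.+1) => j h1 h2 l.
by rewrite leq_eqVlt ltnS => /orP[/eqP -> //|/h1].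
Qed.

Lemma digit_le3 l : (alpha l <= 3)%N.
Proof.
have [n _ /(_ n (leqnn n)) /= [h1 <-]] := filterI (near_greedy_index l) (k_alpha l).
exact: greedy_digit_le3.
Qed.

Lemma digit3_zeros l l' : alpha l = 3%N -> (l < l')%N -> alpha l' = 0%N.
Proof.
move=> al ll'.
have [n _ /(_ n (leqnn n)) /= [h1 [h2 <-]]] := filterI (near_greedy_index l) (filterI (k_alpha l) (k_alpha l')).
by apply: greedy_digit3 h1 _ ll'; rewrite h2.
Qed.

Lemma digit0_gt0 : (0 < alpha 0%N)%N.
Proof.
have [n _ /(_ n (leqnn n)) /= <-] := k_alpha 0%N.
by rewrite /greedy_digit subn0 divn_gt0 ?height_gt0 // height_greedy_index.
Qed.

Lemma ternary_value_gt0 r : (0 < ternary_value alpha r)%N.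
Proof. by elim: r => [|r IH] /=; [exact: digit0_gt0 | rewrite addn_gt0 muln_gt0 IH]. Qed.

Lemma near_width r e : 0 < e -> \forall j \near \oo, w (greedy_index (k j) - r) < e.
Proof.
move=> e0.
have [M _ HM] : \forall n \near \oo, w n < e.
  by apply: (cvgr_lt (0 : R)) => //; exact: width_cvg0.
apply: filterS (near_greedy_index (M + r)) => j h; apply: HM => /=; lia.
Qed.

Lemma near_decomposition r : \forall j \near \oo,
  k j = (ternary_value alpha r * height (greedy_index (k j) - r) +
    (value_drift alpha r + greedy_rem (k j) r.+1))%N.
Proof.
apply: filterS2 (near_greedy_index r) (near_digits r) => j h1 h2.
rewrite {1}(greedy_ternary h1) -addnA; congr (_ * _ + (_ + _))%N.
  exact: ternary_value_eq.
exact: value_drift_eq.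
Qed.

(** The remainder left by s more digits is of order height (n - s), up to a
    constant, hence small with respect to height n when s is large. *)
Lemma small_remainder : (exists r, (forall l, (r < l)%N -> alpha l = 2%N) \/
    (forall l, (r < l)%N -> alpha l = 0%N)) ->
  exists m r, (1 <= m)%N /\ forall e : R, 0 < e -> \forall j \near \oo,
    `|((k j)%:Z - (m * height (greedy_index (k j) - r))%N%:Z)%R|%N%:R * w (greedy_index (k j) - r) < e.
Proof.
move=> [r tail]; pose C := value_drift alpha r.
pose kp m j := ((k j)%:Z - (m * height (greedy_index (k j) - r))%N%:Z)%R.
have [m m1 small] : exists2 m, (1 <= m)%N & forall s, \forall j \near \oo,
    (`|kp m j| <= C + s + height (greedy_index (k j) - r - s))%N /\ (r + s <= greedy_index (k j))%N.
  case: tail => tail.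
    (* A block of twos is almost one more copy of the tower. *)
    exists (ternary_value alpha r).+1 => // s.
    apply: filterS3 (near_greedy_index (r + s)) (near_digits (r + s)) (near_decomposition r) => j n1 n2 n3.
    split => //; have e := @greedy_rem_twos (k j) r s n1 _.
    have {}e := e (fun l hl => etrans (n2 l (andP hl).2) (tail l (andP hl).1)).
    have := greedy_remS_lt (k j) (r + s); rewrite -subnDA /kp mulSn.
    by move: n3 e; rewrite -/C; lia.
  exists (ternary_value alpha r); first exact: ternary_value_gt0.
  move=> s.
  apply: filterS3 (near_greedy_index (r + s)) (near_digits (r + s)) (near_decomposition r) => j n1 n2 n3.
  split => //; have e := @greedy_rem_zeros (k j) r s _.
  have {}e := e (fun l hl => etrans (n2 l (andP hl).2) (tail l (andP hl).1)).
  have := greedy_remS_lt (k j) (r + s); rewrite -subnDA /kp.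
  by move: n3 e; rewrite -/C; lia.
exists m, r; split => // e e0.
have [s hs] : exists s, 3^-1 ^+ s < e / 2 :> R.
  have : (3^-1 ^+ s : R) @[s --> \oo] --> (0 : R) by apply: cvg_expr; rewrite ger0_norm // invf_lt1 // ltr1n.
  have e2 : 0 < e / 2 by lra.
  by move/cvgr_lt => /(_ _ e2)[s _ /(_ s (leqnn s))]; exists s.
have d0 : 0 < e / 2 / (C + s).+1%:R by rewrite !divr_gt0 // ltr0n.
apply: filterS2 (small s) (near_width r d0) => j [h1 h2] h3.
set n := (greedy_index (k j) - r)%N in h1 h3 *.
have sn : (s <= n)%N by rewrite /n; lia.
have w0 := width_gt0 R n.
have wh : w n * (height (n - s))%:R <= 3^-1 ^+ s.
  rewrite -{1}(subnK sn) widthD mulrAC width_height exprVn ler_piMl ?invr_ge0 ?exprn_ge0 //.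
  by have := width_gt0 R (n - s); lra.
have {}h1 : `|kp m j|%N%:R <= (C + s).+1%:R + (height (n - s))%:R :> R.
  by rewrite -natrD ler_nat; apply: leq_trans h1 _; lia.
apply: le_lt_trans (ler_wpM2r (ltW w0) h1) _.
rewrite mulrDl [X in _ + X]mulrC.
move: h3; rewrite ltr_pdivlMr ?ltr0n // => h3; rewrite [X in X + _]mulrC; lra.
Qed.

Section Shift.
Hypothesis alpha_n2 : infinite_set [set l | alpha l <> 2%N].
Hypothesis alpha_n0 : infinite_set [set l | alpha l <> 0%N].

Lemma digit_le2 l : (alpha l <= 2)%N.
Proof.
rewrite leqNgt; apply/negP => l2; apply: alpha_n0.
have l3 : alpha l = 3%N by apply/eqP; rewrite eqn_leq digit_le3.
apply: (@sub_finite_set _ _ `I_l.+1) (finite_II _) => l' /= al'.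
by rewrite ltnS leqNgt; apply/negP => /(digit3_zeros l3).
Qed.

Variable P : nat -> {poly R}.
Hypothesis P_lim : forall q, coef_cvg (gap_poly R ^~ q) (P q).
Variables (N : nat) (c d : nat -> R).
Hypothesis c1 : forall i, `|c i| <= 1.
Hypothesis d1 : forall i, `|d i| <= 1.

Lemma corr_shift_cvg e : 0 < e -> \forall j \near \oo,
  `|dot (step N c \o power (- (k j)%:Z)) (step N d) -
    dot (step N c \o power (- (k j).+1%:Z)) (step N d)| < e.
Proof.
move=> e0; have e4 : 0 < e / 4 by lra.
have [r [h1 h2]] := shift_defect_decay P_lim digit_le2 alpha_n0 alpha_n2 e4.
set m := ternary_value alpha r in h1 h2; pose C := value_drift alpha r.
have d0 : 0 < e / 4 / (2 * m + C + 4)%N%:R by rewrite divr_gt0 // ltr0n addn4.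
apply: filterS3 (near_greedy_index (N + r)) (near_decomposition r) (near_width r d0) => j n1 n2 n3.
set n := (greedy_index (k j) - r)%N in n2 n3.
have Nn : (N <= n)%N by rewrite /n; lia.
have kC : (C + greedy_rem (k j) r.+1 <= height n + C)%N.
  by have := greedy_remS_lt (k j) r; rewrite -/n; lia.
have := @corr_shift_bound R P P_lim N c d c1 d1 n m _ C Nn kC.
rewrite -n2 => b; apply: le_lt_trans b _.
have {}n3 : w n * (2 * m + C + 4)%N%:R < e / 4 by rewrite -ltr_pdivlMr // ltr0n addn4.
lra.
Qed.

End Shift.

Section Factor.
Variable P : nat -> {poly R}.
Hypothesis P_lim : forall q, coef_cvg (gap_poly R ^~ q) (P q).
Variables (m r : nat).
Let kp j := ((k j)%:Z - (m * height (greedy_index (k j) - r))%N%:Z)%R.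
Hypothesis kp_small : forall e : R, 0 < e -> \forall j \near \oo,
    `|kp j|%N%:R * w (greedy_index (k j) - r) < e.
Variables (N : nat) (c d : nat -> R).
Hypothesis c1 : forall i, `|c i| <= 1.
Hypothesis d1 : forall i, `|d i| <= 1.

Lemma corr_factor_cvg e : 0 < e -> \forall j \near \oo,
  `|dot (step N c \o power (- (k j)%:Z)) (step N d) -
    \sum_(i < m.+1) (P m)`_i * dot (step N c \o power (- kp j)) (step N d \o power (- i%:Z))| < e.
Proof.
move=> e0; have e8 : 0 < e / 8 by lra.
have d0 : 0 < e / 8 / (2 * m + 1)%N%:R by rewrite divr_gt0 // ltr0n addn1.
apply: filterS3 (near_greedy_index (N + r)) (kp_small e8) (near_width r d0) => j n1 n2 n3.
set n := (greedy_index (k j) - r)%N in n2 n3.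
have Nn : (N <= n)%N by rewrite /n; lia.
have ke : (k j)%:Z = (m * height n)%N%:Z + kp j by rewrite /kp -/n; lia.
apply: le_lt_trans (@corr_factor_bound R P P_lim N c d c1 d1 n m (k j) (kp j) Nn ke) _.
have {}n3 : w n * (2 * m + 1)%N%:R < e / 8 by rewrite -ltr_pdivlMr // ltr0n addn1.
have -> : (2 * m + 2 * `|kp j| + 1)%N%:R * w n =
    w n * (2 * m + 1)%N%:R + 2 * (`|kp j|%N%:R * w n) by rewrite addnAC natrD [(2 * `|kp j|)%N%:R]natrM; ring.
lra.
Qed.

End Factor.
End Sequence.

(** * Bounded functionals and bilinear forms on L^2 *)

Section Functionals.
Variable R : realType.
Local Notation w := (@width R).
Local Notation base := (@base R).
Local Notation level := (@level R).
Local Notation L2 := (@L2 R).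
Implicit Types (f g h : R -> R) (Phi : (R -> R) -> R).

Definition L2_linear Phi : Prop := forall a f g, f \in L2 -> g \in L2 ->
  Phi (fun x => a * f x + g x) = a * Phi f + Phi g.

Lemma L2_indic (A : set R) : measurable A -> (\1_A : R -> R) \in L2.
Proof. by move=> mA; apply: (@L2_bounded _ _ 1); [exact: measurable_indic | exact: indic_le1]. Qed.

Lemma L2_indic_level n i : (\1_(level n i) : R -> R) \in L2.
Proof. by apply: L2_indic; exact: measurable_level. Qed.

Section Linear.
Variable Phi : (R -> R) -> R.
Hypothesis lin : L2_linear Phi.

Lemma L2_linear0 : Phi (cst 0) = 0.
Proof.
have := lin 1 (L2_cst 0) (L2_cst 0); rewrite mul1r.
have -> : (fun x : R => 1 * cst 0 x + cst 0 x) = (cst 0 : R -> R) by apply/funext => x /=; ring.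
by move=> h; apply: (@addrI _ (Phi (cst 0))); rewrite -h addr0.
Qed.

Lemma L2_linearB f g : f \in L2 -> g \in L2 -> Phi (fun x => f x - g x) = Phi f - Phi g.
Proof.
move=> fL gL; rewrite addrC -mulN1r -lin //; congr Phi.
by apply/funext => x; rewrite mulN1r addrC.
Qed.

Lemma L2_linear_sum (I : Type) (r : seq I) (c : I -> R) (F : I -> R -> R) :
  (forall i, F i \in L2) ->
  (fun x => \sum_(i <- r) c i * F i x) \in L2 /\
  Phi (fun x => \sum_(i <- r) c i * F i x) = \sum_(i <- r) c i * Phi (F i).
Proof.
move=> FL; elim: r => [|i r [IH1 IH2]].
  have -> : (fun x => \sum_(i <- [::]) c i * F i x) = cst 0 by apply/funext => x; rewrite big_nil.
  by rewrite big_nil L2_linear0; split => //; exact: L2_cst.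
have -> : (fun x => \sum_(i <- i :: r) c i * F i x) = (fun x => c i * F i x + \sum_(i <- r) c i * F i x).
  by apply/funext => x; rewrite big_cons.
by split; [exact: L2_lin | rewrite big_cons lin // IH2].
Qed.

Lemma L2_linear_step N c : Phi (step N c) = \sum_(i < height N) c i * Phi (\1_(level N i)).
Proof.
by have [_ <-] := @L2_linear_sum _ (index_enum 'I_(height N)) (fun i => c i)
  (fun (i : 'I_(height N)) => \1_(level N i)) (fun i => L2_indic_level N i).
Qed.

Lemma L2_linear_dense K : 0 <= K -> (forall g, g \in L2 -> `|Phi g| <= K * nrm g) ->
  (forall n i, (i < height n)%N -> Phi (\1_(level n i)) = 0) ->
  forall g, g \in L2 -> Phi g = 0.
Proof.
move=> K0 bnd lev g gL; apply/eqP; rewrite -normr_le0; apply/ler_addgt0Pr => e e0.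
have eK : 0 < e / (K + 1) by rewrite divr_gt0 //; lra.
have [N [c hc]] := step_dense gL eK.
have -> : Phi g = Phi (fun x => g x - step N c x).
  rewrite L2_linearB //; last exact: step_L2.
  by rewrite L2_linear_step big1 ?subr0 // => i _; rewrite lev // mulr0.
rewrite add0r; apply: le_trans (bnd _ (L2_sub gL (step_L2 N c))) _.
apply: le_trans (ler_wpM2l K0 (ltW hc)) _.
rewrite mulrA ler_pdivrMr; last by lra.
nra.
Qed.

End Linear.

Lemma dot_L2_linearl h : h \in L2 -> L2_linear (fun f => dot f h).
Proof. by move=> hL a f g fL gL; exact: dot_linl. Qed.

Lemma dot_L2_linearr h : h \in L2 -> L2_linear (dot h).
Proof. by move=> hL a f g fL gL; rewrite dotC dot_linl // !(dotC _ h). Qed.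

(** Levels are unions of levels of higher towers, which brings two step functions
    to a common tower. *)
Lemma step_raise N s (c : nat -> R) : exists c', step N c = step (N + s) c'.
Proof.
exists (fun j => step N c (base (N + s) j)); apply/funext => x.
have [[j [jh jx]]|h] := pselect (exists j, (j < height (N + s))%N /\ level (N + s) j x).
  rewrite (step_level _ jh jx); apply: step_refine jh jx _.
  by rewrite levelE lexx /= ltrDl width_gt0.
rewrite [RHS]step_out => [|i ih ix]; last by apply: h; exists i.
apply: step_out => i ih /(level_lt ih)/andP[x0 x1].
have [|j jh jx] := @level_ex R (N + s) x; last by apply: h; exists j.
rewrite x0 /=; apply: lt_le_trans x1 _; rewrite lerD2l lerN2 ler_wpM2r ?invr_ge0 //.
rewrite widthD ler_pdivrMr ?exprn_gt0 // ler_peMr ?exprn_ege1 ?ler1n //.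
exact/ltW/width_gt0.
Qed.

(** Uniform boundedness and density reduce weak convergence to indicators of
    levels. Both levels can be taken in one tower by [step_raise]. *)
Lemma L2_bilinear_dense (B : nat -> (R -> R) -> (R -> R) -> R) K : 0 <= K ->
  (forall j g, g \in L2 -> L2_linear (B j ^~ g)) ->
  (forall j f, f \in L2 -> L2_linear (B j f)) ->
  (forall j f g, f \in L2 -> g \in L2 -> `|B j f g| <= K * (nrm f * nrm g)) ->
  (forall N i i', (i < height N)%N -> (i' < height N)%N ->
     B j (\1_(level N i)) (\1_(level N i')) @[j --> \oo] --> (0 : R)) ->
  forall f g, f \in L2 -> g \in L2 -> B j f g @[j --> \oo] --> (0 : R).
Proof.
move=> K0 linl linr bnd lev f g fL gL; apply/cvgr0Pnorm_lt => e e0.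
have ef : 0 < e / 3 / (K * nrm g + 1).
  by rewrite divr_gt0 //; [lra | have := mulr_ge0 K0 (nrm_ge0 g); lra].
have [N1 [c1 h1]] := step_dense fL ef; set f1 := step N1 c1 in h1.
have eg : 0 < e / 3 / (K * nrm f1 + 1).
  by rewrite divr_gt0 //; [lra | have := mulr_ge0 K0 (nrm_ge0 f1); lra].
have [N2 [c2 h2]] := step_dense gL eg; set g1 := step N2 c2 in h2.
have [c1' e1] := step_raise N1 N2 c1; have [c2' e2] := step_raise N2 N1 c2.
rewrite addnC in e2.
have f1L : f1 \in L2 by exact: step_L2.
have g1L : g1 \in L2 by exact: step_L2.
have Bst : B j f1 g1 @[j --> \oo] --> (0 : R).
  have -> : (fun j => B j f1 g1) = (fun j => \sum_(i < height (N1 + N2)) \sum_(i' < height (N1 + N2))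
      c1' i * (c2' i' * B j (\1_(level (N1 + N2) i)) (\1_(level (N1 + N2) i')))).
    apply/funext => j; rewrite /f1 e1 (L2_linear_step (linl j _ g1L)); apply: eq_bigr => i _.
    rewrite /g1 e2 (L2_linear_step (linr j _ (L2_indic_level _ _))) mulr_sumr.
    by apply: eq_bigr.
  pose T i i' j := c1' i * (c2' i' * B j (\1_(level (N1 + N2) i)) (\1_(level (N1 + N2) i'))).
  have cT : \sum_(i < height (N1 + N2)) \sum_(i' < height (N1 + N2)) T i i' j @[j --> \oo] -->
      \sum_(i < height (N1 + N2)) \sum_(i' < height (N1 + N2)) c1' i * (c2' i' * 0).
    apply: (@cvg_sumr _ _ _ _ (fun (i : 'I_(height (N1 + N2))) j => \sum_(i' < height (N1 + N2)) T i i' j)) => i _.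
    apply: (@cvg_sumr _ _ _ _ (fun (i' : 'I_(height (N1 + N2))) j => T i i' j)) => i' _.
    by apply: cvgMl_tmp; apply: cvgMl_tmp; exact: lev.
  by move: cT; rewrite [X in _ --> X -> _]big1 // => i _; rewrite big1 // => i' _; rewrite !mulr0.
have e3 : 0 < e / 3 by lra.
have : \forall j \near \oo, `|B j f1 g1| < e / 3 by move/cvgr0Pnorm_lt : Bst; exact.
apply: filterS => j hj.
have s1 : B j f g = B j (fun x => f x - f1 x) g + B j f1 (fun x => g x - g1 x) + B j f1 g1.
  by rewrite (L2_linearB (linl j _ gL)) // (L2_linearB (linr j _ f1L)) //; ring.
have b1 : `|B j (fun x => f x - f1 x) g| <= e / 3.
  apply: le_trans (bnd j _ _ (L2_sub fL f1L) gL) _.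
  have g0 := nrm_ge0 g; have Kg := mulr_ge0 K0 g0.
  move: h1; rewrite ltr_pdivlMr; last by lra.
  by have := nrm_ge0 (fun x => f x - f1 x); nra.
have b2 : `|B j f1 (fun x => g x - g1 x)| <= e / 3.
  apply: le_trans (bnd j _ _ f1L (L2_sub gL g1L)) _.
  have g0 := nrm_ge0 f1; have Kg := mulr_ge0 K0 g0.
  move: h2; rewrite ltr_pdivlMr; last by lra.
  by have := nrm_ge0 (fun x => g x - g1 x); nra.
rewrite s1; apply: le_lt_trans (ler_normD _ _) _.
have := ler_normD (B j (fun x => f x - f1 x) g) (B j f1 (fun x => g x - g1 x)); lra.
Qed.

(** The levels of rank at least p exhaust the space up to a null set when the
    tower grows; on them T^p o T^-p is the identity. *)
Lemma pr_small (A : set R) (p : nat) : measurable A ->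
  (forall n i, (i + p < height n)%N -> A `&` level n (i + p) = set0) -> pr A = 0.
Proof.
move=> mA hA; apply: (@eq_width_bound _ _ _ (p.+1)%:R) => n.
rewrite subr0 ger0_norm ?pr_ge0 //.
have ih (i : 'I_(height n - p)) : (i + p < height n)%N by have := ltn_ord i; lia.
have inj : {in predT &, injective (fun i : 'I_(height n - p) => (i + p)%N)}.
  by move=> i j _ _ /addIn; exact: val_inj.
have p1 := @pr_levels R _ predT n (fun i : 'I_(height n - p) => (i + p)%N) A mA (fun i _ => ih i) inj.
have p2 := @pr_levels R _ predT n (fun i : 'I_(height n - p) => (i + p)%N) setT measurableT (fun i _ => ih i) inj.
set U := \bigcup_(i in _) _ in p1 p2.
have mU : measurable U by apply: fin_bigcup_measurable => // i _; exact: measurable_level.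
have := prIC mA mU; rewrite p1 big1 => [|i _]; last by rewrite hA // /pr measure0.
rewrite add0r => h; apply: le_trans h _.
rewrite setTI in p2.
have -> : pr U = w n * (height n - p)%N%:R.
  rewrite p2 (eq_bigr (fun=> w n)) => [|i _]; last by rewrite setTI pr_level.
  by rewrite sumr_const cardT size_enum_ord mulr_natr.
by apply: width_card; lia.
Qed.

Lemma dot_adjoint (i : nat) f g : f \in L2 -> g \in L2 ->
  dot (f \o power i%:Z) g = dot f (g \o power (- i%:Z)).
Proof.
move=> fL gL.
have gL' := L2_power (- i%:Z) gL; have fL' := L2_power i%:Z fL.
rewrite -(dot_power (- i%:Z) fL' gL).
apply: dot_ae => //; first exact: L2_power.
pose U := \bigcup_n \bigcup_(u in [set u | (u + i < height n)%N]) level n (u + i).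
have mU : measurable U.
  by apply: bigcupT_measurable => n; apply: bigcup_measurable => u _; exact: measurable_level.
exists (~` U); split.
- exact: measurableC.
- rewrite pr_fin; last exact: measurableC.
  rewrite (@pr_small _ i) //; first exact: measurableC.
  by move=> n u uh; apply/seteqP; split => // x [nU ux]; apply: nU; exists n => //; exists u.
- move=> x /= nx Ux; apply: nx => _; case: Ux => n _ [u /= uh ux].
  have uh' : (u < height n)%N by lia.
  have e1 : power (- i%:Z) x = x - base n (u + i) + base n u.
    by apply: power_level ux _ => //; rewrite PoszD addrK.
  have e2 : power i%:Z (power (- i%:Z) x) = x.
    rewrite e1 (@power_level R _ n u (u + i)) ?PoszD //; last exact: level_shift ux.
    ring.
  by move: e2 => /= ->.
Qed.

End Functionals.

(** * Representation of bounded functionals *)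

Section Riesz.
Variable R : realType.
Local Notation mu := (@chacon_prob R).
Local Notation L2 := (@L2 R).
Local Notation level := (@level R).
Implicit Types (f g h : R -> R).

Variables (Phi : (R -> R) -> R) (K : R).
Hypothesis lin : L2_linear Phi.
Hypothesis K0 : 0 <= K.
Hypothesis bnd : forall g, g \in L2 -> `|Phi g| <= K * nrm g.

Definition set_charge (A : set (measurableTypeR R)) : \bar R := (Phi (\1_A))%:E.

Let Phi_sum (F : nat -> set R) n : (forall i, measurable (F i)) ->
  (fun x => \sum_(0 <= i < n) \1_(F i) x) \in L2 /\
  Phi (fun x => \sum_(0 <= i < n) \1_(F i) x) = \sum_(0 <= i < n) Phi (\1_(F i)).
Proof.
move=> mF; have [h1 h2] := @L2_linear_sum R Phi lin _ (index_iota 0 n) (fun=> 1) (fun i => \1_(F i))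
  (fun i => L2_indic (mF i)).
have e : (fun x : R => \sum_(0 <= i < n) 1 * \1_(F i) x : R) = (fun x => \sum_(0 <= i < n) \1_(F i) x).
  by apply/funext => x; apply: eq_bigr => i _; rewrite mul1r.
by rewrite e in h1 h2; split => //; rewrite h2; apply: eq_bigr => i _; rewrite mul1r.
Qed.

Let set_charge0 : set_charge set0 = 0%E.
Proof. by rewrite /set_charge indic0 (L2_linear0 lin). Qed.

Let set_charge_fin A : measurable A -> set_charge A \is a fin_num.
Proof. by []. Qed.

Let set_charge_sigma : semi_sigma_additive set_charge.
Proof.
move=> F mF tF mU; set U := \bigcup_n F n in mU *.
pose u n x : R := \sum_(0 <= i < n) \1_(F i) x.
have uE n x : u n x = \1_(\bigcup_(i in [set i | (i < n)%N]) F i) x.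
  rewrite /u; elim: n => [|n IH].
    by rewrite big_nil indicE memNset // => -[].
  rewrite big_nat_recr //= IH !indicE.
  have [Fnx|nFnx] := pselect (F n x).
    have b1 : (x \in \bigcup_(i in [set i | (i < n)%N]) F i) = false.
      apply: memNset => -[i /= i_n Fix].
      by have e := tF i n I I (ex_intro _ x (conj Fix Fnx)); rewrite e ltnn in i_n.
    have b2 : (x \in \bigcup_(i in [set i | (i < n.+1)%N]) F i) = true.
      by apply: mem_set; exists n => /=.
    by rewrite (mem_set Fnx) b1 b2 add0r.
  rewrite (memNset nFnx) addr0; congr (_%:R); congr nat_of_bool.
  apply/idP/idP; rewrite !inE => -[i /= i_n Fix].
    by exists i => //=; rewrite ltnS ltnW.
  exists i => //=; move: i_n; rewrite ltnS leq_eqVlt => /orP[/eqP e|//].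
  by rewrite e in Fix.
have u_sub n x : `|\1_U x - u n x| <= cst 1 x :> R.
  rewrite uE !indicE /=; have [Ux|nUx] := pselect (U x).
    rewrite (mem_set Ux); case: (x \in _); rewrite ?subrr ?subr0 ?normr0 ?normr1 //.
  rewrite (memNset nUx) memNset ?subrr ?normr0 // => -[i _ Fix]; apply: nUx.
  by exists i.
have uL n : u n \in L2 by have [] := Phi_sum n mF.
have cv x : 0 <= x < 1 -> u n x @[n --> \oo] --> (\1_U x : R).
  move=> _; apply: cvg_near_cst; have [[i _ Fix]|nUx] := pselect (U x).
    exists i.+1 => // n /= i_n; rewrite uE !indicE !mem_set //; last by exists i.
    by exists i.
  apply: nearW => n; rewrite uE !indicE (memNset nUx) memNset // => -[i _ Fix].
  by apply: nUx; exists i.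
have small := L2_dct (fun n => L2_measurable (uL n)) (measurable_indic mU) (L2_cst 1) u_sub cv.
have -> : (fun n => \sum_(0 <= i < n) set_charge (F i))%E = (fun n => (Phi (u n))%:E).
  by apply/funext => n; rewrite /set_charge sumEFin; congr (_%:E); have [_ ->] := Phi_sum n mF.
apply: cvg_EFin; first exact: nearW.
apply/cvgrPdist_lt => e e0 /=.
have eK : 0 < e / (K + 1) by rewrite divr_gt0 //; have := K0; lra.
apply: filterS (small _ eK) => n hn.
rewrite -(L2_linearB lin) //; last exact: L2_indic.
apply: le_lt_trans (bnd _) _; first by apply: L2_sub => //; exact: L2_indic.
move: hn; rewrite ltr_pdivlMr; last by have := K0; lra.
by have := nrm_ge0 (fun x => \1_U x - u n x); have := K0; nra.
Qed.

Lemma le_nrm f g : f \in L2 -> g \in L2 -> (forall x, `|f x| <= `|g x|) -> nrm f <= nrm g.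
Proof.
move=> fL gL fg; rewrite /nrm ler_wsqrtr //; apply: le_Rintegral => //; try exact: L2_mul_integrable.
by move=> x _; rewrite -!expr2 -[f x ^+ 2]real_normK ?num_real // -[g x ^+ 2]real_normK ?num_real // ler_sqr // nnegrE.
Qed.

(** The set function A |-> Phi 1_A is a charge vanishing on null sets; let h be its
    density. Testing Phi on the truncation of h to the set where |h| <= M bounds
    the norm of this truncation by K, whatever M is, so that h is in L^2 by
    monotone convergence. *)
Lemma riesz : exists2 h, h \in L2 & forall g, g \in L2 -> Phi g = dot h g.
Proof.
pose nu : {charge set (measurableTypeR R) -> \bar R} :=
  HB.pack set_charge (isCharge.Build _ _ _ set_charge set_charge0 set_charge_fin set_charge_sigma).
have dom : nu `<< mu.
  apply/null_content_dominatesP => A mA A0.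
  rewrite -[LHS]/((Phi (\1_A))%:E); congr (_%:E).
  have AL := L2_indic mA.
  have n0 : nrm (\1_A : R -> R) = 0.
    rewrite /nrm (_ : dot _ _ = 0) ?sqrtr0 //.
    have -> : dot (\1_A : R -> R) (\1_A) = pr A.
      rewrite -integral_indic_pr //; apply: eq_Rintegral => x _.
      by rewrite !indicE; case: (_ \in _); rewrite ?mulr1 ?mulr0.
    by rewrite /pr A0.
  have := bnd AL; rewrite n0 mulr0 normr_le0 => /eqP //.
have hi := Radon_Nikodym_integrable dom.
have hE := fun A => @Radon_Nikodym_integral _ _ _ nu mu A dom.
have hfin x := Radon_Nikodym_fin_num x dom.
set H := Radon_Nikodym nu mu in hi hE hfin.
pose h x := fine (H x).
have HE : H = EFin \o h by apply/funext => x; rewrite /h /= fineK.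
rewrite HE in hi hE.
have mh : measurable_fun setT h by apply/measurable_EFinP; case/integrableP: hi.
have PhiA (A : set R) : measurable A -> Phi (\1_A) = \int[mu]_(x in A) h x.
  by move=> mA; rewrite /Rintegral -(hE A).
pose A M := [set x | `|h x| <= M].
have mA M : measurable (A M).
  have mN : measurable_fun setT (fun x => `|h x|) by exact: measurableT_comp.
  have -> : A M = setT `&` (fun x => `|h x|) @^-1` `]-oo, M].
    by apply/seteqP; split => x; rewrite /A /= in_itv /= => // -[].
  exact: mN.
pose hM (M : nat) x := h x * \1_(A M%:R) x.
have mhM M : measurable_fun setT (hM M) by apply: measurable_funM => //; exact: measurable_indic.
have hMb M x : `|hM M x| <= M%:R.
  rewrite /hM indicE; have [Ax|nAx] := pselect (A M%:R x); first by rewrite mem_set // mulr1.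
  by rewrite memNset // mulr0 normr0.
have hML M : hM M \in L2 by exact: (@L2_bounded _ _ M%:R (mhM M) (hMb M)).
have restr M g : g \in L2 -> (fun x => g x * \1_(A M%:R) x) \in L2 /\
    nrm (fun x => g x * \1_(A M%:R) x) <= nrm g.
  move=> gL; have rL : (fun x => g x * \1_(A M%:R) x) \in L2.
    have mg := L2_measurable gL.
    have mr : measurable_fun setT (fun x => g x * \1_(A M%:R) x).
      by apply: measurable_funM; [exact: mg | exact: measurable_indic (mA _)].
    apply: L2_intro => //; apply: (@le_integrable _ _ _ mu setT measurableT _ (fun x => (g x * g x)%:E)).
    - by apply/measurable_EFinP; exact: measurable_funM.
    - move=> x _ /=; rewrite lee_fin !normrM.
      have q1 : `|g x| * `|\1_(A M%:R) x| <= `|g x| by rewrite -[leRHS]mulr1 ler_wpM2l // indic_le1.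
      by rewrite ler_pM // mulr_ge0.
    - exact: L2_mul_integrable.
  split => //; apply: le_nrm => // x.
  by rewrite normrM -[leRHS]mulr1 ler_wpM2l // indic_le1.
have key M g : g \in L2 -> Phi (fun x => g x * \1_(A M%:R) x) = dot (hM M) g.
  move=> gL; apply/eqP; rewrite -subr_eq0; apply/eqP.
  apply: (@L2_linear_dense R (fun g => Phi (fun x => g x * \1_(A M%:R) x) - dot (hM M) g) _ (K + nrm (hM M))) => //.
  - move=> a f1 f2 f1L f2L.
    have -> : (fun x => (a * f1 x + f2 x) * \1_(A M%:R) x) =
        (fun x => a * (f1 x * \1_(A M%:R) x) + f2 x * \1_(A M%:R) x) by apply/funext => x; ring.
    rewrite (lin a (restr M _ f1L).1 (restr M _ f2L).1) (dot_L2_linearr (hML M)) //; ring.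
  - by rewrite addr_ge0 // nrm_ge0.
  - move=> f fL; apply: le_trans (ler_normB _ _) _; rewrite mulrDl; apply: lerD.
      apply: le_trans (bnd (restr M _ fL).1) _; rewrite ler_wpM2l //; exact: (restr M _ fL).2.
    exact: cauchy_schwarz.
  - move=> n i ih; have mB := @measurable_level R n i.
    have -> : (fun x => \1_(level n i) x * \1_(A M%:R) x) = (\1_(level n i `&` A M%:R) : R -> R).
      by rewrite indicI.
    rewrite PhiA; last exact: (measurableI _ _ mB (mA _)).
    rewrite Rintegral_mkcond /dot (_ : \int[mu]_x (_ \_ _) x = \int[mu]_x (hM M x * \1_(level n i) x)) ?subrr //.
    apply: eq_Rintegral => x _; rewrite /patch /hM in_setI !indicE.
    by case: (x \in level n i); case: (x \in A _) => /=; rewrite ?mulr1 ?mulr0.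
have hMK M : dot (hM M) (hM M) <= K ^+ 2.
  have e : Phi (hM M) = dot (hM M) (hM M).
    rewrite -(key M _ (hML M)); congr Phi; apply/funext => x.
    by rewrite /hM indicE; case: (_ \in _); rewrite ?mulr1 ?mulr0.
  have := le_trans (ler_norm _) (bnd (hML M)); rewrite e -nrm_sq.
  by have := nrm_ge0 (hM M); have := K0; nra.
have hL : h \in L2.
  apply: L2_intro => //; apply/integrableP; split.
    by apply/measurable_EFinP; exact: measurable_funM.
  pose G (n : nat) x := (hM n x * hM n x)%:E.
  have mG n : measurable_fun setT (G n) by apply/measurable_EFinP; exact: measurable_funM.
  have G0 n x : setT x -> (0 <= G n x)%E by move=> _; rewrite lee_fin -expr2 sqr_ge0.
  have ndG x : setT x -> nondecreasing_seq (G^~ x).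
    move=> _ p q pq; rewrite /G /hM lee_fin !indicE.
    have [Ax|nAx] := pselect (A p%:R x).
      rewrite !mem_set //; apply: le_trans Ax _; by rewrite ler_nat.
    by rewrite [in leLHS]memNset // mulr0 mul0r -expr2 sqr_ge0.
  have := @monotone_convergence _ _ _ mu setT measurableT G mG G0 ndG.
  have -> : (fun x => limn (G^~ x)) = (fun x => (h x * h x)%:E).
    apply/funext => x; apply/cvg_lim => //; apply: cvg_near_cst.
    exists (Num.bound `|h x|) => // n /= hn; rewrite /G /hM indicE mem_set ?mulr1 //=.
    by apply/ltW; apply: lt_le_trans (archi_boundP (normr_ge0 _)) _; rewrite ler_nat.
  move=> e; rewrite (eq_integral (fun x => (h x * h x)%:E)); last first.
    by move=> x _; rewrite /= ger0_norm // -expr2 sqr_ge0.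
  rewrite e; apply: le_lt_trans (ltry (K ^+ 2)).
  apply: lime_le.
    apply: ereal_nondecreasing_is_cvgn => p q pq; apply: ge0_le_integral => //.
    all: try (exact: G0); try (exact: mG).
    by move=> x _; exact: ndG.
  apply: nearW => n; rewrite -[leLHS]fineK ?lee_fin; first exact: hMK.
  by apply: integrable_fin_num => //; exact: L2_mul_integrable.
exists h => // g gL; apply/eqP; rewrite -subr_eq0; apply/eqP.
apply: (@L2_linear_dense R (fun g => Phi g - dot h g) _ (K + nrm h)) => //.
- move=> a f1 f2 f1L f2L; rewrite lin // (dot_L2_linearr hL) //; ring.
- by rewrite addr_ge0 // nrm_ge0.
- move=> f fL; apply: le_trans (ler_normB _ _) _; rewrite mulrDl; apply: lerD; first exact: bnd.
  exact: cauchy_schwarz.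
- move=> n i ih; rewrite PhiA; last exact: measurable_level.
  rewrite Rintegral_mkcond /dot (_ : \int[mu]_x (_ \_ _) x = \int[mu]_x (h x * \1_(level n i) x)) ?subrr //.
  apply: eq_Rintegral => x _; rewrite /patch indicE.
  by case: (x \in level n i); rewrite ?mulr1 ?mulr0.
Qed.

End Riesz.

(** * Weak compactness of the powers of the Koopman operator *)

Section WeakCompactness.
Variable R : realType.
Local Notation mu := (@chacon_prob R).
Local Notation L2 := (@L2 R).
Local Notation level := (@level R).
Implicit Types (f g h : R -> R).

(** Along an ultrafilter, a cluster point is a limit. *)
Lemma ultra_bounded_cvg (U : set_system nat) (UU : UltraFilter U) (u : nat -> R) b :
  (forall j, `|u j| <= b) -> u j @[j --> U] --> lim (u j @[j --> U]).
Proof.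
move=> ub.
have [p [_ clp]] : `[- b, b]%classic `&` cluster (u j @[j --> U]) !=set0.
  apply: (@segment_compact R (- b) b) => /=.
  by apply: filterE => j /=; rewrite in_itv /= -ler_norml.
apply/cvg_ex; exists p => A Ap.
have [//|nA] := in_ultra_setVsetC (u @^-1` A) UU.
by have [y [nAy Ay]] := clp (~` A) A nA Ap.
Qed.

Lemma dot_power_bound (k : int) f g : f \in L2 -> g \in L2 ->
  `|dot (f \o power k) g| <= nrm f * nrm g.
Proof.
by move=> fL gL; apply: le_trans (cauchy_schwarz (L2_power k fL) gL) _; rewrite nrm_power.
Qed.

Lemma L2_linear_dot_power (k : int) g : g \in L2 ->
  L2_linear (fun f => dot (f \o power k) g).
Proof.
move=> gL a f1 f2 f1L f2L.
exact: (dot_linl a (L2_power k f1L) (L2_power k f2L) gL).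
Qed.

Lemma L2_bilinear_repr (B : (R -> R) -> (R -> R) -> R) :
  (forall g, g \in L2 -> L2_linear (B ^~ g)) -> (forall f, f \in L2 -> L2_linear (B f)) ->
  (forall f g, f \in L2 -> g \in L2 -> `|B f g| <= nrm f * nrm g) ->
  exists2 M, L2_operator M &
    forall f g, f \in L2 -> g \in L2 -> B f g = dot (M f) g.
Proof.
move=> linl linr bnd.
have /choice[M MP] f : exists h, f \in L2 -> h \in L2 /\ forall g, g \in L2 -> B f g = dot h g.
  have [fL|//] := boolP (f \in L2); last by exists (cst 0).
  by have [h hL hE] := riesz (linr f fL) (nrm_ge0 f) (fun g gL => bnd f g fL gL); exists h.
exists M; last by move=> f g fL gL; have [_ ->] := MP f fL.
split.
- by move=> f fL; have [] := MP f fL.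
- move=> a f g fL gL.
  have abL := L2_lin a fL gL; have [hL hE] := MP _ abL.
  have [fL' fE] := MP _ fL; have [gL' gE] := MP _ gL.
  apply: L2_eq_dot => //; first exact: L2_lin.
  by move=> x xL; rewrite -hE // (linl x xL) // fE // gE // dot_linl.
- exists 1 => f fL; have [hL hE] := MP _ fL.
  rewrite mul1e !Lnorm_nrm // lee_fin.
  have := le_trans (ler_norm _) (bnd f (M f) fL hL); rewrite hE // -nrm_sq.
  by have := nrm_ge0 (M f); have := nrm_ge0 f; nra.
Qed.

(** Limits along an ultrafilter define a bilinear form at once. The subsequence
    is then extracted so as to approximate this form within 1 / (q + 1) on the
    levels of rank at most q of the towers of index at most q. *)
Lemma koopman_weak_compact (k : nat -> int) : exists jj : nat -> nat,
  (forall q, (q <= jj q)%N) /\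
  exists2 M, L2_operator M & weak_cvg (fun q => @koopman_pow R (- k (jj q))) M.
Proof.
have [U [UU oU]] := ultraFilterLemma (eventually_filter : ProperFilter eventually).
pose B j f g := dot (f \o power (- k j)) g.
pose ell f g := lim (B j f g @[j --> U]).
have Bb j f g : f \in L2 -> g \in L2 -> `|B j f g| <= nrm f * nrm g by exact: dot_power_bound.
have cB f g : f \in L2 -> g \in L2 -> B j f g @[j --> U] --> ell f g.
  by move=> fL gL; apply: (ultra_bounded_cvg UU) => j; exact: Bb.
have Bl j g : g \in L2 -> L2_linear (B j ^~ g) by exact: L2_linear_dot_power.
have Br j f : f \in L2 -> L2_linear (B j f).
  by move=> fL; apply: dot_L2_linearr; exact: L2_power.
have ell_l g : g \in L2 -> L2_linear (ell ^~ g).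
  move=> gL a f1 f2 f1L f2L; have c := cB _ _ (L2_lin a f1L f2L) gL.
  apply: (cvg_unique _ c) => //.
  have -> : (fun j => B j (fun x => a * f1 x + f2 x) g) = (fun j => a * B j f1 g + B j f2 g).
    by apply/funext => j; rewrite (Bl j g gL).
  by apply: cvgD; [apply: cvgMl_tmp; exact: cB | exact: cB].
have ell_r f : f \in L2 -> L2_linear (ell f).
  move=> fL a g1 g2 g1L g2L; have c := cB _ _ fL (L2_lin a g1L g2L).
  apply: (cvg_unique _ c) => //.
  have -> : (fun j => B j f (fun x => a * g1 x + g2 x)) = (fun j => a * B j f g1 + B j f g2).
    by apply/funext => j; rewrite (Br j f fL).
  by apply: cvgD; [apply: cvgMl_tmp; exact: cB | exact: cB].
have ell_b f g : f \in L2 -> g \in L2 -> `|ell f g| <= nrm f * nrm g.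
  move=> fL gL; apply/ler_addgt0Pr => e e0.
  have /cvgrPdist_lt/(_ _ e0)/filter_ex[j hj] := cB _ _ fL gL.
  have := ler_normD (ell f g - B j f g) (B j f g); rewrite subrK.
  have := Bb j f g fL gL; lra.
have /choice[jj jjP] (q : nat) : exists j, (q <= j)%N /\ forall N i i', (N <= q)%N -> (i <= q)%N ->
    (i' <= q)%N -> `|ell (\1_(level N i)) (\1_(level N i')) -
                     B j (\1_(level N i)) (\1_(level N i'))| < q.+1%:R^-1.
  have h1 : \forall j \near U, (q <= j)%N by apply: oU; exists q.
  have h2 : \forall j \near U, forall t : 'I_q.+1 * 'I_q.+1 * 'I_q.+1,
      `|ell (\1_(level t.1.1 t.1.2)) (\1_(level t.1.1 t.2)) -
        B j (\1_(level t.1.1 t.1.2)) (\1_(level t.1.1 t.2))| < q.+1%:R^-1.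
    apply: filter_forall => t.
    have c := cB _ _ (@L2_indic_level R t.1.1 t.1.2) (@L2_indic_level R t.1.1 t.2).
    by move/cvgrPdist_lt : c; apply; rewrite invr_gt0 ltr0n.
  have [j [hj1 hj2]] := filter_ex (filterI h1 h2).
  exists j; split => // N i i' hN hi hi'.
  exact: (hj2 (@Ordinal q.+1 N hN, @Ordinal q.+1 i hi, @Ordinal q.+1 i' hi')).
exists jj; split; first by move=> q; have [] := jjP q.
have [M Mop ME] := L2_bilinear_repr ell_l ell_r ell_b.
exists M => // f g fL gL.
pose D q f g := ell f g - B (jj q) f g.
have D0 : D q f g @[q --> \oo] --> (0 : R).
  apply: (@L2_bilinear_dense R D 2) => //.
  - by move=> q x xL a f1 f2 f1L f2L; rewrite /D (ell_l x xL) // (Bl _ x xL) //; ring.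
  - by move=> q x xL a f1 f2 f1L f2L; rewrite /D (ell_r x xL) // (Br _ x xL) //; ring.
  - move=> q x y xL yL; apply: le_trans (ler_normB _ _) _.
    by have := ell_b x y xL yL; have := Bb (jj q) x y xL yL; lra.
  - move=> N i i' ih ih'; apply/cvgr0Pnorm_lt => e e0.
    have e1 : \forall q \near \oo, q.+1%:R^-1 < e.
      exact: (near_infty_natSinv_lt (PosNum e0)).
    near=> q; apply: lt_trans (_ : q.+1%:R^-1 < _); last by near: q.
    have [_ h] := jjP q; apply: h; near: q; exact: nbhs_infty_ge.
have -> : (fun q => \int[mu]_x (koopman_pow (- k (jj q)) f x * g x)) =
    (fun q => ell f g - D q f g).
  by apply/funext => q; rewrite /D opprB addrC subrK koopman_powE.
rewrite -[X in _ --> X]/(dot (M f) g) -ME // -[X in _ --> X]subr0.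
by apply: cvgB => //; exact: cvg_cst.
Unshelve. all: by end_near.
Qed.

End WeakCompactness.

(** * Identification of the limit *)

Section Invariant.
Variable R : realType.
Local Notation w := (@width R).
Local Notation mu := (@chacon_prob R).
Local Notation L2 := (@L2 R).
Local Notation level := (@level R).
Implicit Types (f g h : R -> R).

Lemma indic_step N i : (i < height N)%N ->
  (\1_(level N i) : R -> R) = step N (fun j => (j == i)%:R).
Proof.
move=> ih; apply/funext => x; rewrite /step (bigD1 (Ordinal ih)) //= eqxx mul1r.
by rewrite big1 ?addr0 // => j /negbTE ji; rewrite (_ : (j == i :> nat) = false) ?mul0r // -ji.
Qed.

Lemma dot_indic (A B : set R) : measurable A -> measurable B ->
  dot (\1_A) (\1_B) = pr (A `&` B).
Proof.
move=> mA mB; rewrite -integral_indic_pr; last exact: measurableI.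
by apply: eq_Rintegral => x _; rewrite indicI.
Qed.

(** T maps level i onto level i + 1 up to a null set: the indicators u of the image
    and v of level i + 1 have the same norm, and u v = v. *)
Lemma dot_invariant_level h n i : h \in L2 ->
  (forall g, g \in L2 -> dot h (g \o power (- 1)) = dot h g) -> (i < height n)%N ->
  dot h (\1_(level n i)) = dot h (\1_(level n 0)).
Proof.
move=> hL inv; elim: i => // i IH ih; rewrite -IH; last by lia.
have ih' : (i < height n)%N by lia.
have vL := @L2_indic_level R n i.+1; have uL' := @L2_indic_level R n i.
rewrite -(inv _ uL'); set u := _ \o _; set v := \1_ _.
have uL : u \in L2 by exact: L2_power.
apply/eqP; rewrite -subr_eq0 -normr_le0 -dotBr //.
apply: le_trans (cauchy_schwarz hL (L2_sub vL uL)) _.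
rewrite [X in _ * X](_ : _ = 0) ?mulr0 // /nrm (_ : dot _ _ = 0) ?sqrtr0 //.
have uvL := L2_sub vL uL.
rewrite dotBl // !dotBr // [dot u v]dotC.
have -> : dot u u = w n.
  by rewrite dot_power // dot_indic ?setIid ?pr_level //; exact: measurable_level.
have vv : dot v v = w n.
  by rewrite dot_indic ?setIid ?pr_level //; exact: measurable_level.
have -> : dot v u = dot v v; last by rewrite vv; ring.
apply: eq_Rintegral => x _; rewrite /v indicE; have [vx|nvx] := pselect (level n i.+1 x).
  rewrite mem_set // !mul1r -[u x]/(\1_(level n i) (power (- 1) x)).
  rewrite (@power_level R _ n i.+1 i) //; last by lia.
  by rewrite indicE mem_set //; exact: level_shift vx.
by rewrite memNset // !mul0r.
Qed.

(** Ergodicity. The scalar product with the indicator of a level of Tower n depends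
    on n only; cutting the level of Tower 0 into levels of Tower n shows that it is
    proportional to the width, as for a constant function. *)
Lemma invariant_cst h : h \in L2 ->
  (forall g, g \in L2 -> dot h (g \o power (- 1)) = dot h g) ->
  L2_eq h (cst (dot h (cst 1))).
Proof.
move=> hL inv.
have lev := fun n i => @dot_invariant_level h n i hL inv.
have one i n : (i < height n)%N -> dot (cst 1) (\1_(level n i)) = w n.
  move=> ih; rewrite -(pr_level R ih) -integral_indic_pr; last exact: measurable_level.
  by apply: eq_Rintegral => x _; rewrite mul1r.
pose kap := dot h (\1_(level 0 0)) / w 0.
have levk n i : (i < height n)%N -> dot h (\1_(level n i)) = kap * w n.
  move=> ih; rewrite lev //; have h0 : (0 < height 0)%N by [].
  have [c ce] := step_raise 0 n (fun j => (j == 0)%:R : R).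
  have e1 : dot h (\1_(level 0 0)) = dot h (\1_(level n 0)) * \sum_(j < height n) c j.
    rewrite (indic_step h0) ce (L2_linear_step (dot_L2_linearr hL)) mulr_sumr.
    by apply: eq_bigr => j _; rewrite lev // mulrC.
  have e2 : w 0 = w n * \sum_(j < height n) c j.
    rewrite -(one _ _ h0) (indic_step h0) ce (L2_linear_step (dot_L2_linearr (L2_cst 1))) mulr_sumr.
    by apply: eq_bigr => j _; rewrite one // mulrC.
  have w0 := width_gt0 R 0; have wn := width_gt0 R n.
  have c0 : \sum_(j < height n) c j != 0 by apply/eqP => c0; rewrite e2 c0 mulr0 ltxx in w0.
  by rewrite /kap e1 e2; field; rewrite c0 gt_eqF.
have cL a : (cst a : R -> R) \in L2 by exact: L2_cst.
have all g : g \in L2 -> dot h g = dot (cst kap) g.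
  move=> gL; apply/eqP; rewrite -subr_eq0 -dotBl //; apply/eqP.
  have dL := L2_sub hL (cL kap).
  apply: (L2_linear_dense (dot_L2_linearr dL) (nrm_ge0 _)) => //.
    by move=> f fL; exact: cauchy_schwarz.
  move=> n i ih; have lL := @L2_indic_level R n i.
  rewrite dotBl // levk // -(one i n ih) -dotZl //.
  by rewrite (_ : (fun x => kap * cst 1 x) = cst kap) ?subrr //; apply/funext => x /=; rewrite mulr1.
rewrite (all _ (cL 1)).
have -> : dot (cst kap) (cst 1) = kap.
  rewrite -[dot _ _]/(\int[mu]_x cst (kap * 1) x) Rintegral_cst //= mulr1.
  by rewrite chacon_prob_setT mulr1.
by apply: L2_eq_dot.
Qed.

End Invariant.

Section Limits.
Variables (R : realType) (k : nat -> nat).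
Hypothesis k_gt0 : forall j, (0 < k j)%N.
Hypothesis k_infty : k j @[j --> \oo] --> \oo.
Variable alpha : nat -> nat.
Hypothesis k_alpha : forall l, \forall j \near \oo, greedy_digit (k j) l = alpha l.
Variable P : nat -> {poly R}.
Hypothesis P_lim : forall q, coef_cvg (gap_poly R ^~ q) (P q).
Variable L : (R -> R) -> (R -> R).
Hypothesis L_op : L2_operator L.
Hypothesis k_L : weak_cvg (fun j => koopman_pow (- (k j)%:Z)) L.
Local Notation mu := (@chacon_prob R).
Local Notation L2 := (@L2 R).

Lemma delta_le1 i (j : nat) : `|(j == i)%:R| <= 1 :> R.
Proof. by case: (_ == _); rewrite ?normr1 ?normr0. Qed.

Lemma weak_limit_dot f g : f \in L2 -> g \in L2 ->
  dot (f \o power (- (k j)%:Z)) g @[j --> \oo] --> dot (L f) g.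
Proof.
move=> fL gL; have := k_L fL gL.
by under eq_fun do rewrite koopman_powE.
Qed.

(** The correlations at times k_j and k_j + 1 have the same limit, so L f is
    invariant; its constant value is the limit of the integrals of
    f o T^-k_j. *)
Lemma weak_limit_Theta :
  infinite_set [set l | alpha l <> 2%N] -> infinite_set [set l | alpha l <> 0%N] ->
  L2_operator_eq L (@Theta R).
Proof.
move=> n2 n0 f fL.
have LfL : L f \in L2 by exact: L2_operator_stable.
pose B j (f g : R -> R) := dot (f \o power (- (k j)%:Z)) g - dot (f \o power (- (k j).+1%:Z)) g.
have B0 f1 g : f1 \in L2 -> g \in L2 -> B j f1 g @[j --> \oo] --> (0 : R).
  apply: (@L2_bilinear_dense R B 2) => //.
  - move=> j x xL a f2 f3 f2L f3L; rewrite /B !(L2_linear_dot_power _ xL) //; ring.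
  - move=> j x xL a f2 f3 f2L f3L; rewrite /B !(dot_L2_linearr (L2_power _ xL)) //; ring.
  - move=> j x y xL yL; apply: le_trans (ler_normB _ _) _.
    have := dot_power_bound (- (k j)%:Z) xL yL.
    by have := dot_power_bound (- (k j).+1%:Z) xL yL; lra.
  - move=> N i i' ih ih'; apply/cvgr0Pnorm_lt => e e0; rewrite /B (indic_step R ih) (indic_step R ih').
    have := @corr_shift_cvg R k k_infty alpha k_alpha n2 n0 P P_lim N _ _ (delta_le1 i) (delta_le1 i') e e0; exact.
have powS j : f \o power (- (k j).+1%:Z) = (f \o power (- (k j)%:Z)) \o power (- 1).
  apply/funext => x; case: (k j) (k_gt0 j) => // q _.
  by rewrite -[LHS]/(f (iter q.+2 (@chacon_inv R) x)) iterSr.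
have inv g : g \in L2 -> dot (L f) (g \o power (- 1)) = dot (L f) g.
  move=> gL; have gL' := L2_power (- 1) gL.
  have c := cvgB (weak_limit_dot fL gL') (weak_limit_dot fL gL).
  have {}c : B j f (g \o power (- 1)) @[j --> \oo] --> dot (L f) (g \o power (- 1)) - dot (L f) g.
    have -> : (fun j => B j f (g \o power (- 1))) =
        (fun j => dot (f \o power (- (k j)%:Z)) (g \o power (- 1)) - dot (f \o power (- (k j)%:Z)) g).
      by apply/funext => j; rewrite /B powS dot_power //; exact: L2_power.
    exact: c.
  by apply/eqP; rewrite -subr_eq0; apply/eqP; exact: (cvg_unique _ c (B0 _ _ fL gL')).
have := invariant_cst LfL inv; rewrite (_ : dot _ _ = \int[mu]_x f x) //.
have oL := L2_cst (1 : R).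
apply: (cvg_unique _ (weak_limit_dot fL oL)) => //.
have -> : (fun j => dot (f \o power (- (k j)%:Z)) (cst 1)) = cst (\int[mu]_x f x); last exact: cvg_cst.
apply/funext => j; rewrite -[cst 1]/(cst 1 \o power (- (k j)%:Z)) dot_power //.
by apply: eq_Rintegral => x _; rewrite mulr1.
Qed.

Lemma iter_koopman i (f : R -> R) : iter i (@koopman R) f = f \o power i%:Z.
Proof.
elim: i => // i IH; apply/funext => x.
by rewrite iterS IH /koopman /= -iterSr.
Qed.

(** Along a subsequence where T^-k'_j converges to L', the approximation of
    T^-k_j by P_m(T) T^-k'_j identifies L, which is the limit along any
    subsequence. *)
Lemma weak_limit_factor :
  (exists r, (forall l, (r < l)%N -> alpha l = 2%N) \/ (forall l, (r < l)%N -> alpha l = 0%N)) ->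
  exists (m : nat) (k' : nat -> int) (L' : (R -> R) -> (R -> R)),
     [/\ (1 <= m)%N, L2_operator L', weak_cvg (fun j => koopman_pow (- k' j)) L' &
         L2_operator_eq L (fun f => poly_op (P m) (@koopman R) (L' f))].
Proof.
move=> /(small_remainder R k_gt0 k_infty k_alpha)[m [r [m1 small]]].
pose kp j : int := (k j)%:Z - (m * height (greedy_index (k j) - r))%N%:Z.
have [jj [jjq [L' L'op L'w]]] := @koopman_weak_compact R kp.
exists m, (kp \o jj), L'; split => // f fL.
have L'fL : L' f \in L2 by exact: L2_operator_stable.
have LfL : L f \in L2 by exact: L2_operator_stable.
pose D j (f g : R -> R) := dot (f \o power (- (k j)%:Z)) g -
  \sum_(i < m.+1) (P m)`_i * dot (f \o power (- kp j)) (g \o power (- i%:Z)).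
have D0 f1 g : f1 \in L2 -> g \in L2 -> D j f1 g @[j --> \oo] --> (0 : R).
  apply: (@L2_bilinear_dense R D (1 + \sum_(i < m.+1) `|(P m)`_i|)) => //.
  - by rewrite addr_ge0 // sumr_ge0.
  - move=> j x xL a f2 f3 f2L f3L; rewrite /D (L2_linear_dot_power _ xL) //.
    rewrite (eq_bigr (fun i : 'I_m.+1 => a * ((P m)`_i * dot (f2 \o power (- kp j)) (x \o power (- i%:Z))) +
      (P m)`_i * dot (f3 \o power (- kp j)) (x \o power (- i%:Z)))).
      by rewrite big_split /= -mulr_sumr; ring.
    by move=> i _; rewrite (L2_linear_dot_power _ (L2_power _ xL)) //; ring.
  - move=> j x xL a f2 f3 f2L f3L; rewrite /D (dot_L2_linearr (L2_power _ xL)) //.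
    rewrite (eq_bigr (fun i : 'I_m.+1 => a * ((P m)`_i * dot (x \o power (- kp j)) (f2 \o power (- i%:Z))) +
      (P m)`_i * dot (x \o power (- kp j)) (f3 \o power (- i%:Z)))).
      by rewrite big_split /= -mulr_sumr; ring.
    move=> i _; rewrite -[dot _ (_ \o power (- i%:Z))]/(dot _ (fun y => a * (f2 \o power (- i%:Z)) y + (f3 \o power (- i%:Z)) y)).
    by rewrite (dot_L2_linearr (L2_power _ xL)); [ring | exact: L2_power..].
  - move=> j x y xL yL; apply: le_trans (ler_normB _ _) _; rewrite mulrDl mul1r; apply: lerD.
      exact: dot_power_bound.
    rewrite mulr_suml; apply: le_trans (ler_norm_sum _ _ _) _; apply: ler_sum => i _.
    rewrite normrM ler_wpM2l //.
    by apply: le_trans (dot_power_bound _ xL (L2_power _ yL)) _; rewrite nrm_power.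
  - move=> N i i' ih ih'; apply/cvgr0Pnorm_lt => e e0; rewrite /D (indic_step R ih) (indic_step R ih').
    have := @corr_factor_cvg R k k_infty P P_lim m r small N _ _ (delta_le1 i) (delta_le1 i') e e0; exact.
pose M x := \sum_(i < m.+1) (P m)`_i * (L' f \o power i%:Z) x.
have -> : poly_op (P m) (@koopman R) (L' f) = M.
  apply/funext => x; rewrite /poly_op /M.
  rewrite (eq_bigr (fun i : 'I_(size (P m)) => (P m)`_i * (L' f \o power i%:Z) x)) => [|i _]; last first.
    by rewrite iter_koopman.
  rewrite (big_ord_widen _ (fun i => (P m)`_i * (L' f \o power i%:Z) x) (size_gap_law P_lim m)).
  rewrite [RHS](bigID (fun i : 'I_m.+1 => (i < size (P m))%N)) /= [X in _ + X]big1 ?addr0 // => i.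
  by rewrite -leqNgt => hi; rewrite nth_default // mul0r.
have Msum g (gL : g \in L2) := @L2_linear_sum R _ (dot_L2_linearl gL) _ (index_enum 'I_m.+1)
  (fun i => (P m)`_i) (fun i => L' f \o power i%:Z) (fun i => L2_power i%:Z L'fL).
apply: L2_eq_dot => //; first by have [] := Msum _ L'fL.
move=> g gL; have [_ ->] := Msum g gL.
have jj_infty : jj q @[q --> \oo] --> \oo.
  by move=> A [n _ nA]; exists n => // q /= nq; apply: nA => /=; exact: leq_trans nq (jjq q).
have c1 := cvg_comp _ _ jj_infty (weak_limit_dot fL gL).
have c2 := cvg_comp _ _ jj_infty (D0 _ _ fL gL).
pose S q := \sum_(i < m.+1) (P m)`_i * dot (f \o power (- kp (jj q))) (g \o power (- i%:Z)).
have c : S q @[q --> \oo] --> dot (L f) g.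
  have -> : S = (fun q => dot (f \o power (- (k (jj q))%:Z)) g - D (jj q) f g).
    by apply/funext => q; rewrite /D opprB addrC subrK.
  by rewrite -[X in _ --> X]subr0; exact: cvgB c1 c2.
apply: (cvg_unique _ c) => //.
apply: (@cvg_sumr _ _ _ _ (fun (i : 'I_m.+1) q => (P m)`_i * dot (f \o power (- kp (jj q))) (g \o power (- i%:Z)))) => i _.
apply: cvgMl_tmp; rewrite dot_adjoint //.
have := L'w f (g \o power (- i%:Z)) fL (L2_power _ gL).
by under eq_fun do rewrite koopman_powE.
Qed.

End Limits.

Theorem proposition5p6 (R : realType)
    (lam : probability z3 R) (lam_haar : z3_haar lam)
    (k : nat -> nat) (k_gt0 : forall j, (0 < k j)%N)
    (k_infty : k j @[j --> \oo] --> \oo)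
    (L : (R -> R) -> (R -> R)) (L_op : L2_operator L)
    (k_L : weak_cvg (fun j => koopman_pow (- (k j)%:Z)) L)
    (alpha : nat -> nat)
    (k_alpha : forall l, \forall j \near \oo, greedy_digit (k j) l = alpha l) :
  ((exists r, (forall l, (r < l)%N -> alpha l = 2%N) \/
              (forall l, (r < l)%N -> alpha l = 0%N)) ->
   exists (m : nat) (k' : nat -> int) (L' : (R -> R) -> (R -> R)),
     [/\ (1 <= m)%N,
         L2_operator L',
         weak_cvg (fun j => koopman_pow (- k' j)) L' &
         L2_operator_eq L
           (fun f => poly_op (chacon_poly lam m) (@koopman R) (L' f))]) /\
  (infinite_set [set l | alpha l <> 2%N] ->
   infinite_set [set l | alpha l <> 0%N] ->
   L2_operator_eq L (@Theta R)).
Proof.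
have P_lim := chacon_poly_gap lam_haar; split.
- exact: (weak_limit_factor k_gt0 k_infty k_alpha P_lim L_op k_L).
- exact: (weak_limit_Theta k_gt0 k_infty k_alpha P_lim L_op k_L).
Qed.
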